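(* Let $0<a<\infty$, $q\in L^1(-a,a)$, $L=\frac{d^2}{dx^2}-q$, $\Omega=[-a,a]\times[-a,a]$, and let $\Omega_1$ be the closed square in the $(u,v)$-plane with vertices $(-a,0),(0,a),(a,0),(0,-a)$. Let $H\in C(\Omega_1)$ be the unique solution of $$H(u,v)=\frac12\int_0^u q(s)\,ds+\int_0^u\int_0^v q(\alpha+\beta)H(\alpha,\beta)\,d\beta\,d\alpha,\qquad (u,v)\in\Omega_1 .$$ Then $K(x,t)=H\left(\frac{x+t}{2},\frac{x-t}{2}\right)$, $(x,t)\in\Omega$, is a weak solution of the Goursat problem $$\left(\frac{\partial^2}{\partial x^2}-q(x)\right)K(x,t)=\frac{\partial^2}{\partial t^2}K(x,t)\ \text{ in }\Omega,\qquad K(x,x)=\frac12\int_0^x q(s)\,ds,\quad K(x,-x)=0,$$ and $$\mathbf{T}u(x)=u(x)+\int_{-x}^{x}K(x,t)u(t)\,dt$$ is a standard transmutation operator on $W^{2,1}(-a,a)$ corresponding to $L$. The corresponding $L$-base $\alpha_k:=\mathbf{T}[x^k]$ satisfies $\alpha_0(0)=\alpha_1'(0)=1$ and $\alpha_0'(0)=\alpha_1(0)=0$. Moreover, $\mathbf{T}$ is invertible (on $L^1(-a,a)$) and $$\mathbf{T}^{-1}u(x)=u(x)-\int_{-x}^{x}K(t,x)u(t)\,dt .$$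
   Context: All functions are complex valued; $\mathbb{N}_0=\{0,1,2,\dots\}$. Elements of $W^{2,1}(-a,a)$ are identified with their $C^1[-a,a]$ representatives. For $x<0$, $\int_{-x}^{x}=-\int_{x}^{-x}$. The integral equation for $H$ has a unique solution in $C(\Omega_1)$, and it also belongs to $W^{1,1}(\Omega_1)$. A weak solution of the Goursat problem means: $K\in C(\Omega)\cap W^{1,1}(\Omega)$ satisfies $\iint_\Omega\left[(\partial_tK)\,\partial_t\varphi-(\partial_xK)\,\partial_x\varphi-q(x)K\varphi\right]dx\,dt=0$ for all $\varphi\in C_c^\infty(\Omega)$ (smooth with compact support in the interior of $\Omega$), together with the stated conditions on $t=x$ and $t=-x$. A linear map $T$ with domain $D_T$ is a transmutation operator corresponding to $L$ on $\chi\subseteq W^{2,1}(-a,a)$ if for every $u\in\chi$ we have $u''\in D_T$, $Tu\in W^{2,1}(-a,a)$ and $\left(\frac{d^2}{dx^2}-q\right)Tu=Tu''$. An $L$-base is a system $\{\varphi_k\}_{k\in\mathbb{N}_0}$ with $\varphi_k''-q\varphi_k=0$ for $k=0,1$ and $\varphi_k''-q\varphi_k=k(k-1)\varphi_{k-2}$ for $k\ge2$, in the weak sense (equivalently $\varphi_k\in W^{2,1}(-a,a)$ and the equations hold a.e.). It is standard if $\varphi_k(0)=\varphi_k'(0)=0$ for all $k\ge2$. A transmutation operator $T$ on a set containing the polynomials is standard if $\{T[x^k]\}_{k\in\mathbb{N}_0}$ is a standard $L$-base. *)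

(* Defs.v *)
From HB Require Import structures.
From mathcomp Require Import all_boot all_order all_algebra.
From mathcomp Require Import complex.
From mathcomp Require Import all_classical all_reals all_analysis.

Set Implicit Arguments.
Unset Strict Implicit.
Unset Printing Implicit Defensive.

Import Order.TTheory GRing.Theory Num.Theory.
Import numFieldNormedType.Exports.

Local Open Scope classical_set_scope.
Local Open Scope ring_scope.
Local Open Scope complex_scope.

(* Topology, differentiation and integration of complex valued functions are
   componentwise; R[i] itself is only used for its field structure. *)

Definition re {T : Type} {R : realType} (f : T -> R[i]) : T -> R :=
  fun x => complex.Re (f x).
Definition im {T : Type} {R : realType} (f : T -> R[i]) : T -> R :=
  fun x => complex.Im (f x).

Definition ccontinuous_on {R : realType} {T : topologicalType}
    (A : set T) (f : T -> R[i]) : Prop :=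
  {within A, continuous (re f)} /\ {within A, continuous (im f)}.

Definition cintegrable {R : realType} {d : measure_display}
    {T : measurableType d} (mu : set T -> \bar R) (D : set T)
    (f : T -> R[i]) : Prop :=
  mu.-integrable D (EFin \o re f) /\ mu.-integrable D (EFin \o im f).

Definition cint {R : realType} {d : measure_display} {T : measurableType d}
    (mu : {measure set T -> \bar R}) (D : set T) (f : T -> R[i]) : R[i] :=
  (\int[mu]_(x in D) re f x) +i* (\int[mu]_(x in D) im f x).

Definition leb {R : realType} : {measure set (measurableTypeR R) -> \bar R} :=
  lebesgue_measure.

Definition leb2 {R : realType} :
    {measure set (measurableTypeR R * measurableTypeR R)%type -> \bar R} :=
  (leb \x leb)%E.

Definition oint {R : realType} (x y : R) (f : R -> R[i]) : R[i] :=
  if x <= y then cint leb `[x, y] f else - cint leb `[y, x] f.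

Definition is_cderive {R : realType} (f : R -> R[i]) (x : R) (l : R[i]) : Prop :=
  is_derive x (1 : R) (re f) (complex.Re l) /\
  is_derive x (1 : R) (im f) (complex.Im l).

Definition cD {R : realType} {V : normedModType R} (v : V) (f : V -> R[i])
    (x : V) : R[i] :=
  'D_v (re f) x +i* 'D_v (im f) x.

(* All iterated directional derivatives exist and are continuous; the empty
   list of directions gives f itself. *)
Definition smooth {R : realType} {V : normedModType R} (f : V -> R) : Prop :=
  forall s : seq V, let g := foldr (fun v h => 'D_v h) f s in
    continuous g /\ forall v x, derivable g x v.

Definition csupp {R : realType} {V : normedModType R} (f : V -> R[i]) : set V :=
  closure [set x | f x != 0].

(* C_c^oo(U), its elements being extended by 0 to the whole space. *)
Definition test_function {R : realType} {V : normedModType R} (U : set V)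
    (f : V -> R[i]) : Prop :=
  [/\ smooth (re f), smooth (im f), compact (csupp f) & csupp f `<=` U].

Definition ae_eq_on {R : realType} (a : R) (f g : R -> R[i]) : Prop :=
  {ae leb, forall x : R, x \in `]-a, a[ -> f x = g x}.

(* Elements of L^1(-a,a) are represented by functions on R; the values outside
   ]-a, a[ are irrelevant. *)
Definition L1 {R : realType} (a : R) : set (R -> R[i]) :=
  [set f | cintegrable leb `]-a, a[ f].

Definition weak_deriv {R : realType} (a : R) (f g : R -> R[i]) : Prop :=
  forall phi : R -> R[i], test_function `]-a, a[ phi ->
    cint leb `]-a, a[ (fun x => f x * cD (1 : R) phi x) =
    - cint leb `]-a, a[ (fun x => g x * phi x).

Definition weak_deriv2 {R : realType} (a : R) (f h : R -> R[i]) : Prop :=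
  exists g, [/\ L1 a g, L1 a h, weak_deriv a f g & weak_deriv a g h].

(* C^1[-a,a] for functions whose values outside [-a,a] are irrelevant: the
   derivative on ]-a, a[ extends continuously to [-a, a]. *)
Definition C1 {R : realType} (a : R) (f : R -> R[i]) : Prop :=
  ccontinuous_on `[-a, a] f /\
  exists g, ccontinuous_on `[-a, a] g /\
    forall x, x \in `]-a, a[ -> is_cderive f x (g x).

(* W^{2,1}(-a,a), each class being replaced by its C^1[-a,a] representative. *)
Definition W21 {R : realType} (a : R) : set (R -> R[i]) :=
  [set f | [/\ L1 a f, C1 a f & exists h, weak_deriv2 a f h]].

Definition Omega {R : realType} (a : R) : set (R * R) := `[-a, a] `*` `[-a, a].

(* The closed square with vertices (-a,0), (0,a), (a,0), (0,-a). *)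
Definition Omega1 {R : realType} (a : R) : set (R * R) :=
  [set p | `|p.1| + `|p.2| <= a].

Definition unc {R : realType} (F : R -> R -> R[i]) : R * R -> R[i] :=
  fun p => F p.1 p.2.

Definition weak_partial {R : realType} (a : R) (v : R * R)
    (F G : R * R -> R[i]) : Prop :=
  forall phi : R * R -> R[i], test_function (Omega a)° phi ->
    cint leb2 (Omega a) (fun p => F p * cD v phi p) =
    - cint leb2 (Omega a) (fun p => G p * phi p).

Definition dirx {R : realType} : R * R := (1, 0).
Definition dirt {R : realType} : R * R := (0, 1).

(* F is in W^{1,1}(Omega) with weak gradient (Fx, Ft). *)
Definition W11_grad {R : realType} (a : R) (F Fx Ft : R * R -> R[i]) : Prop :=
  [/\ cintegrable leb2 (Omega a) F,
      cintegrable leb2 (Omega a) Fx, cintegrable leb2 (Omega a) Ft,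
      weak_partial a dirx F Fx & weak_partial a dirt F Ft].

Definition H_equation {R : realType} (a : R) (q : R -> R[i])
    (H : R -> R -> R[i]) : Prop :=
  forall u v : R, Omega1 a (u, v) ->
    H u v = 2^-1 * oint 0 u q +
      oint 0 u (fun al => oint 0 v (fun be => q (al + be) * H al be)).

Definition goursat_kernel {R : realType} (H : R -> R -> R[i]) : R -> R -> R[i] :=
  fun x t => H ((x + t) / 2) ((x - t) / 2).

Definition Goursat_weak_solution {R : realType} (a : R) (q : R -> R[i])
    (K : R -> R -> R[i]) : Prop :=
  [/\ ccontinuous_on (Omega a) (unc K),
      exists Kx Kt : R * R -> R[i], W11_grad a (unc K) Kx Kt /\
        forall phi : R * R -> R[i], test_function (Omega a)° phi ->
          cint leb2 (Omega a) (fun p =>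
            Kt p * cD dirt phi p - Kx p * cD dirx phi p
            - q p.1 * unc K p * phi p) = 0,
      forall x, x \in `[-a, a] -> K x x = 2^-1 * oint 0 x q &
      forall x, x \in `[-a, a] -> K x (- x) = 0].

(* Linear map from the subspace D of L^1(-a,a) to L^1(-a,a), acting on
   representatives. *)
Definition linear_operator {R : realType} (a : R) (D : set (R -> R[i]))
    (T : (R -> R[i]) -> R -> R[i]) : Prop :=
  [/\ D `<=` L1 a /\ D (fun=> 0),
      forall (c : R[i]) u v, D u -> D v -> D (fun x => c * u x + v x),
      forall u, D u -> L1 a (T u),
      forall u v, D u -> D v -> ae_eq_on a u v -> ae_eq_on a (T u) (T v) &
      forall (c : R[i]) u v, D u -> D v ->
        ae_eq_on a (T (fun x => c * u x + v x)) (fun x => c * T u x + T v x)].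

(* u'' is determined up to a null set only: the condition is required for all
   of its representatives. *)
Definition transmutation_operator {R : realType} (a : R) (q : R -> R[i])
    (D : set (R -> R[i])) (T : (R -> R[i]) -> R -> R[i])
    (chi : set (R -> R[i])) : Prop :=
  [/\ linear_operator a D T, chi `<=` W21 a, chi `<=` D &
      forall u, chi u -> W21 a (T u) /\
        forall u2, weak_deriv2 a u u2 -> D u2 /\
          exists w2, weak_deriv2 a (T u) w2 /\
            ae_eq_on a (fun x => w2 x - q x * T u x) (T u2)].

Definition L_base {R : realType} (a : R) (q : R -> R[i])
    (phi : nat -> R -> R[i]) : Prop :=
  (forall k, W21 a (phi k)) /\
  forall k, exists w, weak_deriv2 a (phi k) w /\
    ae_eq_on a (fun x => w x - q x * phi k x)
      (fun x => if (k < 2)%N then 0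
                else (k * (k - 1))%N%:R * phi (k - 2)%N x).

Definition standard_L_base {R : realType} (a : R) (q : R -> R[i])
    (phi : nat -> R -> R[i]) : Prop :=
  L_base a q phi /\
  forall k, (2 <= k)%N -> phi k 0 = 0 /\ is_cderive (phi k) 0 0.

Definition monomial {R : realType} (k : nat) : R -> R[i] :=
  fun x => x%:C ^+ k.

Definition standard_transmutation_operator {R : realType} (a : R)
    (q : R -> R[i]) (D : set (R -> R[i])) (T : (R -> R[i]) -> R -> R[i])
    (chi : set (R -> R[i])) : Prop :=
  [/\ transmutation_operator a q D T chi,
      forall p : {poly R[i]}, chi (fun x => p.[x%:C]) &
      standard_L_base a q (fun k => T (monomial k))].

Definition inverse_operator {R : realType} (a : R) (D : set (R -> R[i]))
    (T S : (R -> R[i]) -> R -> R[i]) : Prop :=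
  [/\ linear_operator a D T, linear_operator a D S,
      forall u, D u -> D (T u) /\ D (S u),
      forall u, D u -> ae_eq_on a (S (T u)) u &
      forall u, D u -> ae_eq_on a (T (S u)) u].

Definition T_op {R : realType} (K : R -> R -> R[i]) (u : R -> R[i]) : R -> R[i] :=
  fun x => u x + oint (- x) x (fun t => K x t * u t).

Definition T_inv {R : realType} (K : R -> R -> R[i]) (u : R -> R[i]) : R -> R[i] :=
  fun x => u x - oint (- x) x (fun t => K t x * u t).

(* Main.v *)
(* The integral equation for H is kept in integrated form throughout. After extending q by 0 and K
   continuously to the plane, it says that, for |t| <= x, K(x, t) is half the integral, over the
   backward light cone of (x, t), of the source q(s) K(s, tau) plus q on the segment (s, s). The
   kernel K(t, x) has the same shape, with source - q(tau) K(tau, s).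
   Write u = c0 + c1 x + J f, where (J f)'' = f and J f vanishes to first order at 0. Exchanging the
   integration of u against the kernel with that of the sources over the cone gives
     T u = c0 + c1 x + J (q (T u) + T f)   and   S u = c0 + c1 x + J (S (f - q u)),
   S being the claimed inverse. The first formula is the transmutation property, and both together
   give S (T u) = c0 + c1 x + J (S (T f)). By induction S T fixes every monomial, so the bounded
   kernel of S T - 1 has vanishing moments and is zero. Since 1 - S is a Volterra operator, S is
   injective, whence T S = 1.
   For the Goursat problem, K is an indefinite integral along each of the two characteristic
   directions, and so are its two characteristic derivatives: integrate by parts along lines. *)

Require Import Defs.
From HB Require Import structures.
From mathcomp Require Import all_boot all_order all_algebra.
From mathcomp Require Import complex.
From mathcomp Require Import all_classical all_reals all_analysis.
From mathcomp Require Import measurable_realfun.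
From mathcomp Require Import ring lra.
Import Order.TTheory GRing.Theory Num.Theory.
Import numFieldNormedType.Exports.
Local Open Scope classical_set_scope.
Local Open Scope ring_scope.
Local Open Scope complex_scope.

Set Implicit Arguments.
Unset Strict Implicit.
Unset Printing Implicit Defensive.

(** * Integrals of complex functions *)

(** As q is merely integrable, K has no second derivatives in general and its first ones need not be
    continuous, so the kernel is never differentiated pointwise. The exchange of integrals rests on
    one fact: the integral of u over the interval of radius r about tau is 2 r u(tau) plus the
    integral of f(s) (r - |s - tau|)_+^2 / 2. For a source at time x - r the first term carries the
    factor r of the kernel of J, and the square is the integral of x - y over the times y <= x at
    which the backward cone of position s contains the source; this gives J of the same operator
    applied to f. The inverse has kernel K(t, x) because exchanging x and t is v -> - v in the
    equation for H: the single integral is unchanged, while the double integral changes sign and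
    moves q to the other variable. In S (T u) the second derivative of T u is q (T u) + T f, and S
    subtracts q (T u) again, so S T commutes with J. The cone argument needs x >= 0; for x < 0 it is
    applied to the potential q(- s) and the kernel - K(- x, - t), which satisfy the same
    equation. *)

Section ComplexIntegral.
Context {R : realType}.

(* Integrability and continuity being componentwise, this is the convenient norm; it is
   submultiplicative. *)
Definition cnorm1 (z : R[i]) : R := `|complex.Re z| + `|complex.Im z|.

Lemma cReM (x y : R[i]) :
  complex.Re (x * y) = complex.Re x * complex.Re y - complex.Im x * complex.Im y.
Proof. by case: x y => [a b] [c e]. Qed.

Lemma cImM (x y : R[i]) :
  complex.Im (x * y) = complex.Re x * complex.Im y + complex.Im x * complex.Re y.
Proof. by case: x y => [a b] [c e]. Qed.

Lemma cReD (x y : R[i]) : complex.Re (x + y) = complex.Re x + complex.Re y.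
Proof. by case: x y => [a b] [c e]. Qed.

Lemma cImD (x y : R[i]) : complex.Im (x + y) = complex.Im x + complex.Im y.
Proof. by case: x y => [a b] [c e]. Qed.

Lemma cReN (x : R[i]) : complex.Re (- x) = - complex.Re x.
Proof. by case: x. Qed.

Lemma cImN (x : R[i]) : complex.Im (- x) = - complex.Im x.
Proof. by case: x. Qed.

Lemma complex_eqP (x y : R[i]) :
  complex.Re x = complex.Re y -> complex.Im x = complex.Im y -> x = y.
Proof. by case: x y => [a b] [c e] /= -> ->. Qed.

Lemma cnorm1_ge0 z : 0 <= cnorm1 z.
Proof. by rewrite addr_ge0. Qed.

Lemma cnorm1D x y : cnorm1 (x + y) <= cnorm1 x + cnorm1 y.
Proof. by rewrite /cnorm1 cReD cImD addrACA lerD ?ler_normD. Qed.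

Lemma cnorm1N x : cnorm1 (- x) = cnorm1 x.
Proof. by rewrite /cnorm1 cReN cImN !normrN. Qed.

Lemma cnorm1M x y : cnorm1 (x * y) <= cnorm1 x * cnorm1 y.
Proof.
rewrite /cnorm1 cReM cImM mulrDl !mulrDr -!normrM.
apply: (le_trans (lerD (ler_normB _ _) (ler_normD _ _))).
by rewrite le_eqVlt; apply/orP; left; apply/eqP; ring.
Qed.

Lemma cnorm1_0 : cnorm1 0 = 0.
Proof. by rewrite /cnorm1 /= normr0 addr0. Qed.

Lemma cnorm1_eq0 x : cnorm1 x <= 0 -> x = 0.
Proof.
move=> x0; have /eqP : cnorm1 x = 0 by apply/eqP; rewrite eq_le x0 cnorm1_ge0.
rewrite paddr_eq0// => /andP[/eqP/normr0_eq0 a /eqP/normr0_eq0 b].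
exact: complex_eqP.
Qed.

Lemma cnorm1_real (r : R) : cnorm1 r%:C = `|r|.
Proof. by rewrite /cnorm1 /= normr0 addr0. Qed.

Lemma cnorm1_realM (z : R[i]) (r : R) : cnorm1 (z * r%:C) = cnorm1 z * `|r|.
Proof. by rewrite /cnorm1 cReM cImM /= !mulr0 subr0 add0r !normrM mulrDl. Qed.

Lemma Re_nat n : complex.Re (n%:R : R[i]) = n%:R.
Proof. by elim: n => // n IH; rewrite -natr1 cReD IH -natr1. Qed.

Lemma Im_nat n : complex.Im (n%:R : R[i]) = 0.
Proof. by elim: n => // n IH; rewrite -natr1 cImD IH add0r. Qed.

(** Integrals over sets are written as integrals over the whole space with this complex factor, so
    that linearity and Fubini are needed in one form only. *)
Definition ind (b : bool) : R[i] := b%:R.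

Lemma ind1 : ind true = 1. Proof. by []. Qed.
Lemma ind0 : ind false = 0. Proof. by []. Qed.

Lemma indE (b : bool) : ind b = (if b then 1 else 0 : R)%:C.
Proof. by case: b. Qed.

Lemma indM (b c : bool) : ind b * ind c = ind (b && c).
Proof. by case: b c => [] []; rewrite ?ind1 ?ind0 ?mul1r ?mul0r. Qed.

Lemma cnorm1_bool (b : bool) : cnorm1 (ind b) <= 1.
Proof. by rewrite /ind /cnorm1 Re_nat Im_nat normr0 addr0; case: b; rewrite ?normr1 ?normr0. Qed.

Lemma cnorm1_le_boolM (b : bool) z : cnorm1 (ind b * z) <= cnorm1 z.
Proof. by case: b; rewrite ?ind1 ?ind0 ?mul1r // mul0r cnorm1_0 cnorm1_ge0. Qed.

Section OneMeasure.
Context {d : measure_display} {T : measurableType d}.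

Definition cmeasurable (f : T -> R[i]) :=
  measurable_fun setT (re f) /\ measurable_fun setT (im f).

Lemma cmeasurable_cst (c : R[i]) : cmeasurable (fun=> c).
Proof. by split; exact: measurable_cst. Qed.

Lemma cmeasurableD f g : cmeasurable f -> cmeasurable g ->
  cmeasurable (fun x => f x + g x).
Proof.
move=> [f1 f2] [g1 g2]; split.
- rewrite (_ : re _ = re f \+ re g); first exact: measurable_funD.
  by apply/funext => x; rewrite /re /= cReD.
- rewrite (_ : im _ = im f \+ im g); first exact: measurable_funD.
  by apply/funext => x; rewrite /im /= cImD.
Qed.

Lemma cmeasurableM f g : cmeasurable f -> cmeasurable g ->
  cmeasurable (fun x => f x * g x).
Proof.
move=> [f1 f2] [g1 g2]; split.
- rewrite (_ : re _ = (re f \* re g) \- (im f \* im g)).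
    by apply: measurable_funB; apply: measurable_funM.
  by apply/funext => x; rewrite /re /im /= cReM.
- rewrite (_ : im _ = (re f \* im g) \+ (im f \* re g)).
    by apply: measurable_funD; apply: measurable_funM.
  by apply/funext => x; rewrite /re /im /= cImM.
Qed.

Lemma cmeasurable_real (f : T -> R) : measurable_fun setT f ->
  cmeasurable (fun x => (f x)%:C).
Proof. by move=> mf; split => //; exact: measurable_cst. Qed.

Lemma cmeasurableN f : cmeasurable f -> cmeasurable (fun x => - f x).
Proof.
move=> mf; rewrite (_ : (fun x => - f x) = (fun x => -1 * f x)); last first.
  by apply/funext => x; rewrite mulN1r.
by apply: cmeasurableM => //; exact: cmeasurable_cst.
Qed.

Lemma cmeasurableB f g : cmeasurable f -> cmeasurable g ->
  cmeasurable (fun x => f x - g x).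
Proof. by move=> mf mg; apply: cmeasurableD => //; exact: cmeasurableN. Qed.

Lemma cmeasurable_bool (b : T -> bool) : measurable_fun setT b ->
  cmeasurable (fun x => ind (b x)).
Proof.
move=> mb; rewrite (_ : (fun x => _) = (fun x => (if b x then 1 else 0 : R)%:C)).
  by apply: cmeasurable_real; apply: measurable_fun_ifT.
by apply/funext => x; case: (b x).
Qed.

Lemma measurable_cnorm1 f : cmeasurable f -> measurable_fun setT (cnorm1 \o f).
Proof. by move=> [f1 f2]; apply: measurable_funD; apply: measurableT_comp. Qed.

Context (mu : {measure set T -> \bar R}).
Implicit Types f g : T -> R[i].
Local Notation cintT f := (cint mu setT f).
Local Notation L1T f := (cintegrable mu setT f).

Lemma cintegrable_measurable f : L1T f -> cmeasurable f.
Proof. by move=> [/measurable_int/measurable_EFinP f1 /measurable_int/measurable_EFinP f2]. Qed.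

Lemma cintegrable_le f (g : T -> R) : cmeasurable f ->
  mu.-integrable setT (EFin \o g) -> (forall x, cnorm1 (f x) <= g x) ->
  L1T f.
Proof.
move=> [f1 f2] ig fg; split; apply: le_integrable ig => //.
- exact/measurable_EFinP.
- move=> x _ /=; rewrite lee_fin; apply: le_trans (ler_norm _).
  by apply: le_trans (fg x); rewrite lerDl.
- exact/measurable_EFinP.
- move=> x _ /=; rewrite lee_fin; apply: le_trans (ler_norm _).
  by apply: le_trans (fg x); rewrite lerDr.
Qed.

Lemma integrable_cnorm1 f : L1T f -> mu.-integrable setT (EFin \o (cnorm1 \o f)).
Proof.
move=> [f1 f2].
have := integrableD measurableT (integrable_norm f1) (integrable_norm f2).
by apply: eq_integrable.
Qed.

Lemma cintegrable0 : L1T (fun=> 0).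
Proof. by split; exact: integrable0. Qed.

Lemma cintegrableD f g : L1T f -> L1T g -> L1T (fun x => f x + g x).
Proof.
move=> [f1 f2] [g1 g2]; split.
- have := integrableD measurableT f1 g1; apply: eq_integrable => // x _ /=.
  by rewrite /re cReD.
- have := integrableD measurableT f2 g2; apply: eq_integrable => // x _ /=.
  by rewrite /im cImD.
Qed.

Lemma cintegrableMr f g (c : R) : L1T f -> cmeasurable g ->
  (forall x, cnorm1 (g x) <= c) -> L1T (fun x => f x * g x).
Proof.
move=> If mg gc; apply: (@cintegrable_le _ (fun x => c * cnorm1 (f x))).
- by apply: cmeasurableM => //; exact: cintegrable_measurable.
- by have := integrableZl measurableT c (integrable_cnorm1 If); apply: eq_integrable.
- move=> x; rewrite mulrC; apply: (le_trans (cnorm1M _ _)).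
  by apply: ler_wpM2r => //; exact: cnorm1_ge0.
Qed.

Lemma cintegrableMl f g (c : R) : L1T f -> cmeasurable g ->
  (forall x, cnorm1 (g x) <= c) -> L1T (fun x => g x * f x).
Proof.
move=> If mg gc; under eq_fun do rewrite mulrC.
exact: cintegrableMr gc.
Qed.

Lemma cintegrableZ f (c : R[i]) : L1T f -> L1T (fun x => c * f x).
Proof.
by move=> If; apply: (@cintegrableMl _ _ (cnorm1 c)) => //; exact: cmeasurable_cst.
Qed.

Lemma cintegrableN f : L1T f -> L1T (fun x => - f x).
Proof. by move=> If; under eq_fun do rewrite -mulN1r; exact: cintegrableZ. Qed.

Lemma cintegrableB f g : L1T f -> L1T g -> L1T (fun x => f x - g x).
Proof. by move=> If Ig; apply: cintegrableD => //; exact: cintegrableN. Qed.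

Lemma cintegrable_bool (b : T -> bool) f : measurable_fun setT b -> L1T f ->
  L1T (fun x => ind (b x) * f x).
Proof.
move=> mb If; apply: (@cintegrableMl _ _ 1) => //.
- exact: cmeasurable_bool.
- by move=> x; exact: cnorm1_bool.
Qed.

Lemma cintD f g : L1T f -> L1T g -> cintT (fun x => f x + g x) = cintT f + cintT g.
Proof.
move=> [f1 f2] [g1 g2]; apply: complex_eqP.
- by rewrite cReD /= -RintegralD//; apply: eq_Rintegral => x _; rewrite /re cReD.
- by rewrite cImD /= -RintegralD//; apply: eq_Rintegral => x _; rewrite /im cImD.
Qed.

Lemma cintZ (c : R[i]) f : L1T f -> cintT (fun x => c * f x) = c * cintT f.
Proof.
move=> [f1 f2].
have Z (r : R) (h : T -> R) : mu.-integrable setT (EFin \o h) ->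
    mu.-integrable setT (EFin \o (fun x => r * h x)).
  by move=> ih; have := integrableZl measurableT r ih; apply: eq_integrable.
apply: complex_eqP.
- rewrite cReM /= -!RintegralZl// -RintegralB//; [|exact: Z..].
  by apply: eq_Rintegral => x _; rewrite /re cReM.
- rewrite cImM /= -!RintegralZl// -RintegralD//; [|exact: Z..].
  by apply: eq_Rintegral => x _; rewrite /im cImM.
Qed.

Lemma cint0 : cintT (fun=> 0) = 0.
Proof.
by apply: complex_eqP; rewrite /= /re /im /= Rintegral_cst// mul0r.
Qed.

Lemma cintN f : L1T f -> cintT (fun x => - f x) = - cintT f.
Proof.
move=> If; rewrite -mulN1r -cintZ//; congr (cint _ _ _).
by apply/funext => x; rewrite mulN1r.
Qed.

Lemma cintB f g : L1T f -> L1T g -> cintT (fun x => f x - g x) = cintT f - cintT g.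
Proof. by move=> If Ig; rewrite cintD ?cintN//; exact: cintegrableN. Qed.

Lemma cnorm1_cint f : L1T f ->
  cnorm1 (cintT f) <= \int[mu]_x cnorm1 (f x).
Proof.
move=> [f1 f2]; rewrite /cnorm1 RintegralD//; [|exact: integrable_norm..].
by rewrite lerD//=; exact: le_normr_Rintegral.
Qed.

Lemma cnorm1_cint_le f (g : T -> R) : L1T f ->
  mu.-integrable setT (EFin \o g) -> (forall x, cnorm1 (f x) <= g x) ->
  cnorm1 (cintT f) <= \int[mu]_x g x.
Proof.
move=> If ig fg; apply: (le_trans (cnorm1_cint If)).
by apply: le_Rintegral => //; exact: integrable_cnorm1.
Qed.

Lemma cint_mkcond (D : set T) f :
  cint mu D f = cintT (fun x => ind (x \in D) * f x).
Proof.
apply: complex_eqP => /=; rewrite Rintegral_mkcond; apply: eq_Rintegral => x _.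
- by rewrite /patch /re; case: ifPn; rewrite ?ind1 ?ind0 ?mul1r ?mul0r.
- by rewrite /patch /im; case: ifPn; rewrite ?ind1 ?ind0 ?mul1r ?mul0r.
Qed.

Lemma cintegrable_mkcond (D : set T) f : measurable D ->
  cintegrable mu D f <-> L1T (fun x => ind (x \in D) * f x).
Proof.
move=> mD; rewrite /cintegrable !(integrable_mkcond _ mD).
have e1 : (EFin \o re f) \_ D = EFin \o re (fun x => ind (x \in D) * f x).
  by apply/funext => x; rewrite /patch /re /=; case: ifPn; rewrite ?ind1 ?ind0 ?mul1r ?mul0r.
have e2 : (EFin \o im f) \_ D = EFin \o im (fun x => ind (x \in D) * f x).
  by apply/funext => x; rewrite /patch /im /=; case: ifPn; rewrite ?ind1 ?ind0 ?mul1r ?mul0r.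
by rewrite e1 e2.
Qed.

End OneMeasure.

Lemma cmeasurable_comp d1 d2 (T1 : measurableType d1) (T2 : measurableType d2)
    (f : T2 -> R[i]) (g : T1 -> T2) : cmeasurable f -> measurable_fun setT g ->
  cmeasurable (fun x => f (g x)).
Proof. by move=> [f1 f2] mg; split; [exact: (measurableT_comp f1)|exact: (measurableT_comp f2)]. Qed.

Section Product.
Context {d1 d2 : measure_display} {T1 : measurableType d1} {T2 : measurableType d2}.
Context (m1 : {sigma_finite_measure set T1 -> \bar R})
  (m2 : {sigma_finite_measure set T2 -> \bar R}).
Local Notation m12 := (product_measure1 m1 m2).

(** No integrability is asked: the integral is [fine] of a difference of two nonnegative integrals,
    each of which is measurable in x by Tonelli. *)
Lemma measurable_Rintegral_section (f : T1 * T2 -> R) : measurable_fun setT f ->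
  measurable_fun setT (fun x => \int[m2]_y f (x, y)).
Proof.
move=> mf; have mf' : measurable_fun setT (EFin \o f) by exact/measurable_EFinP.
have mp := measurable_funepos mf'; have mn := measurable_funeneg mf'.
rewrite (_ : (fun x => _) = fine \o
  (fun x => \int[m2]_y ((EFin \o f)^\+ (x, y)) - \int[m2]_y ((EFin \o f)^\- (x, y)))%E).
  apply: measurableT_comp => //; apply: emeasurable_funB.
  - by apply: (@measurable_fun_fubini_tonelli_F _ _ _ _ _ m2) => // x; exact: funepos_ge0.
  - by apply: (@measurable_fun_fubini_tonelli_F _ _ _ _ _ m2) => // x; exact: funeneg_ge0.
apply/funext => x; rewrite /Rintegral/= integralE.
by congr (fine (_ - _)); apply: eq_integral => y _; rewrite !unlock.
Qed.

Lemma cmeasurable_section (f : T1 * T2 -> R[i]) : cmeasurable f ->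
  cmeasurable (fun x => cint m2 setT (fun y => f (x, y))).
Proof.
by move=> [f1 f2]; split; [exact: (measurable_Rintegral_section f1)|exact: (measurable_Rintegral_section f2)].
Qed.

Let Rfubini1 (f : T1 * T2 -> R) : m12.-integrable setT (EFin \o f) ->
  m1.-integrable setT (EFin \o (fun x => \int[m2]_y f (x, y))) /\
  \int[m1]_x \int[m2]_y f (x, y) = \int[m12]_p f p.
Proof.
move=> If.
have iF := integrable_fubini_F If.
have aeF := integrable_ae measurableT iF.
(* The section integral may fail to be finite on a null set, where [fine] returns 0; off that set
   the real and the extended real versions agree. *)
have aeE : ae_eq m1 setT (fubini_F m2 (EFin \o f))
    (EFin \o (fun x => \int[m2]_y f (x, y))).
  by apply: filterS aeF => x /= + _ => /(_ I) fx; rewrite /Rintegral fineK.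
have mG : measurable_fun setT (EFin \o (fun x => \int[m2]_y f (x, y))).
  apply/measurable_EFinP; apply: measurable_Rintegral_section.
  by apply/measurable_EFinP; exact: measurable_int If.
split.
  apply/integrableP; split => //.
  move/integrableP : iF => [mF]; congr (_ < _)%E.
  apply: ge0_ae_eq_integral => //; [exact: measurableT_comp..|].
  by apply: filterS aeE => x /= H Dx; rewrite H.
rewrite [LHS]/Rintegral [RHS]/Rintegral -(integral12_prod_meas1 If).
congr fine; apply/esym/ae_eq_integral => //.
exact: measurable_int iF.
Qed.

Let Rfubini2 (f : T1 * T2 -> R) : m12.-integrable setT (EFin \o f) ->
  \int[m2]_y \int[m1]_x f (x, y) = \int[m12]_p f p.
Proof.
move=> If.
have mF := measurable_fubini_G If.
have aeF := ae_integrable2 If.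
have aeE : ae_eq m2 setT (fubini_G m1 (EFin \o f))
    (EFin \o (fun y => \int[m1]_x f (x, y))).
  by apply: filterS aeF => y /= Iy _; rewrite /Rintegral fineK//; exact: integrable_fin_num Iy.
rewrite [LHS]/Rintegral [RHS]/Rintegral -(integral21_prod_meas1 If).
congr fine; apply/esym/ae_eq_integral => //.
have -> : (fun y => (\int[m1]_x f (x, y))%:E) =
      EFin \o (fine \o fubini_G m1 (EFin \o f)) by [].
by apply/measurable_EFinP; exact: measurableT_comp.
Qed.

Lemma cintegrable_section (f : T1 * T2 -> R[i]) : cintegrable m12 setT f ->
  cintegrable m1 setT (fun x => cint m2 setT (fun y => f (x, y))).
Proof. by move=> [f1 f2]; split; [have [] := Rfubini1 f1|have [] := Rfubini1 f2]. Qed.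

Lemma cfubini1 (f : T1 * T2 -> R[i]) : cintegrable m12 setT f ->
  cint m1 setT (fun x => cint m2 setT (fun y => f (x, y))) = cint m12 setT f.
Proof.
move=> [f1 f2]; apply: complex_eqP => /=.
- by have [_] := Rfubini1 f1.
- by have [_] := Rfubini1 f2.
Qed.

Lemma cfubini2 (f : T1 * T2 -> R[i]) : cintegrable m12 setT f ->
  cint m2 setT (fun y => cint m1 setT (fun x => f (x, y))) = cint m12 setT f.
Proof.
move=> [f1 f2]; apply: complex_eqP => /=; [exact: Rfubini2 f1|exact: Rfubini2 f2].
Qed.

Lemma cfubini (f : T1 * T2 -> R[i]) : cintegrable m12 setT f ->
  cint m1 setT (fun x => cint m2 setT (fun y => f (x, y))) =
  cint m2 setT (fun y => cint m1 setT (fun x => f (x, y))).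
Proof. by move=> If; rewrite cfubini1// cfubini2. Qed.

Lemma cintegrable_tonelli (f : T1 * T2 -> R[i]) (g : T1 * T2 -> R) : cmeasurable f ->
  measurable_fun setT g -> (forall p, cnorm1 (f p) <= g p) ->
  (\int[m2]_y \int[m1]_x (g (x, y))%:E < +oo)%E ->
  cintegrable m12 setT f.
Proof.
move=> mf mg fg gy; apply: (cintegrable_le (mu := m12) mf _ fg).
have g0 p : 0 <= g p by apply: le_trans (fg p); exact: cnorm1_ge0.
apply/integrable21ltyP; first exact/measurable_EFinP.
move: gy; congr (_ < _)%E; apply: eq_integral => y _; apply: eq_integral => x _ /=.
by rewrite ger0_norm.
Qed.

(** Source of nearly every joint integrability below: integrands are brought to the form of a tensor
    product, possibly after a linear change of variables, times a bounded measurable factor. *)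
Lemma cintegrable_tensor (f : T1 -> R[i]) (g : T2 -> R[i]) :
  cintegrable m1 setT f -> cintegrable m2 setT g ->
  cintegrable m12 setT (fun p => f p.1 * g p.2).
Proof.
move=> If Ig.
have mf := cintegrable_measurable If; have mg := cintegrable_measurable Ig.
apply: (@cintegrable_tonelli _ (fun p => cnorm1 (f p.1) * cnorm1 (g p.2))).
- by apply: cmeasurableM; apply: cmeasurable_comp.
- by apply: measurable_funM; [have := measurable_cnorm1 mf|have := measurable_cnorm1 mg];
    move=> h; exact: (measurableT_comp h).
- by move=> p; exact: cnorm1M.
- have i1 := integrable_cnorm1 If; have i2 := integrable_cnorm1 Ig.
  under eq_integral => y _.
    under eq_integral => x _ do rewrite /= mulrC EFinM.
    rewrite integralZl//.
    rewrite -[X in (_ * X)%E]fineK; last exact: integrable_fin_num i1.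
    over.
  rewrite /= integralZr//.
  rewrite -[X in (X * _)%E]fineK; last exact: integrable_fin_num i2.
  by rewrite -EFinM ltry.
Qed.

End Product.
End ComplexIntegral.

(** * Changes of variables in the plane *)

Section LebesguePlane.
Context {R : realType}.
Local Notation mR := (measurableTypeR R).
Local Notation leb' := (@lebesgue_measure R).
Local Notation I1 f := (cint (@leb R) setT f).
Local Notation I2 f := (cint (@leb2 R) setT f).
Local Notation L1R f := (cintegrable (@leb R) setT f).
Local Notation L1R2 f := (cintegrable (@leb2 R) setT f).

Lemma measurable_affine (c b : R) :
  measurable_fun setT (fun x : mR => c * x + b : mR).
Proof.
apply: measurable_funD; last exact: measurable_cst.
by apply: measurable_funM; [exact: measurable_cst|exact: measurable_id].
Qed.

(** The pushforward scaled by |c| agrees with Lebesgue measure on half-open intervals, and this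
    determines it. For c < 0 the preimage of an interval has its closed end on the other side, hence
    the two cases. *)
Lemma lebesgue_affine (c b : R) (A : set mR) : c != 0 -> measurable A ->
  (`|c|%R%:E * leb' ((fun x : mR => (c * x + b)%R : mR) @^-1` A) = leb' A)%E.
Proof.
move=> c0 mA.
pose phi : mR -> mR := fun x => c * x + b.
have mphi : measurable_fun setT phi by exact: measurable_affine.
pose k : {nonneg R} := NngNum (normr_ge0 c).
apply/esym.
unshelve refine (@lebesgue_measure_unique R (mscale k (pushforward leb' phi)) _ A mA); first exact mphi.
move=> _ [[l r] _ <-].
rewrite lebesgue_measure_itv/= /mscale /pushforward /=.
have [cp|cn|/eqP] := ltrgtP c 0; last by rewrite (negbTE c0).
- rewrite [X in (_ * lebesgue_measure X)%E](_ : _ = `[(r - b) / c, (l - b) / c[%classic); last first.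
    apply/seteqP; split => x /=; rewrite !in_itv/= /phi ler_ndivrMr// ltr_ndivlMr// => /andP[h1 h2]; apply/andP; split; lra.
  rewrite lebesgue_measure_itv/= !lte_fin ltr_ndivrMr// divfK//.
  rewrite ltrD2r; case: ifPn => _; last by rewrite mule0.
  rewrite -!EFinD -EFinM; congr EFin; rewrite ltr0_norm//; by field.
- rewrite [X in (_ * lebesgue_measure X)%E](_ : _ = `](l - b) / c, (r - b) / c]%classic); last first.
    apply/seteqP; split => x /=; rewrite !in_itv/= /phi ler_pdivlMr// ltr_pdivrMr// => /andP[h1 h2]; apply/andP; split; lra.
  rewrite lebesgue_measure_itv/= !lte_fin ltr_pdivlMr// divfK//.
  rewrite ltrD2r; case: ifPn => _; last by rewrite mule0.
  rewrite -!EFinD -EFinM; congr EFin; rewrite gtr0_norm//; by field.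
Qed.

Lemma ge0_integral_affine (c b : R) (f : mR -> \bar R) : c != 0 ->
  measurable_fun setT f -> (forall x, 0 <= f x)%E ->
  (\int[leb']_x f x = `|c|%R%:E * \int[leb']_x f (c * x + b)%R)%E.
Proof.
move=> c0 mf f0.
pose phi : mR -> mR := fun x => c * x + b.
have mphi : measurable_fun setT phi by exact: measurable_affine.
pose k : {nonneg R} := NngNum (normr_ge0 c).
have -> : (\int[leb']_x f (c * x + b)%R =
    \int[pushforward leb' phi]_x f x)%E.
  by rewrite (ge0_integral_pushforward mphi)//= preimage_setT.
unshelve refine (etrans _ (@ge0_integral_mscale _ _ _ (pushforward leb' phi) setT measurableT k f mf _)); [exact mphi| |by move=> x _; exact: f0].
unshelve refine (@eq_measure_integral _ _ _ _ (mscale k (pushforward leb' phi)) leb' f _).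
move=> A mA _.
exact (esym (lebesgue_affine b c0 mA)).
Qed.

Lemma Rintegral_affine (c b : R) (f : mR -> R) : c != 0 ->
  measurable_fun setT f ->
  (\int[leb']_x f x = `|c| * \int[leb']_x f (c * x + b)).
Proof.
move=> c0 mf.
have mE : measurable_fun setT (EFin \o f) by exact/measurable_EFinP.
rewrite /Rintegral integralE [in RHS]integralE.
have E (g : mR -> \bar R) : measurable_fun setT g -> (forall x, 0 <= g x)%E ->
    (\int[leb']_x g (c * x + b)%R = (`|c|^-1)%R%:E * \int[leb']_x g x)%E.
  move=> mg g0; rewrite [in RHS](@ge0_integral_affine c b g)// muleA -EFinM mulVf ?normr_eq0//.
  by rewrite mul1e.
have -> : (\int[leb']_x ((fun x => (f (c * x + b)%R)%:E)^\+ x) =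
    (`|c|^-1)%R%:E * \int[leb']_x ((EFin \o f)^\+ x))%E.
  rewrite -E//; [|exact: measurable_funepos].
  by apply: eq_integral => x _; rewrite !unlock.
have -> : (\int[leb']_x ((fun x => (f (c * x + b)%R)%:E)^\- x) =
    (`|c|^-1)%R%:E * \int[leb']_x ((EFin \o f)^\- x))%E.
  rewrite -E//; [|exact: measurable_funeneg].
  by apply: eq_integral => x _; rewrite !unlock.
set A := (\int[_]_x _)%E; set B := (\int[_]_x _)%E.
have A0 : (0 <= A)%E by apply: integral_ge0.
have B0 : (0 <= B)%E by apply: integral_ge0.
have c1 : 0 < `|c|^-1 by rewrite invr_gt0 normr_gt0.
rewrite -[LHS]mul1r -[X in X * _ = _](@mulfV _ `|c|) ?normr_eq0//.
rewrite -mulrA; congr (_ * _).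
(* Integrability is not assumed, so the infinite values of the positive and negative parts are
   checked case by case; a positive factor preserves each of them. *)
move: A B A0 B0 => [x||] [y||]//= _ _; rewrite ?mulrBr// ?gt0_muley ?lte_fin//= ?mulr0//.
Qed.

Lemma eq_I1 (f g : R -> R[i]) : (forall x : R, f x = g x) -> I1 f = I1 g.
Proof. by move=> fg; congr (cint _ _ _); apply/funext. Qed.

Lemma cint_affine (c b : R) (f : R -> R[i]) : c != 0 -> cmeasurable (f : mR -> _) ->
  I1 f = `|c|%:C * I1 (fun x => f (c * x + b)).
Proof.
move=> c0 [f1 f2]; apply: complex_eqP; rewrite ?cReM ?cImM /= mul0r ?subr0 ?addr0.
- exact: Rintegral_affine.
- exact: Rintegral_affine.
Qed.

Lemma cintegrable_affine (c b : R) (f : R -> R[i]) : c != 0 -> L1R f ->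
  L1R (fun x => f (c * x + b)).
Proof.
move=> c0 If; have mf := cintegrable_measurable If.
have key (g : mR -> R) : measurable_fun setT g ->
    lebesgue_measure.-integrable setT (EFin \o g) ->
    (@leb R).-integrable setT (EFin \o (fun x => g (c * x + b))).
  move=> mg /integrableP[_ ig]; apply/integrableP; split.
    apply/measurable_EFinP.
    exact: (measurableT_comp mg (measurable_affine c b)).
  move: ig; rewrite (@ge0_integral_affine c b (fun x => `|(g x)%:E|%E))//; last first.
    by apply: measurableT_comp => //; exact/measurable_EFinP.
  rewrite [X in (X < _)%E -> _]muleC.
  set A := (X in (X * _ < _)%E) => H.
  suff : (A < +oo)%E by [].
  have : (0 <= A)%E by apply: integral_ge0.
  by move: A H => [x||]//; rewrite ?ltry// gt0_mulye ?lte_fin ?normr_gt0.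
by case: If => f1 f2; case: mf => m1 m2; split; [exact: key m1 f1|exact: key m2 f2].
Qed.

Lemma fub1 (f : R * R -> R[i]) : L1R2 f ->
  I1 (fun x => I1 (fun y => f (x, y))) = I2 f.
Proof. exact: (@cfubini1 _ _ _ _ _ leb' leb'). Qed.

Lemma fub2 (f : R * R -> R[i]) : L1R2 f ->
  I1 (fun y => I1 (fun x => f (x, y))) = I2 f.
Proof. exact: (@cfubini2 _ _ _ _ _ leb' leb'). Qed.

Lemma fub (f : R -> R -> R[i]) : L1R2 (fun p => f p.1 p.2) ->
  I1 (fun x => I1 (fun y => f x y)) = I1 (fun y => I1 (fun x => f x y)).
Proof. by move=> If; rewrite (fub1 If) -(fub2 If). Qed.

Lemma L1R_section (f : R * R -> R[i]) : L1R2 f -> L1R (fun x => I1 (fun y => f (x, y))).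
Proof. exact: (@cintegrable_section _ _ _ _ _ leb' leb'). Qed.

Lemma cmeasurable_swap (f : R * R -> R[i]) : cmeasurable (f : mR * mR -> _) ->
  cmeasurable (fun p : mR * mR => f (p.2, p.1)).
Proof.
by move=> mf; apply: (cmeasurable_comp mf); apply: measurable_fun_pair.
Qed.

(** Finiteness of an iterated integral of the norm is what passes through changes of a single
    variable; together with the version for the other order it also gives the swap of
    coordinates. *)
Lemma L1R2P (f : R * R -> R[i]) : cmeasurable (f : mR * mR -> _) ->
  L1R2 f <-> (\int[leb']_x \int[leb']_y (cnorm1 (f (x, y)))%:E < +oo)%E.
Proof.
move=> mf.
have mN : measurable_fun setT (EFin \o (cnorm1 \o f) : mR * mR -> _).
  by apply/measurable_EFinP; exact: measurable_cnorm1.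
have E : (\int[leb']_x \int[leb']_y (cnorm1 (f (x, y)))%:E =
    \int[leb']_x \int[leb']_y `|(EFin \o (cnorm1 \o f)) (x, y)|)%E.
  apply: eq_integral => x _; apply: eq_integral => y _ /=.
  by rewrite ger0_norm// cnorm1_ge0.
rewrite E; split.
- by move=> /integrable_cnorm1; rewrite (@integrable12ltyP _ _ _ _ _ leb' leb' _ mN).
- rewrite -(@integrable12ltyP _ _ _ _ _ leb' leb' _ mN) => H.
  by apply: cintegrable_le mf H _.
Qed.

Lemma L1R2P' (f : R * R -> R[i]) : cmeasurable (f : mR * mR -> _) ->
  L1R2 f <-> (\int[leb']_y \int[leb']_x (cnorm1 (f (x, y)))%:E < +oo)%E.
Proof.
move=> mf.
have mN : measurable_fun setT (EFin \o (cnorm1 \o f) : mR * mR -> _).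
  by apply/measurable_EFinP; exact: measurable_cnorm1.
have E : (\int[leb']_y \int[leb']_x (cnorm1 (f (x, y)))%:E =
    \int[leb']_y \int[leb']_x `|(EFin \o (cnorm1 \o f)) (x, y)|)%E.
  apply: eq_integral => x _; apply: eq_integral => y _ /=.
  by rewrite ger0_norm// cnorm1_ge0.
rewrite E; split.
- by move=> /integrable_cnorm1; rewrite (@integrable21ltyP _ _ _ _ _ leb' leb' _ mN).
- rewrite -(@integrable21ltyP _ _ _ _ _ leb' leb' _ mN) => H.
  by apply: cintegrable_le mf H _.
Qed.

Lemma L1R2_swap (f : R * R -> R[i]) : L1R2 f -> L1R2 (fun p => f (p.2, p.1)).
Proof.
move=> If; have mf := cintegrable_measurable If.
by apply/L1R2P; [exact: cmeasurable_swap|exact/L1R2P'].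
Qed.

Lemma I2_swap (f : R * R -> R[i]) : L1R2 f -> I2 (fun p => f (p.2, p.1)) = I2 f.
Proof. by move=> If; rewrite -(fub1 (L1R2_swap If)) -(fub2 If). Qed.

Lemma cmeasurable_pair1 (f : R * R -> R[i]) (x : R) : cmeasurable (f : mR * mR -> _) ->
  cmeasurable (fun y : mR => f (x, y)).
Proof. by move=> mf; apply: (cmeasurable_comp mf); exact: pair1_measurable. Qed.

Lemma measurable_shear (c e : R) :
  measurable_fun setT (fun p : mR * mR => (p.1, c * p.2 + e * p.1) : mR * mR).
Proof.
apply: measurable_fun_pair => //; apply: measurable_funD; apply: measurable_funM => //;
  exact: measurable_cst.
Qed.

Lemma L1R2_shear (c e : R) (f : R * R -> R[i]) : c != 0 -> L1R2 f ->
  L1R2 (fun p => f (p.1, c * p.2 + e * p.1)).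
Proof.
move=> c0 If; have mf := cintegrable_measurable If.
have c1 : 0 < `|c| by rewrite normr_gt0.
apply/L1R2P; first exact: (cmeasurable_comp mf (measurable_shear c e)).
move: (If) => /(L1R2P mf).
under eq_integral => x _.
  rewrite (@ge0_integral_affine c (e * x) (fun y => (cnorm1 (f (x, y)))%:E))//; last 2 first.
  - by apply/measurable_EFinP; apply: measurable_cnorm1; exact: cmeasurable_pair1.
  - by move=> y; rewrite lee_fin cnorm1_ge0.
  over.
rewrite /= ge0_integralZl//; last 2 first.
- apply: (@measurable_fun_fubini_tonelli_F _ _ _ _ _ leb' (fun p : mR * mR => (cnorm1 (f (p.1, c * p.2 + e * p.1)%R))%:E)).
  + apply/measurable_EFinP; apply: measurable_cnorm1.
    exact: (cmeasurable_comp mf (measurable_shear c e)).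
  + by move=> p; rewrite lee_fin cnorm1_ge0.
- by move=> x _; apply: integral_ge0 => y _; rewrite lee_fin cnorm1_ge0.
set A := (X in (_ * X < _)%E) => H; suff : (A < +oo)%E by [].
have : (0 <= A)%E.
  by apply: integral_ge0 => x _; apply: integral_ge0 => y _; rewrite lee_fin cnorm1_ge0.
by move: A H => [x _ _||]//; [exact: ltry|rewrite gt0_muley ?lte_fin].
Qed.

Lemma I2_shear (c e : R) (f : R * R -> R[i]) : c != 0 -> L1R2 f ->
  I2 f = `|c|%:C * I2 (fun p => f (p.1, c * p.2 + e * p.1)).
Proof.
move=> c0 If; have mf := cintegrable_measurable If.
rewrite -(fub1 If) -(fub1 (L1R2_shear e c0 If)) -cintZ; last first.
  exact: (L1R_section (L1R2_shear e c0 If)).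
congr (cint _ _ _); apply/funext => x.
by rewrite (@cint_affine c (e * x))//; exact: cmeasurable_pair1.
Qed.

(** The map is composed of the shear (x, 2 t - x), the swap of coordinates and the shear (x, t + x),
    so that only affine changes of one variable enter. *)
Lemma L1R2_rotate (f : R * R -> R[i]) : L1R2 f ->
  L1R2 (fun p => f (p.1 + p.2, p.1 - p.2)).
Proof.
move=> If; have two0 : (2 : R) != 0 by [].
have := L1R2_shear 1 (oner_neq0 R) (L1R2_swap (L1R2_shear (- 1) two0 If)).
congr (cintegrable _ _ _); apply/funext => p /=; congr (f (_, _)); ring.
Qed.

(** The factor 1/2 is the inverse Jacobian of x = u + v, t = u - v, contributed by the first shear;
    it is also the factor 1/2 of d'Alembert's formula in [cone_kernel]. *)
Lemma I2_rotate (f : R * R -> R[i]) : L1R2 f ->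
  I1 (fun al => I1 (fun be => f (al + be, al - be))) = 2^-1 * I2 f.
Proof.
move=> If; have two0 : (2 : R) != 0 by [].
have I1f := L1R2_shear (- 1) two0 If.
rewrite (fub1 (L1R2_rotate If)) (I2_shear (- 1) two0 If) -(I2_swap I1f).
rewrite (I2_shear 1 (oner_neq0 R) (L1R2_swap I1f)) normr1 mul1r mulrA.
rewrite [X in X * _](_ : _ = 1); last first.
  rewrite ger0_norm// (_ : 2%:C = 2 :> R[i]); first by rewrite mulVf.
  exact: rmorph_nat.
rewrite mul1r; congr (cint _ _ _); apply/funext => p /=; congr (f (_, _)); ring.
Qed.

End LebesguePlane.

Section ProductSigmaFinite.
Context {R : realType}.
Local Notation mR := (measurableTypeR R).

(** Lets the plane be a factor of a further product, as Fubini with sources in the plane requires.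
    The exhausting sets are the squares over those of the line. *)
Lemma sigma_finite_leb2 : sigma_finite setT (@leb2 R).
Proof.
have /sigma_finiteP[F [TF ndF Foo]] := sigma_finiteT (@lebesgue_measure R).
exists (fun n => F n `*` F n).
  rewrite -setXTT TF predeqE => -[x y]; split.
    move=> [/= [n _ Fnx] [k _ Fky]]; exists (maxn n k) => //; split.
    - by move: x Fnx; exact/subsetPset/ndF/leq_maxl.
    - by move: y Fky; exact/subsetPset/ndF/leq_maxr.
  by move=> [n _ []/= ? ?]; split; exists n.
move=> k; have [mF Fk] := Foo k; split; first exact: measurableX.
rewrite /leb2 /= product_measure1E// lte_mul_pinfty//.
by rewrite ge0_fin_numE.
Qed.

Definition leb2' : set (mR * mR)%type -> \bar R := @leb2 R.
HB.instance Definition _ := Measure.on leb2'.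
HB.instance Definition _ := Measure_isSigmaFinite.Build _ _ _ leb2' sigma_finite_leb2.
(** The two spaces that carry sources: the plane for the density q K, the line for q on the
    diagonal. *)
Definition sleb2 : {sigma_finite_measure set (mR * mR)%type -> \bar R} := leb2'.
Definition sleb : {sigma_finite_measure set mR -> \bar R} := @lebesgue_measure R.
End ProductSigmaFinite.

(** * Fubini's theorem with a bounded kernel *)

Section FubiniKernel.
Context {R : realType} {d1 d2 : measure_display}
  {T1 : measurableType d1} {T2 : measurableType d2}.
Context (m1 : {sigma_finite_measure set T1 -> \bar R})
  (m2 : {sigma_finite_measure set T2 -> \bar R}).
Context (w : T1 -> T2 -> R[i]) (c : R).
Hypothesis mw : cmeasurable (fun p : T1 * T2 => w p.1 p.2).
Hypothesis wc : forall x y, cnorm1 (w x y) <= c.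

Lemma cmeasurable_kernel1 y : cmeasurable (fun x => w x y).
Proof. exact: (cmeasurable_comp mw (pair2_measurable y)). Qed.

Lemma cmeasurable_kernel2 x : cmeasurable (w x).
Proof. exact: (cmeasurable_comp mw (pair1_measurable x)). Qed.

Lemma cintegrable_kernel x (rho : T2 -> R[i]) : cintegrable m2 setT rho ->
  cintegrable m2 setT (fun y => w x y * rho y).
Proof.
by move=> ir; apply: (cintegrableMl (c := c)) => //; exact: cmeasurable_kernel2.
Qed.

Lemma cnorm1_kernel x (rho : T2 -> R[i]) : cintegrable m2 setT rho ->
  cnorm1 (cint m2 setT (fun y => w x y * rho y)) <= c * \int[m2]_y cnorm1 (rho y).
Proof.
move=> ir; rewrite -RintegralZl//; last exact: integrable_cnorm1.
apply: (cnorm1_cint_le (cintegrable_kernel x ir)).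
  by have := integrableZl measurableT c (integrable_cnorm1 ir); apply: eq_integrable.
by move=> y; apply: (le_trans (cnorm1M _ _)); apply: ler_wpM2r => //; exact: cnorm1_ge0.
Qed.

Lemma cmeasurable_cint_kernel (rho : T2 -> R[i]) : cmeasurable rho ->
  cmeasurable (fun x => cint m2 setT (fun y => w x y * rho y)).
Proof.
move=> mr; apply: (cmeasurable_section m2 (f := fun p => w p.1 p.2 * rho p.2)).
by apply: cmeasurableM => //; exact: cmeasurable_comp mr _.
Qed.

(** The integrand is the tensor product of g and rho times the bounded factor w, so joint
    integrability is automatic. *)
Lemma fubini_kernel (g : T1 -> R[i]) (rho : T2 -> R[i]) :
  cintegrable m1 setT g -> cintegrable m2 setT rho ->
  cint m1 setT (fun x => cint m2 setT (fun y => w x y * rho y) * g x) =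
  cint m2 setT (fun y => cint m1 setT (fun x => w x y * g x) * rho y).
Proof.
move=> ig ir.
pose F (p : T1 * T2) := g p.1 * rho p.2 * w p.1 p.2.
have iF : cintegrable (product_measure1 m1 m2) setT F.
  by apply: (cintegrableMr (c := c)) => //; exact: cintegrable_tensor.
transitivity (cint m1 setT (fun x => cint m2 setT (fun y => F (x, y)))).
  congr (cint _ _ _); apply/funext => x.
  rewrite mulrC -cintZ; last exact: cintegrable_kernel.
  by congr (cint _ _ _); apply/funext => y; rewrite /F /=; ring.
rewrite (cfubini iF); congr (cint _ _ _); apply/funext => y.
rewrite mulrC -cintZ; last first.
  by apply: (cintegrableMl (c := c)) => //; exact: cmeasurable_kernel1.
by congr (cint _ _ _); apply/funext => x; rewrite /F /=; ring.
Qed.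

End FubiniKernel.

(** * Double primitives and their integrals over intervals *)

Section Primitives.
Context {R : realType}.
Local Notation mR := (measurableTypeR R).
Local Notation I1 f := (cint (@leb R) setT f).
Local Notation I2 f := (cint (@leb2 R) setT f).
Local Notation L1R f := (cintegrable (@leb R) setT f).
Local Notation L1R2 f := (cintegrable (@leb2 R) setT f).

Lemma is_derive_continuous (f : R -> R) (x l : R) :
  is_derive x (1 : R) f l -> {for x, continuous f}.
Proof. by move=> [df _]; apply: differentiable_continuous; exact/derivable1_diffP. Qed.

Lemma Rintegral_FTC2 (F f : R -> R) (al be : R) : al <= be ->
  (forall x, is_derive x (1 : R) F (f x)) -> continuous f ->
  \int[leb]_(x in `[al, be]) f x = F be - F al.
Proof.
move=> + dF cf; rewrite le_eqVlt => /predU1P[<-|ab].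
  by rewrite set_itv1 Rintegral_set1 subrr.
have cF : continuous F by move=> x; exact: (is_derive_continuous (dF x)).
rewrite /Rintegral (@continuous_FTC2 _ f F)//.
- exact: continuous_subspaceT.
- split.
  + by move=> x _; have [] := dF x.
  + exact/cvg_at_right_filter/cF.
  + exact/cvg_at_left_filter/cF.
- by move=> x _; rewrite derive1E; have [] := dF x.
Qed.

Lemma bounded_itv_cintegrable (al be c : R) (f : R -> R[i]) :
  cmeasurable (f : mR -> _) -> (forall x, al <= x <= be -> cnorm1 (f x) <= c) ->
  L1R (fun x : R => ind (al <= x <= be) * f x).
Proof.
move=> mf fc.
have mb : measurable_fun setT (fun x : mR => (al <= (x : R) <= be)).
  by apply: measurable_and; apply: measurable_fun_ler => //; exact: measurable_cst.
(* The interval may be empty, in which case the bound says nothing about the sign of c; hence the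
   absolute value. *)
apply: (@cintegrable_le R _ mR leb _ (fun x : mR => `|c| * \1_(`[al, be]%classic) x)).
- by apply: cmeasurableM => //; exact: cmeasurable_bool.
- rewrite (_ : EFin \o _ = fun x => (`|c|%:E * (\1_(`[al, be]%classic) x)%:E)%E); last first.
    by apply/funext.
  apply: integrableZl => //; apply: integrable_indic_itv.
- move=> x; rewrite indicE mem_setE in_itv/=; case: (boolP (al <= (x : R) <= be)) => [/fc fx|_].
  + by rewrite ind1 mul1r mulr1; apply: (le_trans fx); exact: ler_norm.
  + by rewrite ind0 mul0r cnorm1_0 mulr_ge0.
Qed.

Lemma bounded_dist_cintegrable (t0 r c : R) (f : R -> R[i]) :
  cmeasurable (f : mR -> _) -> (forall t, `|t - t0| <= r -> cnorm1 (f t) <= c) ->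
  L1R (fun t => ind (`|t - t0| <= r) * f t).
Proof.
move=> mf fc; rewrite (_ : (fun t => _) = fun t => ind (t0 - r <= t <= t0 + r) * f t).
  by apply: (bounded_itv_cintegrable (c := c)) => // t; rewrite -ler_distl; exact: fc.
by apply/funext => t; rewrite ler_distl.
Qed.

Lemma cint_real (f : R -> R) : I1 (fun x => (f x)%:C) = (\int[leb]_x f x)%:C.
Proof.
by apply: complex_eqP => //=; rewrite /im /= Rintegral_cst// mul0r.
Qed.

Lemma I1_itv_real (f : R -> R) (al be : R) :
  I1 (fun x : R => ind (al <= x <= be) * (f x)%:C) = (\int[leb]_(x in `[al, be]) f x)%:C.
Proof.
rewrite Rintegral_mkcond -cint_real; congr (cint _ _ _); apply/funext => x.
by rewrite patchE mem_setE in_itv/=; case: (boolP (al <= x <= be)) => _; rewrite ?ind1 ?ind0 ?mul1r ?mul0r.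
Qed.

Lemma I1_affine_itv (al be m n : R) : al <= be ->
  I1 (fun x : R => ind (al <= x <= be) * (m * x + n)%:C) =
  (m * (be ^+ 2 - al ^+ 2) / 2 + n * (be - al))%:C.
Proof.
move=> ab; rewrite I1_itv_real; congr (_ %:C).
have dF (x : R) : is_derive x (1 : R) (fun x : R => m * x ^+ 2 / 2 + n * x) (m * x + n).
  apply: is_deriveD.
  - have -> : (fun x : R => m * x ^+ 2 / 2) = (fun x : R => (m / 2) *: (x ^+ 2)).
      by apply/funext => y; rewrite /GRing.scale /=; ring.
    by apply: is_derive_eq; rewrite /GRing.scale /= ?expr1; field.
  - change (is_derive x (1 : R) (fun x : R => n *: x) n).
    by apply: is_derive_eq; rewrite /GRing.scale /= mulr1.
have cf : continuous (fun x : R => m * x + n).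
  by move=> x; apply: continuousD; [apply: continuousM => //; exact: cvg_cst|exact: cvg_cst].
by rewrite (Rintegral_FTC2 ab dF cf); ring.
Qed.

Local Notation ind := (@ind R).

Lemma cmeasurable_bool_itv (al be : R) : cmeasurable (fun x : mR => ind (al <= (x : R) <= be)).
Proof.
by apply: cmeasurable_bool; apply: measurable_and; apply: measurable_fun_ler => //;
  exact: measurable_cst.
Qed.

Lemma measurable_posdiff (t : R) : measurable_fun setT (fun s : mR => Num.max 0 (t - s) : mR).
Proof.
by apply: measurable_maxr; [exact: measurable_cst|apply: measurable_funB => //; exact: measurable_cst].
Qed.

(** Cauchy's formula for the double primitive from minus infinity. *)
Definition prim2 (f : R -> R[i]) (t : R) : R[i] :=
  I1 (fun s => (Num.max 0 (t - s))%:C * f s).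

(** A Taylor formula for the fundamental solution (t - s)_+ of the second derivative: the integral
    over an interval is its length times the value at the centre, and the remainder is the
    contribution of the kink at s. *)
Lemma cone_posdiff (r t0 s : R) : 0 <= r ->
  I1 (fun t : R => ind (`|t - t0| <= r) * (Num.max 0 (t - s))%:C) =
  (2 * r * Num.max 0 (t0 - s) + Num.max 0 (r - `|s - t0|) ^+ 2 / 2)%:C.
Proof.
(* Left of [lo] either the point is outside the interval or the positive part vanishes; right of it
   the integrand is affine. *)
move=> r0; pose lo := Num.max (t0 - r) s.
have [lohi|hilo] := leP lo (t0 + r); last first.
  rewrite (_ : (fun t => _) = fun=> 0); last first.
    apply/funext => t; case: (boolP (_ <= r)); rewrite ?ind1 ?ind0 ?mul0r// ler_norml => /andP[h1 h2].
    rewrite max_l ?mulr0//; move: hilo; rewrite /lo lt_max; lra.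
  rewrite cint0; have h : t0 + r < s by move: hilo; rewrite /lo lt_max; lra.
  rewrite max_l ?max_l ?expr0n/= ?mul0r ?mulr0 ?addr0//; last lra.
  by have := ler_norm (s - t0); lra.
rewrite (_ : (fun t => _) = (fun t => ind (lo <= t <= t0 + r) * (1 * t + (- s))%:C)); last first.
  apply/funext => t; rewrite mul1r /lo ge_max.
  case: (boolP (`|t - t0| <= r)) => [|]; rewrite ler_norml ?ind1 ?ind0.
  - move=> /andP[h1 h2]; have -> : (t0 - r <= t) = true by apply/idP; lra.
    have -> : (t <= t0 + r) = true by apply/idP; lra.
    rewrite andbT/=; have [ts|st] := leP s t.
    + by rewrite max_r ?subr_ge0// ind1.
    + by rewrite max_l ?subr_le0 ?(ltW st)// ind0 mul1r mul0r.
  - rewrite negb_and -!ltNge mul0r; have [h1|h1] := leP (t0 - r) t; last by rewrite ind0 mul0r.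
    have [h2|h2] := leP t (t0 + r); last by rewrite andbF ind0 mul0r.
    by move=> /orP[] ?; exfalso; lra.
rewrite (I1_affine_itv 1 (- s) lohi); congr (_ %:C).
move: lohi; rewrite /lo; have [h1|h1] := leP (t0 - r) s => h2.
- have [h3|h3] := leP s t0.
  + rewrite max_r; last lra.
    rewrite ler0_norm; last lra. rewrite max_r; last lra. by field.
  + rewrite max_l; last lra.
    rewrite ger0_norm; last lra. rewrite max_r; last lra. by field.
- rewrite max_r; last lra.
  rewrite ler0_norm; last lra. rewrite max_l; last lra. by field.
Qed.

Section Prim2.
Context (f : R -> R[i]) (A : R).
Hypotheses (If : L1R f) (fA : forall s, A < `|s| -> f s = 0).

Lemma L1R_suppM (g : R -> R[i]) (c : R) : cmeasurable (g : mR -> _) ->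
  (forall s, `|s| <= A -> cnorm1 (g s) <= c) -> L1R (fun s => g s * f s).
Proof.
move=> mg gc; apply: (@cintegrable_le _ _ mR _ _ (fun s => c * cnorm1 (f s))).
- by apply: cmeasurableM => //; exact: cintegrable_measurable If.
- by have := integrableZl measurableT c (integrable_cnorm1 If); apply: eq_integrable.
- move=> s; apply: (le_trans (cnorm1M _ _)).
  have [/gc h|/fA ->] := leP `|s| A; last by rewrite cnorm1_0 !mulr0.
  by apply: ler_wpM2r => //; exact: cnorm1_ge0.
Qed.

Lemma L1R_prim2 (t0 : R) : L1R (fun s => (Num.max 0 (t0 - s))%:C * f s).
Proof.
apply: (L1R_suppM (c := `|t0| + `|A|)).
  by apply: cmeasurable_real; exact: measurable_posdiff.
move=> s; rewrite ler_norml => /andP[? ?].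
rewrite cnorm1_real ger0_norm ?le_max ?lexx// ge_max !addr_ge0//=.
by have := ler_norm A; have := ler_norm t0; lra.
Qed.

Lemma cmeasurable_prim2 : cmeasurable (prim2 f : mR -> _).
Proof.
have mw : cmeasurable (fun p : mR * mR => ind true * (Num.max 0 (p.1 - p.2))%:C).
  apply: cmeasurableM; first exact: cmeasurable_cst.
  apply: cmeasurable_real; apply: measurable_maxr; first exact: measurable_cst.
  by apply: measurable_funB.
have := @cmeasurable_cint_kernel R _ _ _ _ (@sleb R) (fun t s : mR => ind true * (Num.max 0 ((t : R) - s))%:C) mw f (cintegrable_measurable If).
rewrite (_ : (fun x => _) = prim2 f)//; apply/funext => t.
by congr (cint _ _ _); apply/funext => s; rewrite ind1 mul1r.
Qed.

Lemma cnorm1_prim2 t : cnorm1 (prim2 f t) <= (`|t| + `|A|) * \int[leb]_s cnorm1 (f s).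
Proof.
rewrite -RintegralZl//; last exact: integrable_cnorm1.
apply: (cnorm1_cint_le (L1R_prim2 t)).
  by have := integrableZl measurableT (`|t| + `|A|) (integrable_cnorm1 If); apply: eq_integrable.
move=> s; apply: (le_trans (cnorm1M _ _)).
have [sA|/fA ->] := leP `|s| A; last by rewrite cnorm1_0 !mulr0.
apply: ler_wpM2r; first exact: cnorm1_ge0.
rewrite cnorm1_real ger0_norm ?le_max ?lexx// ge_max !addr_ge0//=.
move: sA; rewrite ler_norml => /andP[? ?].
by have := ler_norm A; have := ler_norm t; lra.
Qed.

(** Superposition of [cone_posdiff] over the points s, with weight f. *)
Lemma cint_cone_prim2 (r t0 : R) : 0 <= r ->
  I1 (fun t => ind (`|t - t0| <= r) * prim2 f t) =
  (2 * r)%:C * prim2 f t0 +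
  I1 (fun s => (Num.max 0 (r - `|s - t0|) ^+ 2 / 2)%:C * f s).
Proof.
move=> r0.
have A0 (s : R) : ~~ (`|s| <= A) -> f s = 0 by rewrite -ltNge; exact: fA.
(* The factor restricting s to the support of f does not change the integral, but makes the kernel
   bounded, as Fubini requires. *)
pose w (t s : R) : R[i] := ind (`|t - t0| <= r) * (ind (`|s| <= A) * (Num.max 0 (t - s))%:C).
have mi (u v : R) : cmeasurable (fun x : mR => ind (`|(x : R) - u| <= v)).
  apply: cmeasurable_bool; apply: measurable_fun_ler; last exact: measurable_cst.
  by apply: measurableT_comp => //; apply: measurable_funB => //; exact: measurable_cst.
have mp : cmeasurable (fun p : mR * mR => (Num.max 0 (p.1 - p.2))%:C).
  apply: cmeasurable_real; apply: measurable_maxr; first exact: measurable_cst.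
  by apply: measurable_funB.
have mw : cmeasurable (fun p : mR * mR => w p.1 p.2).
  apply: cmeasurableM; first exact: (cmeasurable_comp (mi t0 r) measurable_fst).
  apply: cmeasurableM => //.
  by have := cmeasurable_comp (mi 0 A) (measurable_snd (T1 := mR)); under eq_fun do rewrite subr0.
have wc t s : cnorm1 (w t s) <= `|t0| + r + `|A|.
  rewrite /w; case: (boolP (_ <= r)) => h1; rewrite ?ind1 ?ind0 ?mul0r ?cnorm1_0 ?addr_ge0//.
  rewrite mul1r; case: (boolP (_ <= A)) => h2; rewrite ?ind1 ?ind0 ?mul0r ?cnorm1_0 ?addr_ge0//.
  rewrite mul1r cnorm1_real ger0_norm ?le_max ?lexx// ge_max !addr_ge0//=.
  have := ler_norm A; move: h1 h2; rewrite !ler_norml => /andP[? ?] /andP[? ?].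
  by have := ler_norm t0; lra.
have Iind : L1R (fun t : R => ind (`|t - t0| <= r)).
  have := @bounded_itv_cintegrable (t0 - r) (t0 + r) 1 (fun=> 1) (cmeasurable_cst _).
  move=> /(_ (fun x _ => cnorm1_bool true)); congr (cintegrable _ _ _); apply/funext => t.
  by rewrite mulr1 ler_distl.
have := @fubini_kernel R _ _ _ _ (@sleb R) (@sleb R) w _ mw wc _ _ Iind If.
set L := cint _ _ _; set M := cint _ _ _ => LM.
transitivity L.
  congr (cint _ _ _); apply/funext => t; rewrite /w /prim2.
  case: (boolP (`|t - t0| <= r)) => _; rewrite ?ind1 ?ind0 ?mul0r ?mulr0// mul1r mulr1.
  congr (cint _ _ _); apply/funext => s; rewrite mul1r.
  by case: (boolP (`|s| <= A)) => [_|/A0 ->]; rewrite ?ind1 ?mul1r ?mulr0.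
rewrite LM /M /prim2 -cintZ; last exact: L1R_prim2.
rewrite -cintD; last 2 first.
- by apply: cintegrableZ; exact: L1R_prim2.
- apply: (L1R_suppM (c := r ^+ 2 / 2)).
    apply: cmeasurable_real; apply: measurable_funM; last exact: measurable_cst.
    apply: measurable_funX; apply: measurable_maxr; first exact: measurable_cst.
    apply: measurable_funB; first exact: measurable_cst.
    by apply: measurableT_comp => //; apply: measurable_funB => //; exact: measurable_cst.
  move=> s _; rewrite cnorm1_real ger0_norm ?divr_ge0 ?sqr_ge0// ler_wpM2r ?invr_ge0//.
  rewrite ler_pXn2r ?nnegrE ?le_max ?lexx// ge_max r0/=.
  by have := normr_ge0 (s - t0); lra.
congr (cint _ _ _); apply/funext => s; rewrite mulrA -mulrDl.
case: (boolP (`|s| <= A)) => [sA|/A0 ->]; last by rewrite !mulr0.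
congr (_ * _); transitivity (I1 (fun t : R => ind (`|t - t0| <= r) * (Num.max 0 (t - s))%:C)).
  congr (cint _ _ _); apply/funext => t; rewrite /w sA ind1 mul1r.
  by case: (boolP (`|t - t0| <= r)) => _; rewrite ?ind1 ?ind0 ?mul1r ?mulr1 ?mul0r.
by rewrite cone_posdiff// -rmorphM -rmorphD.
Qed.

End Prim2.

End Primitives.

(** * Integrals over light cones *)

Section Source.
Context {R : realType} {d : measure_display} {T : measurableType d}.
Context (mu : {sigma_finite_measure set T -> \bar R}).
Local Notation mR := (measurableTypeR R).
Local Notation I1 f := (cint (@leb R) setT f).
Local Notation L1R f := (cintegrable (@leb R) setT f).
Local Notation ind := (@ind R).
Context (rho : T -> R[i]) (sg tau : T -> R).
Hypothesis irho : cintegrable mu setT rho.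
Hypothesis msg : measurable_fun setT (sg : T -> mR).
Hypothesis mtau : measurable_fun setT (tau : T -> mR).
Hypothesis supp : forall p, sg p < `|tau p| -> rho p = 0.

(** Sources are indexed by an abstract measure space with time [sg] and position [tau], so that
    sources on the diagonal and sources in the plane are treated at once. By [supp] they all lie in
    the forward cone of the origin. *)
Definition cone (x t : R) (p : T) : R[i] := ind (`|t - tau p| <= x - sg p).

(* d'Alembert's formula: the sources [rho p], located at time [sg p] and position [tau p], are
   integrated over the backward light cone of position [t] at time [x]. *)
Definition cone_kernel (x t : R) : R[i] :=
  2^-1 * cint mu setT (fun p => cone x t p * rho p).

Definition cone_operator (f : R -> R[i]) (x : R) : R[i] :=
  I1 (fun t => cone_kernel x t * f t).

Definition jkernel (x y : R) : R[i] := ind (0 <= y <= x) * (x - y)%:C.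

Lemma cnorm1_cone x t p : cnorm1 (cone x t p) <= 1.
Proof. exact: cnorm1_bool. Qed.

Lemma cmeasurable_cone : cmeasurable (fun r : (mR * mR) * T => cone r.1.1 r.1.2 r.2).
Proof.
apply: cmeasurable_bool; apply: measurable_fun_ler.
- apply: measurableT_comp => //; apply: measurable_funB.
  + exact: (measurableT_comp measurable_snd).
  + exact: (measurableT_comp mtau).
- apply: measurable_funB.
  + exact: (measurableT_comp measurable_fst).
  + exact: (measurableT_comp msg).
Qed.

Lemma cmeasurable_cone_t x : cmeasurable (fun r : mR * T => cone x r.1 r.2).
Proof.
have h : measurable_fun setT (fun r : mR * T => ((x : mR, r.1), r.2)).
  by apply: measurable_fun_pair => //; apply: measurable_fun_pair => //; exact: measurable_cst.
exact: (cmeasurable_comp cmeasurable_cone h).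
Qed.

Lemma cone_kernel_supp x t : x < `|t| -> cone_kernel x t = 0.
Proof.
move=> xt; rewrite /cone_kernel (_ : (fun p => _) = fun=> 0) ?cint0 ?mulr0//.
apply/funext => p; have [tp|/supp ->] := leP `|tau p| (sg p); last by rewrite mulr0.
rewrite /cone (_ : (_ <= _) = false) ?ind0 ?mul0r//.
apply/negbTE; rewrite -ltNge.
have := ler_normD (t - tau p) (tau p); rewrite subrK; lra.
Qed.

Lemma L1R_jkernel x : L1R (jkernel x).
Proof.
apply: (@bounded_itv_cintegrable R 0 x x).
- apply: cmeasurable_real; apply: measurable_funB => //; exact: measurable_cst.
- move=> y /andP[? ?]; rewrite cnorm1_real ger0_norm; lra.
Qed.

Lemma cint_cone_affine (r t0 : R) (c0 c1 : R[i]) : 0 <= r ->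
  I1 (fun t => ind (`|t - t0| <= r) * (c0 + c1 * t%:C)) = (2 * r)%:C * (c0 + c1 * t0%:C).
Proof.
move=> r0; have ab : t0 - r <= t0 + r by lra.
have i (m n : R) : L1R (fun t : R => ind (t0 - r <= t <= t0 + r) * (m * t + n)%:C).
  apply: (@bounded_itv_cintegrable R _ _ (`|m| * (`|t0| + r) + `|n|)).
    apply: cmeasurable_real; exact: measurable_affine.
  move=> t /andP[? ?]; rewrite cnorm1_real; apply: (le_trans (ler_normD _ _)).
  rewrite lerD// normrM ler_wpM2l// ler_norml.
  by have := ler_norm t0; have := lerNnormlW (lexx `|t0|); move=> *; apply/andP; split; lra.
transitivity (I1 (fun t : R => c0 * (ind (t0 - r <= t <= t0 + r) * (0 * t + 1)%:C) +
    c1 * (ind (t0 - r <= t <= t0 + r) * (1 * t + 0)%:C))).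
  congr (cint _ _ _); apply/funext => t; rewrite -ler_distl mul0r add0r mul1r addr0.
  by rewrite rmorph1; ring.
rewrite cintD; [|by apply: cintegrableZ; exact: i..].
rewrite !cintZ; [|exact: i..]; rewrite !I1_affine_itv//.
have -> : (0 * ((t0 + r) ^+ 2 - (t0 - r) ^+ 2) / 2 + 1 * (t0 + r - (t0 - r))) = 2 * r by ring.
have -> : (1 * ((t0 + r) ^+ 2 - (t0 - r) ^+ 2) / 2 + 0 * (t0 + r - (t0 - r))) = 2 * r * t0 by field.
by rewrite (rmorphM _ (2 * r) t0); ring.
Qed.

(** At position t the cone condition reads y >= sg p + |t - tau p|, so x - y is integrated from
    there to x; with sg p >= 0 the lower limit 0 of [jkernel] is never active. The value is the
    remainder term of [cint_cone_prim2] for r = x - sg p, and this coincidence makes the operator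
    reappear under the double primitive. *)
Lemma cint_jkernel_cone x t p : 0 <= sg p ->
  I1 (fun y => cone y t p * jkernel x y) =
  (Num.max 0 (x - sg p - `|t - tau p|) ^+ 2 / 2)%:C.
Proof.
move=> s0; pose al := sg p + `|t - tau p|.
have al0 : 0 <= al by rewrite addr_ge0.
have E : (fun y => cone y t p * jkernel x y) =
    (fun y => ind (al <= y <= x) * ((- 1) * y + x)%:C).
  apply/funext => y; rewrite /cone /jkernel mulrA indM.
  congr (ind _ * _%:C); last by ring.
  rewrite /al; apply/idP/idP => [/andP[h1 /andP[h2 h3]]|/andP[h1 h2]].
    by rewrite h3 andbT; lra.
  by move: al0; rewrite /al h2 => ?; apply/and3P; split => //; lra.
rewrite E; have [alx|xal] := leP al x.
  rewrite I1_affine_itv//; congr (_ %:C).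
  by rewrite max_r; [rewrite /al; field|rewrite -addrA -opprD subr_ge0].
rewrite (_ : (fun y => _) = fun=> 0) ?cint0.
  by rewrite max_l ?expr0n/= ?mul0r// -addrA -opprD subr_le0 ltW.
apply/funext => y; have [h1|h1] := leP al y; last by rewrite ind0 mul0r.
by have [h2|h2] := leP y x; rewrite ?ind0 ?mul0r//; exfalso; lra.
Qed.

Lemma cone_operatorE f x : L1R f ->
  cone_operator f x = 2^-1 * cint mu setT (fun p => I1 (fun t => cone x t p * f t) * rho p).
Proof.
move=> If; rewrite -(@fubini_kernel R _ _ _ _ (@sleb R) mu (cone x) 1)//; last 2 first.
  - exact: cmeasurable_cone_t.
  - exact: cnorm1_cone.
rewrite /cone_operator /cone_kernel -cintZ; last first.
  apply: (cintegrableMl (c := \int[mu]_p cnorm1 (rho p))) => //.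
  - exact: (cmeasurable_cint_kernel mu (cmeasurable_cone_t x) (cintegrable_measurable irho)).
  - move=> t; have := @cnorm1_kernel R _ _ _ _ mu (cone x) 1 (cmeasurable_cone_t x) (cnorm1_cone x) t rho irho.
    by rewrite mul1r.
by congr (cint _ _ _); apply/funext => t; rewrite mulrA.
Qed.

Section Prim2Identity.
Context (f : R -> R[i]) (A x : R) (c0 c1 : R[i]).
Hypotheses (If : L1R f) (fA : forall s, A < `|s| -> f s = 0).
Hypothesis x0 : 0 <= x.
Let k t := c0 + c1 * t%:C + prim2 f t.
Let k1 t := ind (`|t| <= x) * k t.

(* [jkernel x] is the kernel of the double primitive from 0, so that this expresses
   V u = J (V u'' + source * u). *)
Lemma cone_operator_prim2 : L1R k1 ->
  (exists c, forall t, cnorm1 (k1 t) <= c) ->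
  cone_operator k1 x =
  cint mu setT (fun p => jkernel x (sg p) * k1 (tau p) * rho p) +
  I1 (fun y => jkernel x y * cone_operator f y).
Proof.
move=> Ik1 [c k1c].
have mk1 := cintegrable_measurable Ik1.
pose M t p := I1 (fun y => cone y t p * jkernel x y).
pose w2 y p := I1 (fun t => cone y t p * f t).
pose g2 p := I1 (fun y => w2 y p * jkernel x y).
have mw2 : cmeasurable (fun r : mR * T => w2 r.1 r.2).
  apply: (@cmeasurable_cint_kernel R _ _ _ _ (@sleb R) (fun (r : mR * T) t => cone r.1 t r.2) _ f).
    have h : measurable_fun setT (fun r : (mR * T) * mR => ((r.1.1, r.2), r.1.2)).
      apply: measurable_fun_pair; first apply: measurable_fun_pair => //.
        exact: (measurableT_comp measurable_fst).
      exact: (measurableT_comp measurable_snd).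
    exact: (cmeasurable_comp cmeasurable_cone h).
  exact: cintegrable_measurable If.
have mcy p : cmeasurable (fun r : mR * mR => cone r.1 r.2 p).
  have h : measurable_fun setT (fun r : mR * mR => (r, p)) by exact: pair2_measurable.
  exact: (cmeasurable_comp cmeasurable_cone h).
have w2c y p : cnorm1 (w2 y p) <= \int[leb]_t cnorm1 (f t).
  have := @cnorm1_kernel R _ _ _ _ (@sleb R) (fun y t => cone y t p) 1 (mcy p) _ y f If.
  by rewrite mul1r; apply=> *; exact: cnorm1_cone.
have MG p : I1 (fun t => M t p * f t) = g2 p.
  exact: (esym (@fubini_kernel R _ _ _ _ (@sleb R) (@sleb R) (fun y t => cone y t p) 1 (mcy p) (fun y t => cnorm1_cone y t p) _ _ (L1R_jkernel x) If)).
have msw : measurable_fun setT (fun r : T * mR => (r.2, r.1)) by exact: measurable_swap.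
have mg2 : cmeasurable g2.
  apply: (@cmeasurable_cint_kernel R _ _ _ _ (@sleb R) (fun p y => w2 y p) _ (jkernel x)).
    exact: (cmeasurable_comp mw2 msw).
  exact: cintegrable_measurable (L1R_jkernel x).
have g2c p : cnorm1 (g2 p) <= (\int[leb]_t cnorm1 (f t)) * (\int[leb]_y cnorm1 (jkernel x y)).
  apply: (@cnorm1_kernel R _ _ _ _ (@sleb R) (fun p y => w2 y p) _ _ _ p _ (L1R_jkernel x)).
    exact: (cmeasurable_comp mw2 msw).
  by move=> *; exact: w2c.
(* For a single source, [cint_cone_prim2] with centre [tau p] and radius x - sg p: the central value
   carries 2 (x - sg p), twice the kernel of J, and the remainder is [g2 p] by
   [cint_jkernel_cone]. *)
have point p : I1 (fun t => cone x t p * k1 t) * rho p =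
    2 * (jkernel x (sg p) * k1 (tau p) * rho p) + g2 p * rho p.
  have [tp|/supp ->] := leP `|tau p| (sg p); last by rewrite !mulr0 addr0.
  have s0 : 0 <= sg p by apply: le_trans tp.
  rewrite [2 * _]mulrA -mulrDl; congr (_ * _); rewrite -MG.
  have -> : (fun t => M t p * f t) =
      (fun t => (Num.max 0 (x - sg p - `|t - tau p|) ^+ 2 / 2)%:C * f t).
    by apply/funext => t; rewrite /M cint_jkernel_cone.
  (* A source later than x contributes nothing to either side. *)
  have [sx|xs] := leP (sg p) x; last first.
    rewrite (_ : (fun t => cone _ _ _ * _) = fun=> 0); last first.
      apply/funext => t; rewrite /cone (_ : (_ <= _) = false) ?ind0 ?mul0r//.
      by apply/negbTE; rewrite -ltNge; apply: lt_le_trans (normr_ge0 _); rewrite subr_lt0.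
    rewrite (_ : (fun t => _%:C * _) = fun=> 0); last first.
      apply/funext => t; rewrite max_l ?expr0n/= ?mul0r//.
      by have := normr_ge0 (t - tau p); lra.
    by rewrite /jkernel cint0 (leNgt (sg p) x) xs andbF ind0 !mul0r mulr0 addr0.
  have r0 : 0 <= x - sg p by rewrite subr_ge0.
  transitivity (I1 (fun t => ind (`|t - tau p| <= x - sg p) * (c0 + c1 * t%:C) +
      ind (`|t - tau p| <= x - sg p) * prim2 f t)).
    congr (cint _ _ _); apply/funext => t; rewrite /cone /k1 /k.
    case: (boolP (_ <= x - sg p)) => h; rewrite ?ind1 ?ind0 ?mul0r ?addr0// !mul1r.
    (* Since |tau p| <= sg p, the interval of radius x - sg p about [tau p] lies in |t| <= x, so the
       truncation in [k1] is not seen. *)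
    rewrite (_ : (_ <= _) = true) ?ind1 ?mul1r//; apply/idP.
    by have := ler_normD (t - tau p) (tau p); rewrite subrK; lra.
  have hn t : `|t - tau p| <= x - sg p -> `|t| <= `|tau p| + (x - sg p).
    by move=> h; have := ler_normD (t - tau p) (tau p); rewrite subrK; lra.
  rewrite cintD; last 2 first.
  - apply: (bounded_dist_cintegrable (c := cnorm1 c0 + cnorm1 c1 * (`|tau p| + (x - sg p)))).
      apply: cmeasurableD; first exact: cmeasurable_cst.
      by apply: cmeasurableM; [exact: cmeasurable_cst|apply: cmeasurable_real].
    move=> t /hn ht; apply: (le_trans (cnorm1D _ _)); rewrite lerD//.
    apply: (le_trans (cnorm1M _ _)); apply: ler_wpM2l; first exact: cnorm1_ge0.
    by rewrite cnorm1_real.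
  - apply: (bounded_dist_cintegrable (c := (`|tau p| + (x - sg p) + `|A|) * \int[leb]_s cnorm1 (f s))).
      exact: cmeasurable_prim2.
    move=> t /hn ht; apply: (le_trans (cnorm1_prim2 If fA t)).
    apply: ler_wpM2r; last by rewrite lerD2r.
    by apply: Rintegral_ge0 => *; exact: cnorm1_ge0.
  rewrite cint_cone_affine// (cint_cone_prim2 If fA)// addrA; congr (_ + _).
  rewrite /jkernel s0 sx ind1 mul1r /k1 (le_trans tp sx) ind1 mul1r /k.
  by rewrite rmorphM /= (_ : 2%:C = 2 :> R[i]) ?rmorph_nat//; ring.
have jc y : cnorm1 (jkernel x y) <= x.
  rewrite /jkernel; case: (boolP (0 <= y <= x)) => [/andP[h1 h2]|_].
    by rewrite ind1 mul1r cnorm1_real ger0_norm; lra.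
  by rewrite ind0 mul0r cnorm1_0.
have ijk : cintegrable mu setT (fun p => jkernel x (sg p) * k1 (tau p) * rho p).
  have mj := cintegrable_measurable (L1R_jkernel x).
  apply: (cintegrableMl (c := x * c)) => //.
    by apply: cmeasurableM; [exact: (cmeasurable_comp mj msg)|exact: (cmeasurable_comp mk1 mtau)].
  by move=> p; apply: (le_trans (cnorm1M _ _)); apply: ler_pM => //; exact: cnorm1_ge0.
rewrite cone_operatorE//; transitivity (2^-1 * cint mu setT
    (fun p => 2 * (jkernel x (sg p) * k1 (tau p) * rho p) + g2 p * rho p)).
  by congr (_ * cint _ _ _); apply/funext => p; exact: point.
rewrite cintD; last 2 first.
- exact: cintegrableZ.
- exact: (cintegrableMl irho mg2 g2c).
rewrite cintZ// mulrDr mulrA mulVf ?mul1r ?pnatr_eq0//; congr (_ + _).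
rewrite -(@fubini_kernel R _ _ _ _ (@sleb R) mu w2 _ mw2 w2c _ _ (L1R_jkernel x) irho) -cintZ.
  congr (cint _ _ _); apply/funext => y; rewrite cone_operatorE//.
  by rewrite /w2; ring.
apply: (@cintegrableMl R _ mR (@leb R) (jkernel x) (fun y => cint mu setT (fun p => w2 y p * rho p)) ((\int[leb]_t cnorm1 (f t)) * \int[mu]_p cnorm1 (rho p)) (L1R_jkernel x)).
  exact: (cmeasurable_cint_kernel mu mw2 (cintegrable_measurable irho)).
by move=> y; exact: (cnorm1_kernel (c := \int[leb]_t cnorm1 (f t)) mw2 w2c y irho).
Qed.

End Prim2Identity.
End Source.

(** * First primitives, the fundamental theorem and integration by parts *)

Section FirstPrimitive.
Context {R : realType}.
Local Notation mR := (measurableTypeR R).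
Local Notation I1 f := (cint (@leb R) setT f).
Local Notation L1R f := (cintegrable (@leb R) setT f).
Local Notation ind := (@ind R).

Lemma ball_eq_continuous (f g : R -> R) (x e : R) : 0 < e ->
  (forall y, `|y - x| < e -> f y = g y) ->
  {for x, continuous g} -> {for x, continuous f}.
Proof.
move=> e0 fg cg; rewrite /prop_for /continuous_at fg ?subrr ?normr0//.
apply: cvg_trans cg; apply: near_eq_cvg; near=> y; apply/esym/fg.
rewrite distrC; near: y; exact: cvgr_dist_lt.
Unshelve. all: by end_near. Qed.

Lemma ball_eq_is_derive (f g : R -> R) (x e l : R) : 0 < e ->
  (forall y, `|y - x| < e -> f y = g y) ->
  is_derive x (1 : R) g l -> is_derive x (1 : R) f l.
Proof.
move=> e0 fg; apply: near_eq_is_derive; near=> y; apply/esym/fg.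
rewrite distrC; near: y; exact: cvgr_dist_lt.
Unshelve. all: by end_near. Qed.

Definition ccontinuous (f : R -> R[i]) := continuous (re f) /\ continuous (im f).

Definition prim1 (f : R -> R[i]) (x : R) : R[i] := I1 (fun s => ind (s <= x) * f s).

Lemma measurable_le_cst (x : R) : measurable_fun setT (fun s : mR => ((s : R) <= x)).
Proof. by apply: measurable_fun_ler => //; exact: measurable_cst. Qed.

Lemma ccontinuous_measurable f : ccontinuous f -> cmeasurable (f : mR -> _).
Proof. by move=> [c1 c2]; split; exact: continuous_measurable_fun. Qed.

Lemma ccontinuous_bounded f (al be : R) : ccontinuous f ->
  exists c, forall x, al <= x <= be -> cnorm1 (f x) <= c.
Proof.
move=> [c1 c2].
have key (g : R -> R) : continuous g -> exists c, forall x, al <= x <= be -> `|g x| <= c.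
  move=> cg; have [ab|ba] := leP al be; last by exists 0 => x /andP[? ?]; exfalso; lra.
  have [c cmax Hc] := @EVT_max R (fun x => `|g x|) al be ab
    (continuous_subspaceT (fun x => continuous_comp (cg x) (@norm_continuous _ _ _))).
  by exists `|g c| => x xab; apply: Hc; rewrite in_itv.
have [m1 h1] := key _ c1; have [m2 h2] := key _ c2.
by exists (m1 + m2) => x xab; rewrite /cnorm1 lerD ?h1 ?h2.
Qed.

Lemma oint_prim1 f (x y : R) : L1R f -> oint x y f = prim1 f y - prim1 f x.
Proof.
move=> If.
have key (u v : R) : u <= v -> cint leb `[u, v] f = prim1 f v - prim1 f u.
  move=> uv; rewrite /prim1.
  have e (z : R) : I1 (fun s => ind (s <= z) * f s) = cint leb `]-oo, z] f.
    rewrite [RHS]cint_mkcond; congr (cint _ _ _); apply/funext => s.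
    by rewrite mem_setE in_itv.
  have it (g : mR -> R) (D : set mR) : measurable D -> (@leb R).-integrable setT (EFin \o g) ->
      (@leb R).-integrable D (EFin \o g).
    by move=> mD; apply: integrableS.
  rewrite !e; case: If => f1 f2; apply: complex_eqP; rewrite ?cReD ?cImD ?cReN ?cImN /=.
  - rewrite [in RHS](Rintegral_itvB (it _ _ (measurable_itv _) f1))//.
    by rewrite Rintegral_itv_obnd_cbnd//; exact: it.
  - rewrite [in RHS](Rintegral_itvB (it _ _ (measurable_itv _) f2))//.
    by rewrite Rintegral_itv_obnd_cbnd//; exact: it.
rewrite /oint; case: ifPn => [|/negbTE xy]; first exact: key.
by rewrite key ?opprB// ltW// ltNge xy.
Qed.

Lemma ccontinuous_prim1 f : L1R f -> ccontinuous (prim1 f).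
Proof.
move=> If.
have key (g : mR -> R) : (@leb R).-integrable setT (EFin \o g) ->
    continuous (fun x : R => \int[leb]_(s in `]-oo, x]) g s).
  move=> ig x0.
  pose al := x0 - 1; pose be := x0 + 1.
  have ab : al <= be by rewrite /al /be; lra.
  have ii (D : set mR) : measurable D -> (@leb R).-integrable D (EFin \o g).
    by move=> mD; apply: integrableS ig.
  have := parameterized_integral_continuous ab (ii _ (measurable_itv _)).
  have x0ab : x0 \in `]al, be[ by rewrite in_itv /al /be /=; apply/andP; split; lra.
  have ab' : al < be by rewrite /al /be; lra.
  move=> /(within_continuous_continuous ab') /(_ x0ab) hc.
  apply: (@ball_eq_continuous _ (fun x => \int[leb]_(s in `]-oo, al]) g s +
      parameterized_integral leb al x g) x0 1) => //; last first.
    by apply: continuousD => //; exact: cvg_cst.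
  move=> y; rewrite ltr_distl => /andP[h1 h2].
  have aly : al <= y by rewrite /al; lra.
  rewrite /parameterized_integral -(Rintegral_itv_obnd_cbnd (ii _ (measurable_itv _))).
  rewrite -(@Rintegral_itvB R g -oo%O (BRight y) al (ii _ (measurable_itv _)))//.
  by rewrite addrCA subrr addr0.
have e (z : R) : prim1 f z = cint leb `]-oo, z] f.
  rewrite [RHS]cint_mkcond; congr (cint _ _ _); apply/funext => s.
  by rewrite mem_setE in_itv.
case: If => f1 f2; split.
- rewrite (_ : re _ = (fun x => \int[leb]_(s in `]-oo, x]) re f s)); first exact: key.
  by apply/funext => x; rewrite /re e.
- rewrite (_ : im _ = (fun x => \int[leb]_(s in `]-oo, x]) im f s)); first exact: key.
  by apply/funext => x; rewrite /im e.
Qed.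

Lemma cint_itv_derive (g : R -> R[i]) (al x : R) : ccontinuous g -> al < x ->
  is_cderive (fun t => I1 (fun y => ind (al <= y <= t) * g y)) x (g x).
Proof.
move=> [c1 c2] ax.
have key (h : R -> R) : continuous h ->
    is_derive x (1 : R) (fun t => \int[leb]_(y in `[al, t]) h y) (h x).
  move=> ch; have xu : x < x + 1 by lra.
  have ih : (@leb R).-integrable `[al, x + 1] (EFin \o h).
    by apply: continuous_compact_integrable; [exact: segment_compact|exact: continuous_subspaceT].
  have [d1 d2] := continuous_FTC1_closed xu ih ax (ch x).
  by split; [exact: d1|rewrite -derive1E; exact: d2].
have e t : I1 (fun y => ind (al <= y <= t) * g y) = cint leb `[al, t] g.
  rewrite [RHS]cint_mkcond; congr (cint _ _ _); apply/funext => s.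
  by rewrite mem_setE in_itv.
split.
- rewrite (_ : re _ = (fun t => \int[leb]_(y in `[al, t]) re g y)); first exact: key.
  by apply/funext => t; rewrite /re e.
- rewrite (_ : im _ = (fun t => \int[leb]_(y in `[al, t]) im g y)); first exact: key.
  by apply/funext => t; rewrite /im e.
Qed.

Lemma cint_FTC2 (F f : R -> R[i]) (al be : R) : al <= be ->
  (forall x, is_cderive F x (f x)) -> ccontinuous f ->
  I1 (fun x => ind (al <= x <= be) * f x) = F be - F al.
Proof.
move=> ab dF [c1 c2].
transitivity (cint leb `[al, be] f).
  rewrite [RHS]cint_mkcond; congr (cint _ _ _); apply/funext => s.
  by rewrite mem_setE in_itv.
apply: complex_eqP; rewrite ?cReD ?cImD ?cReN ?cImN /=.
- by apply: (@Rintegral_FTC2 R (re F)) => // x; have [] := dF x.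
- by apply: (@Rintegral_FTC2 R (im F)) => // x; have [] := dF x.
Qed.

Lemma is_cderive_eq_near (f g : R -> R[i]) (x e : R) l : 0 < e ->
  (forall y, `|y - x| < e -> f y = g y) -> is_cderive g x l -> is_cderive f x l.
Proof.
move=> e0 fg [g1 g2]; split.
- by apply: (ball_eq_is_derive e0 _ g1) => y xy; rewrite /re fg.
- by apply: (ball_eq_is_derive e0 _ g2) => y xy; rewrite /im fg.
Qed.

Lemma is_cderiveD (f g : R -> R[i]) (x : R) (l m : R[i]) : is_cderive f x l -> is_cderive g x m ->
  is_cderive (fun y => f y + g y) x (l + m).
Proof.
move=> [f1 f2] [g1 g2]; split; rewrite ?cReD ?cImD.
- rewrite (_ : re _ = re f + re g); first exact: is_deriveD.
  by apply/funext => y; rewrite /re cReD.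
- rewrite (_ : im _ = im f + im g); first exact: is_deriveD.
  by apply/funext => y; rewrite /im cImD.
Qed.

Lemma is_cderiveZ (c : R[i]) (f : R -> R[i]) (x : R) (l : R[i]) : is_cderive f x l ->
  is_cderive (fun y => c * f y) x (c * l).
Proof.
move=> [f1 f2]; split.
- have := is_deriveB (is_deriveZ (complex.Re c) f1) (is_deriveZ (complex.Im c) f2).
  rewrite cReM; congr (is_derive _ _ _ _).
  by apply/funext => y; rewrite /re cReM.
- have := is_deriveD (is_deriveZ (complex.Re c) f2) (is_deriveZ (complex.Im c) f1).
  rewrite cImM; congr (is_derive _ _ _ _).
  by apply/funext => y; rewrite /im cImM.
Qed.

Lemma is_cderive_cst (c : R[i]) (x : R) : is_cderive (fun=> c) x 0.
Proof. by split; exact: is_derive_cst. Qed.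

Lemma is_cderive_id (x : R) : is_cderive (fun y : R => y%:C) x 1.
Proof. by split; [exact: is_derive_id|exact: is_derive_cst]. Qed.

Lemma is_cderive_affine (c0 c1 : R[i]) (x : R) : is_cderive (fun y : R => c0 + c1 * y%:C) x c1.
Proof.
have := is_cderiveD (is_cderive_cst c0 x) (is_cderiveZ c1 (is_cderive_id x)).
by rewrite add0r mulr1.
Qed.

Lemma is_cderive_ccontinuous (f g : R -> R[i]) : (forall x, is_cderive f x (g x)) -> ccontinuous f.
Proof. by move=> df; split => x; have [d1 d2] := df x; exact: is_derive_continuous. Qed.

Section Prim2Derivative.
Context (f : R -> R[i]) (A : R).
Hypotheses (If : L1R f) (fA : forall s, A < `|s| -> f s = 0).

(** Fubini on the triangle s <= y <= t. As f lives in [-|A|, |A|], any starting point to the left of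
    it replaces minus infinity. *)
Lemma prim2_prim1 (al t : R) : al <= - `|A| -> al <= t ->
  prim2 f t = I1 (fun y => ind (al <= y <= t) * prim1 f y).
Proof.
move=> alA alt.
have mw : cmeasurable (fun p : mR * mR => ind ((p.2 : R) <= p.1)).
  by apply: cmeasurable_bool; apply: measurable_fun_ler.
have Ig : L1R (fun y : R => ind (al <= y <= t)).
  have := @bounded_itv_cintegrable R al t 1 (fun=> 1) (cmeasurable_cst _).
  move=> /(_ (fun x _ => cnorm1_bool true)); congr (cintegrable _ _ _); apply/funext => y.
  by rewrite mulr1.
have := @fubini_kernel R _ _ _ _ (@sleb R) (@sleb R) (fun y s : mR => ind ((s : R) <= y)) 1 mw
  (fun _ _ => cnorm1_bool _) _ _ Ig If.
set L := cint _ _ _; set M := cint _ _ _ => LM.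
transitivity M; last first.
  by rewrite -LM; congr (cint _ _ _); apply/funext => y; rewrite mulrC.
congr (cint _ _ _); apply/funext => s.
have [sA|/fA ->] := leP `|s| A; last by rewrite !mulr0.
congr (_ * _); move: sA; rewrite ler_norml => /andP[s1 s2].
have sal : al <= s by have := ler_norm A; lra.
transitivity (I1 (fun y => ind (s <= y <= t) * (0 * y + 1)%:C)); last first.
  congr (cint _ _ _); apply/funext => y; rewrite mul0r add0r rmorph1 mulr1 indM.
  by congr ind; have [sy|//] := leP s y; rewrite (le_trans sal sy).
have [st|ts] := leP s t.
- by rewrite I1_affine_itv// max_r ?subr_ge0//; congr (_ %:C); ring.
- rewrite max_l ?subr_le0 ?(ltW ts)// (_ : (fun y => _) = fun=> 0) ?cint0//.
  apply/funext => y; rewrite (_ : _ && _ = false) ?ind0 ?mul0r//.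
  by apply/negbTE; rewrite negb_and -!ltNge; have [|] := leP s y => //=; lra.
Qed.

Lemma is_cderive_prim2 x : is_cderive (prim2 f) x (prim1 f x).
Proof.
(* One starting point must serve all arguments within distance 1 of x, hence the extra room. *)
pose al := - `|A| - `|x| - 2.
have alx : al + 1 < x.
  by rewrite /al; have := normr_ge0 A; have := lerNnormlW (lexx `|x|); lra.
apply: (@is_cderive_eq_near _ (fun t => I1 (fun y => ind (al <= y <= t) * prim1 f y)) _ 1) => //.
- move=> y; rewrite ltr_distl => /andP[h1 h2]; apply: prim2_prim1; last lra.
  by rewrite /al; have := normr_ge0 x; lra.
- by apply: cint_itv_derive; [exact: ccontinuous_prim1|lra].
Qed.

End Prim2Derivative.

(** As g is merely integrable, no product rule is used: [prim1 g] is expanded and Fubini leaves the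
    integral of dphi over [s, +oo[, which is - phi s. The constant c drops out because dphi has
    total integral 0. *)
Lemma cint_by_parts (g phi dphi : R -> R[i]) (c : R[i]) (A : R) : L1R g ->
  (forall x, is_cderive phi x (dphi x)) -> ccontinuous dphi ->
  (forall x, A < `|x| -> phi x = 0) ->
  I1 (fun x => (c + prim1 g x) * dphi x) = - I1 (fun x => g x * phi x).
Proof.
move=> Ig dp cd pA.
(* phi is known to vanish only strictly beyond A; at B it does, so the boundary terms at both ends
   are 0. *)
pose B := `|A| + 1.
have phiB x : `|A| < `|x| -> phi x = 0.
  by move=> h; apply: pA; apply: le_lt_trans h; exact: ler_norm.
have dB x : `|A| < `|x| -> dphi x = 0.
  move=> h.
  have e0 : 0 < `|x| - `|A| by rewrite subr_gt0.
  have z : is_cderive phi x 0.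
    apply: (is_cderive_eq_near e0) (is_cderive_cst 0 x) => y xy; apply: phiB.
    by have := ler_normD (x - y) y; rewrite subrK distrC; lra.
  have [p1 p2] := dp x; have [z1 z2] := z; apply: complex_eqP.
  - by rewrite -(@derive_val _ _ _ _ _ _ _ p1) -(@derive_val _ _ _ _ _ _ _ z1).
  - by rewrite -(@derive_val _ _ _ _ _ _ _ p2) -(@derive_val _ _ _ _ _ _ _ z2).
have dE : dphi = (fun x => ind (- B <= x <= B) * dphi x).
  apply/funext => x; have [h|h] := leP `|x| B; first by rewrite -ler_norml h ind1 mul1r.
  by rewrite dB ?mulr0//; apply: lt_trans h; rewrite /B; lra.
have Id : L1R dphi.
  have [m hm] := ccontinuous_bounded (- B) B cd.
  rewrite dE; apply: bounded_itv_cintegrable hm; exact: ccontinuous_measurable.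
have mw : cmeasurable (fun p : mR * mR => ind ((p.2 : R) <= p.1)).
  by apply: cmeasurable_bool; apply: measurable_fun_ler.
have wc (x y : mR) : cnorm1 (ind ((y : R) <= x)) <= 1 by exact: cnorm1_bool.
have F := @fubini_kernel R _ _ _ _ (@sleb R) (@sleb R) (fun y s : mR => ind ((s : R) <= y)) 1 mw wc _ _ Id Ig.
have pB x : B <= `|x| -> phi x = 0.
  by move=> h; apply: phiB; apply: lt_le_trans h; rewrite /B; lra.
have Bx (x : R) : x <= Num.max x B /\ B <= Num.max x B by rewrite !le_max !lexx orbT.
have B0 : 0 <= B by rewrite addr_ge0.
have tail (s : R) : I1 (fun x => ind (s <= x) * dphi x) = - phi s.
  have [b1 b2] := Bx s.
  rewrite -[RHS]add0r -[X in X - _](pB (Num.max s B)); last first.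
    by apply: (le_trans b2); exact: ler_norm.
  rewrite -(cint_FTC2 b1 dp cd); congr (cint _ _ _); apply/funext => x.
  have [h|h] := leP x (Num.max s B); first by rewrite andbT.
  rewrite dB ?mulr0//; apply: lt_le_trans (ler_norm _); apply: le_lt_trans h.
  by apply: le_trans b2; rewrite /B; lra.
have total : I1 dphi = 0.
  have := tail (- B); rewrite pB ?oppr0; last by rewrite normrN; exact: ler_norm.
  move=> <-; congr (cint _ _ _); apply/funext => x.
  have [h|h] := leP (- B) x; first by rewrite ind1 mul1r.
  rewrite dB ?mulr0//; have := ler_norm (- x); rewrite normrN.
  by move: h; rewrite /B; lra.
have Ip : L1R (fun x => prim1 g x * dphi x).
  rewrite dE (_ : (fun x => _) = (fun x => ind (- B <= x <= B) * (prim1 g x * dphi x))); last first.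
    by apply/funext => x; rewrite mulrCA.
  have cp := ccontinuous_prim1 Ig.
  have [m hm] := ccontinuous_bounded (- B) B cd.
  have [m' hm'] := ccontinuous_bounded (- B) B cp.
  apply: (bounded_itv_cintegrable (c := m' * m)).
    by apply: cmeasurableM; exact: ccontinuous_measurable.
  move=> x hx; apply: (le_trans (cnorm1M _ _)); apply: ler_pM; rewrite ?cnorm1_ge0//; [exact: hm'|exact: hm].
transitivity (I1 (fun x => c * dphi x + prim1 g x * dphi x)).
  by congr (cint _ _ _); apply/funext => x; rewrite mulrDl.
rewrite cintD//; last exact: cintegrableZ.
rewrite cintZ// total mulr0 add0r F -cintN; last first.
  have [m hm] := ccontinuous_bounded (- B) B (is_cderive_ccontinuous dp).
  apply: (cintegrableMr (c := `|m|) Ig); first exact: ccontinuous_measurable (is_cderive_ccontinuous dp).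
  move=> x; have [h|h] := leP `|x| B.
    by apply: le_trans (ler_norm _); apply: hm; rewrite -ler_norml.
  by rewrite pB ?cnorm1_0// ltW.
by congr (cint _ _ _); apply/funext => s; rewrite tail; ring.
Qed.

End FirstPrimitive.

(** * Smooth functions and a bump *)

Section SmoothFunctions.
Context {R : realType}.
Local Notation mR := (measurableTypeR R).

(** A tower of derivatives. In dimension one every iterated directional derivative is a multiple of
    a member of the tower, which yields [smooth] without induction on lists of directions in each
    example. *)
Definition csmooth (f : R -> R[i]) := exists F : nat -> R -> R[i],
  F 0%N = f /\ forall n x, is_cderive (F n) x (F n.+1 x).

Lemma derive_scaled (f : R -> R) (x v l : R) : is_derive x (1 : R) f l ->
  is_derive x v f (v * l).
Proof.
move=> [/derivable1_diffP df <-]; split; first exact: diff_derivable.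
by rewrite !deriveE// -[X in 'd f x X]mulr1 -[v * 1]/(v *: (1 : R)) linearZ.
Qed.

Lemma smooth_chain (F : nat -> R -> R) :
  (forall n x, is_derive x (1 : R) (F n) (F n.+1 x)) -> smooth (F 0%N).
Proof.
move=> dF s /=.
have [c [n ->]] : exists c n, foldr (fun v h => 'D_v h) (F 0%N) s = (fun x => c * F n x).
  elim: s => [|v s [c [n IH]]] /=; first by exists 1, 0%N; apply/funext => x; rewrite mul1r.
  exists (v * c), n.+1; rewrite IH; apply/funext => x.
  have /(derive_scaled v) [_ ->] := is_deriveZ c (dF n x).
  by rewrite mulrA.
have dn x v : is_derive x v (fun y => c * F n y) (v * (c * F n.+1 x)).
  exact: (derive_scaled v (is_deriveZ c (dF n x))).
split; last by move=> v x; have [] := dn x v.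
by move=> x; exact: (@is_derive_continuous R _ x (c * F n.+1 x)).
Qed.

Lemma csmooth_smooth f : csmooth f -> smooth (re f) /\ smooth (im f).
Proof.
move=> [F [<- dF]]; split.
- by apply: (@smooth_chain (fun n => re (F n))) => n x; have [] := dF n x.
- by apply: (@smooth_chain (fun n => im (F n))) => n x; have [] := dF n x.
Qed.

Lemma csmooth_prim f g : csmooth g -> (forall x, is_cderive f x (g x)) -> csmooth f.
Proof.
move=> [F [F0 dF]] df; exists (fun n => if n is m.+1 then F m else f); split => // -[|n] x.
  by rewrite F0.
exact: dF.
Qed.

Lemma csmoothD f g : csmooth f -> csmooth g -> csmooth (fun x => f x + g x).
Proof.
move=> [F [<- dF]] [G [<- dG]]; exists (fun n x => F n x + G n x); split => // n x.
exact: is_cderiveD.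
Qed.

Lemma csmoothZ c f : csmooth f -> csmooth (fun x => c * f x).
Proof.
move=> [F [<- dF]]; exists (fun n x => c * F n x); split => // n x.
exact: is_cderiveZ.
Qed.

Lemma csmooth_ccontinuous f : csmooth f -> ccontinuous f.
Proof. by move=> [F [<- dF]]; exact: (is_cderive_ccontinuous (dF 0%N)). Qed.

Lemma cD_cderive (f : R -> R[i]) x l : is_cderive f x l -> cD (1 : R) f x = l.
Proof.
move=> [d1 d2]; apply: complex_eqP; rewrite /cD /=.
- by rewrite (@derive_val _ _ _ _ _ _ _ d1).
- by rewrite (@derive_val _ _ _ _ _ _ _ d2).
Qed.

Lemma test_function_csmooth (a r : R) f : r < a -> csmooth f ->
  (forall x, r < `|x| -> f x = 0) -> test_function `]-a, a[ f.
Proof.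
move=> ra /csmooth_smooth[s1 s2] f0.
have sub : csupp f `<=` `[-r, r].
  rewrite /csupp; apply: (@subset_trans _ (closure `[-r, r])).
    apply: closure_subset => x /= fx; rewrite in_itv/= -ler_norml leNgt.
    by apply/negP => /f0 fx0; rewrite fx0 eqxx in fx.
  by have /closure_id <- := @interval_closed R (BLeft (- r)) (BRight r) erefl erefl.
split => //.
- exact: (subclosed_compact (@closed_closure _ _) (@segment_compact _ _ _) sub).
- by move=> x /sub /=; rewrite !in_itv/= => /andP[? ?]; apply/andP; split; lra.
Qed.

(** Meant for the points outside the open support of the bump, where a quadratic bound on the nearby
    values replaces any formula for the derivative. *)
Lemma quadratic_is_derive0 (f : R -> R) (x C : R) : f x = 0 ->
  (forall y, `|f y| <= C * `|y - x| ^+ 2) -> is_derive x (1 : R) f 0.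
Proof.
move=> fx fC.
have E : (fun h : R => h^-1 *: ((f \o shift x) (h *: (1 : R)) - f x)) @ 0^' --> 0.
  apply/cvgr0Pnorm_lt => e e0; near=> h.
  rewrite fx subr0 /= /GRing.scale /= mulr1 normrM normfV.
  have h0 : 0 < `|h| by rewrite normr_gt0; near: h; exact: nbhs_dnbhs_neq.
  rewrite ltr_pdivrMl//; apply: (le_lt_trans (fC _)).
  rewrite addrK expr2 mulrCA ltr_pM2l//.
  have he : `|h| < e / (`|C| + 1).
    by near: h; apply: dnbhs0_lt; rewrite divr_gt0// ltr_wpDl.
  have C0 : 0 < `|C| + 1 by rewrite ltr_wpDl.
  rewrite ltr_pdivlMr// in he; apply: le_lt_trans he; rewrite mulrC.
  by apply: ler_wpM2l => //; have := ler_norm C; lra.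
split; first by apply/cvg_ex; exists 0.
exact: cvg_lim E.
Unshelve. all: by end_near. Qed.

(** With t = 1 / D and t' = - t^2 D', the derivative of p t^m exp(- t) is again of this form, with
    exponent m + 2; the polynomial factor on the right is the one of [bump_step]. *)
Lemma bump_algebra (pv p1 Dv D1 t e : R) (m : nat) : Dv * t = 1 ->
  pv * t ^+ m * (e * - (- t ^+ 2 * D1)) +
    e * (pv * (m%:R * t ^+ m.-1 * (- t ^+ 2 * D1)) + t ^+ m * p1) =
  (p1 * Dv ^+ 2 - (pv * D1 * Dv) *+ m + pv * D1) * t ^+ m.+2 * e.
Proof.
move=> Dt; rewrite -mulr_natl.
transitivity ((p1 * (Dv * t) ^+ 2 * t ^+ m + pv * D1 * t ^+ m.+2) * e
  - m%:R * pv * D1 * (Dv * t) * t ^+ m.+1 * e); last first.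
  by rewrite -[m.+2]addn2 -[m.+1]addn1 !exprD; ring.
rewrite Dt; case: m => [|m]; first by rewrite expr0; ring.
by rewrite /= -[m.+3]addn3 -[m.+2]addn2 -[m.+1]addn1 !exprD; ring.
Qed.

Section Bump.
Context (c d : R).
Hypothesis d0 : 0 < d.

Let D : {poly R} := (d ^+ 2)%:P - ('X - c%:P) ^+ 2.

(** The functions p D^(- m) exp(- 1 / D), with D = d^2 - (x - c)^2, extended by 0. This family is
    closed under differentiation and contains the classical bump, for p = 1 and m = 0, hence all its
    derivatives. *)
Definition bump_term (p : {poly R}) (m : nat) (x : R) : R :=
  if `|x - c| < d then p.[x] * (D.[x])^-1 ^+ m * expR (- (D.[x])^-1) else 0.

Let bump_step (p : {poly R}) (m : nat) : {poly R} :=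
  p^`() * D ^+ 2 - (p * D^`() * D) *+ m + p * D^`().

Lemma bumpD x : D.[x] = (d - `|x - c|) * (d + `|x - c|).
Proof.
rewrite /D !hornerE -subr_sqr; congr (_ - _).
by rewrite -[RHS]normrX ger0_norm ?sqr_ge0.
Qed.

(** As exp t >= t^(m + 2) / (m + 2)!, the factor t^m exp(- t) is at most a constant times D^2. For x
    outside the interval, D at y is at most 2 d |y - x|, because it factors as (d - |y - c|) (d + |y
    - c|). One constant serves all such x. *)
Lemma bump_term_bound p m : exists C, forall x y, d <= `|x - c| ->
  `|bump_term p m y| <= C * `|y - x| ^+ 2.
Proof.
have cp : continuous (horner p).
  by move=> x; exact: (@is_derive_continuous R _ x p^`().[x]).
have cd : c - d <= c + d by rewrite lerD2l ge0_cp// ltW.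
have [P _ HP] := @EVT_max R (fun x => `|p.[x]|) (c - d) (c + d) cd
  (continuous_subspaceT (fun x => continuous_comp (cp x) (@norm_continuous _ _ _))).
exists (`|p.[P]| * (m.+2)`!%:R * (2 * d) ^+ 2) => x y xd.
rewrite /bump_term; case: ifPn => [yd|_]; last by rewrite normr0 !mulr_ge0 ?(ltW d0).
have h1 : d - `|y - c| <= `|y - x|.
  by have := ler_distD y x c; rewrite (distrC x y); lra.
have Dp : 0 < D.[y] by rewrite bumpD mulr_gt0 ?subr_gt0// ltr_wpDr.
set t := (D.[y])^-1; have tp : 0 < t by rewrite invr_gt0.
have Dle : D.[y] <= `|y - x| * (2 * d).
  by rewrite bumpD; apply: ler_pM; rewrite ?subr_ge0 ?addr_ge0 ?(ltW yd) ?(ltW d0)//; lra.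
have H0 : `|p.[y]| <= `|p.[P]| by apply: HP; rewrite in_itv/= -ler_distl ltW.
have fac : 0 < (m.+2)`!%:R :> R by rewrite ltr0n fact_gt0.
have ee : t ^+ m.+2 <= (m.+2)`!%:R * expR t.
  have := expR_ge1Dxn m.+1 (ltW tp).
  have -> : (1 + t ^+ m.+2 / (m.+2)`!%:R <= expR t) =
    ((m.+2)`!%:R + t ^+ m.+2 <= (m.+2)`!%:R * expR t).
    by rewrite -(ler_pM2l fac) mulrDr mulr1 mulrCA mulfV ?mulr1// gt_eqF.
  by apply: le_trans; rewrite lerDr ltW.
have H1 : t ^+ m * expR (- t) <= (m.+2)`!%:R * (`|y - x| * (2 * d)) ^+ 2.
  have -> : t ^+ m * expR (- t) = t ^+ m.+2 * expR (- t) * D.[y] ^+ 2.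
    have Dt : D.[y] * t = 1 by rewrite mulfV// gt_eqF.
    rewrite -[in RHS]addn2 exprD; transitivity (t ^+ m * expR (- t) * (D.[y] * t) ^+ 2); last by ring.
    by rewrite Dt expr1n mulr1.
  apply: ler_pM; [|exact: sqr_ge0| |].
  - by rewrite mulr_ge0 ?exprn_ge0 ?ltW ?expR_gt0.
  - by rewrite expRN ler_pdivrMr ?expR_gt0.
  - by apply: lerXn2r => //; rewrite nnegrE ?(ltW Dp)// !mulr_ge0 ?(ltW d0).
rewrite !normrM (gtr0_norm (expR_gt0 _)) (ger0_norm (exprn_ge0 _ (ltW tp))) -mulrA.
apply: le_trans (ler_pM _ _ H0 H1) _ => //.
  by rewrite mulr_ge0 ?exprn_ge0 ?ltW ?expR_gt0.
by rewrite le_eqVlt; apply/orP; left; apply/eqP; ring.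
Qed.

Lemma is_derive_bump_term p m x :
  is_derive x (1 : R) (bump_term p m) (bump_term (bump_step p m) m.+2 x).
Proof.
have [xd|dx] := ltP `|x - c| d; last first.
  have [C HC] := bump_term_bound p m.
  rewrite [X in is_derive _ _ _ X](_ : _ = 0); last by rewrite /bump_term ltNge dx.
  apply: (quadratic_is_derive0 (C := C)); first by rewrite /bump_term ltNge dx.
  by move=> y; exact: HC.
have Dp : 0 < D.[x] by rewrite bumpD mulr_gt0 ?subr_gt0// ltr_wpDr.
apply: (ball_eq_is_derive (e := d - `|x - c|)
  (g := fun x => p.[x] * (D.[x])^-1 ^+ m * expR (- (D.[x])^-1))).
- by rewrite subr_gt0.
- move=> y yx; rewrite /bump_term ifT//.
  by have := ler_distD x y c; lra.
have dD : is_derive x (1 : R) (horner D) D^`().[x] by exact: is_derive_poly.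
have dinv : is_derive x (1 : R) (fun y => (D.[y])^-1) (- (D.[x])^-1 ^+ 2 * D^`().[x]).
  have Dn0 : horner D x != 0 by rewrite gt_eqF.
  split; first by apply: derivableV => //; have [] := dD.
  have [dD1 dD2] := dD.
  by rewrite (deriveV Dn0 dD1) dD2 exprVn.
have dexp : is_derive x (1 : R) (fun y => expR (- (D.[y])^-1))
    (expR (- (D.[x])^-1) * (- (- (D.[x])^-1 ^+ 2 * D^`().[x]))).
  exact: (is_derive1_comp (is_derive_expR _) (is_deriveN dinv)).
have := is_deriveM (is_deriveM (is_derive_poly p x) (is_deriveX m dinv)) dexp.
congr (is_derive _ _ _ _); first by apply/funext => y; rewrite !fctE.
rewrite /bump_term ifT//.
have -> : (bump_step p m).[x] = p^`().[x] * D.[x] ^+ 2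
    - (p.[x] * D^`().[x] * D.[x]) *+ m + p.[x] * D^`().[x].
  by rewrite /bump_step; move: (D) => D0; rewrite !(hornerD, hornerN, hornerMn, hornerM, horner_exp).
have Dt : D.[x] * (D.[x])^-1 = 1 by rewrite mulfV// gt_eqF.
rewrite !fctE; exact: (bump_algebra _ _ _ _ _ Dt).
Qed.

Lemma bump_term_csmooth p m : csmooth (fun x => (bump_term p m x)%:C).
Proof.
pose F n := iter n (fun q : {poly R} * nat => (bump_step q.1 q.2, q.2.+2)) (p, m).
exists (fun n x => (bump_term (F n).1 (F n).2 x)%:C); split => // n x.
by split; [exact: is_derive_bump_term|exact: is_derive_cst].
Qed.

Definition smooth_bump := bump_term 1 0.

Lemma bump_supp x : d <= `|x - c| -> smooth_bump x = 0.
Proof. by move=> xd; rewrite /smooth_bump /bump_term ltNge xd. Qed.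

Lemma bump_ge0 x : 0 <= smooth_bump x.
Proof.
rewrite /smooth_bump /bump_term; case: ifP => // _.
by rewrite hornerC expr0 !mul1r expR_ge0.
Qed.

Lemma continuous_bump : continuous smooth_bump.
Proof. by move=> x; exact: (@is_derive_continuous R _ x _ (is_derive_bump_term 1 0 x)). Qed.

Lemma integrable_bump : (@leb R).-integrable setT (EFin \o smooth_bump).
Proof.
have cb := csmooth_ccontinuous (bump_term_csmooth 1 0).
have [C hC] := ccontinuous_bounded (c - d) (c + d) cb.
have [+ _] := bounded_itv_cintegrable (ccontinuous_measurable cb) hC.
apply: eq_integrable => // x _ /=; congr EFin.
rewrite /re -ler_distl; have [h|h] := leP `|x - c| d; first by rewrite ind1 mul1r.
by rewrite ind0 mul0r bump_supp ?ltW.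
Qed.

Lemma bump_mass_gt0 : 0 < \int[leb]_x smooth_bump x.
Proof.
pose al := c - d / 2; pose be := c + d / 2.
have d2 : 0 < d / 2 by rewrite divr_gt0.
have ab : al <= be by rewrite lerD2l ge0_cp// ltW.
(* On |x - c| <= d / 2 one has D >= d^2 - (d / 2)^2 = 3 / 4 d^2, so the bump is at least [k]
   there. *)
pose k := expR (- (3 / 4 * d ^+ 2)^-1).
have h (x : R) : al <= x <= be -> k <= smooth_bump x.
  rewrite -ler_distl => xd; have xd' : `|x - c| < d.
    by apply: (le_lt_trans xd); rewrite ltr_pdivrMr// ltr_pMr// ltr1n.
  rewrite /smooth_bump /bump_term xd' hornerC expr0 !mul1r /k ler_expR lerN2.
  have c1 : 0 < 3 / 4 * d ^+ 2 by rewrite mulr_gt0// exprn_gt0.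
  have c2 : 3 / 4 * d ^+ 2 <= D.[x].
    have x2 : `|x - c| ^+ 2 <= (d / 2) ^+ 2 by rewrite lerXn2r// nnegrE ltW.
    rewrite bumpD -subr_sqr; apply: (@le_trans _ _ (d ^+ 2 - (d / 2) ^+ 2)); last by rewrite lerD2l lerN2.
    by rewrite le_eqVlt; apply/orP; left; apply/eqP; field.
  by rewrite lef_pV2// posrE// (lt_le_trans c1).
have I := I1_affine_itv 0 k ab.
have E : \int[leb]_(x in `[al, be]) (0 * x + k) = k * (be - al).
  have := I; rewrite I1_itv_real => -[->]; ring.
have ki : k * (be - al) = k * d by rewrite /be /al; congr (_ * _); field.
have kd : 0 < k * d by rewrite mulr_gt0// expR_gt0.
apply: (lt_le_trans kd); rewrite -ki -E Rintegral_mkcond.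
have cb := csmooth_ccontinuous (bump_term_csmooth 1 0).
apply: le_Rintegral => //.
- rewrite -restrict_EFin -integrable_mkcond//.
  apply: continuous_compact_integrable; first exact: segment_compact.
  apply: continuous_subspaceT => x; apply: continuousD; last exact: cvg_cst.
  by apply: continuousM => //; exact: cvg_cst.
- exact: integrable_bump.
- move=> x _; rewrite patchE mem_setE in_itv/=; case: ifPn => [/h|_]; last exact: bump_ge0.
  by rewrite mul0r add0r.
Qed.

End Bump.
End SmoothFunctions.

(** * Sobolev functions as double primitives *)

Section SobolevRepresentation.
Context {R : realType} (a : R).
Hypothesis a0 : 0 < a.
Local Notation mR := (measurableTypeR R).
Local Notation I1 f := (cint (@leb R) setT f).
Local Notation L1R f := (cintegrable (@leb R) setT f).
Local Notation ind := (@ind R).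

(** The open interval, as in the definition of [L1]; [cutoff] below uses the closed one, on which
    the kernel estimates and the representations hold. They differ at the two end points only. *)
Definition clip (f : R -> R[i]) (x : R) : R[i] := ind (- a < x < a) * f x.

Lemma cint_clip f : cint leb `]-a, a[ f = I1 (clip f).
Proof.
rewrite cint_mkcond; apply: eq_I1 => x.
by rewrite mem_setE in_itv.
Qed.

Lemma L1_clip f : L1 a f <-> L1R (clip f).
Proof.
rewrite /L1 /= cintegrable_mkcond//.
suff -> : (fun x => ind (x \in `]-a, a[%classic) * f x) = clip f by [].
by apply/funext => x; rewrite mem_setE in_itv.
Qed.

Lemma clip_supp f s : a < `|s| -> clip f s = 0.
Proof.
move=> h; rewrite /clip (_ : _ && _ = false) ?ind0 ?mul0r//.
by apply/negbTE; rewrite -ltr_norml -leNgt ltW.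
Qed.

Lemma clip_in f s : - a < s < a -> clip f s = f s.
Proof. by rewrite /clip => ->; rewrite ind1 mul1r. Qed.

Section TestPairing.
Context (theta : R -> R[i]) (r : R).
Hypotheses (ra : r < a) (sth : csmooth theta) (th0 : forall x, r < `|x| -> theta x = 0).
Hypotheses (mass0 : I1 theta = 0) (moment0 : I1 (fun s => s%:C * theta s) = 0).

Let cth := csmooth_ccontinuous sth.

Let Ith : L1R theta.
Proof.
have [m hm] := ccontinuous_bounded (- r) r cth.
have := bounded_itv_cintegrable (ccontinuous_measurable cth) hm.
congr (cintegrable _ _ _); apply/funext => x; rewrite -ler_norml.
have [h|h] := leP `|x| r; first by rewrite ind1 mul1r.
by rewrite th0// mulr0.
Qed.

Let phi := prim2 theta.
Let dphi := prim1 theta.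

Let dphiP x : is_cderive phi x (dphi x).
Proof. exact: (is_cderive_prim2 Ith th0). Qed.

Lemma is_cderive_prim1 x : is_cderive dphi x (theta x).
Proof.
pose al := - `|r| - `|x| - 2.
have alx : al + 1 < x.
  by rewrite /al; have := normr_ge0 r; have := lerNnormlW (lexx `|x|); lra.
apply: (@is_cderive_eq_near _ _ (fun t => I1 (fun y => ind (al <= y <= t) * theta y)) _ 1) => //.
- move=> y _; apply: eq_I1 => s.
  have [h|h] := leP `|s| r; last by rewrite th0// !mulr0.
  rewrite (_ : al <= s = true)//; apply/idP; move: h; rewrite ler_norml => /andP[h _].
  by rewrite /al; have := normr_ge0 x; have := ler_norm r; lra.
- by apply: cint_itv_derive => //; lra.
Qed.

Let dphi0 x : r < `|x| -> dphi x = 0.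
Proof.
rewrite /dphi /prim1 lter_normr => /orP[].
  move=> rx; rewrite -[RHS]mass0; apply: eq_I1 => s.
  have [sx|xs] := leP s x; first by rewrite ind1 mul1r.
  by rewrite th0 ?mulr0//; apply: lt_le_trans (ler_norm _); lra.
move=> xr; rewrite -[RHS](cint0 (@leb R)); apply: eq_I1 => s.
have [sx|xs] := leP s x; last by rewrite ind0 mul0r.
by rewrite th0 ?mulr0//; rewrite -normrN; apply: lt_le_trans (ler_norm _); lra.
Qed.

(** To the right of the support, [prim2 theta] at x is x times the mass minus the first moment of
    theta, which is why both are required to vanish. *)
Let phi0 x : r < `|x| -> phi x = 0.
Proof.
rewrite /phi /prim2 lter_normr => /orP[].
  move=> rx; transitivity (I1 (fun s => x%:C * theta s - s%:C * theta s)).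
    apply: eq_I1 => s; rewrite -mulrBl -rmorphB/=.
    have [sx|xs] := leP s x; first by rewrite max_r// subr_ge0.
    by rewrite th0 ?mulr0//; apply: lt_le_trans (ler_norm _); lra.
  have Im : L1R (fun s => s%:C * theta s).
    have ms : cmeasurable (fun s : mR => (s : R)%:C) by exact: cmeasurable_real.
    apply: (L1R_suppM Ith th0 (c := r) ms) => s; by rewrite cnorm1_real.
  by rewrite cintB ?cintZ ?mass0 ?moment0 ?mulr0 ?subr0//; exact: cintegrableZ.
move=> xr; rewrite -[RHS](cint0 (@leb R)); apply: eq_I1 => s.
have [sx|xs] := leP s x; last by rewrite max_l ?mul0r// subr_le0 ltW.
by rewrite th0 ?mulr0//; rewrite -normrN; apply: lt_le_trans (ler_norm _); lra.
Qed.

(** Both primitives of theta have compact support in the open interval, so they are admissible: u is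
    tested with the first, its weak derivative with the second. *)
Lemma weak_deriv2_pairing u h : weak_deriv2 a u h ->
  I1 (fun x => clip u x * theta x) = I1 (fun x => clip h x * phi x).
Proof.
move=> [g [_ _ ug gh]].
have sdphi : csmooth dphi := csmooth_prim sth is_cderive_prim1.
have sphi : csmooth phi := csmooth_prim sdphi dphiP.
have := ug _ (test_function_csmooth ra sdphi dphi0).
have := gh _ (test_function_csmooth ra sphi phi0).
have -> : cD (1 : R) phi = dphi by apply/funext => x; exact: cD_cderive.
have -> : cD (1 : R) dphi = theta by apply/funext => x; apply: cD_cderive; exact: is_cderive_prim1.
rewrite !cint_clip.
have e (f k : R -> R[i]) : clip (fun x => f x * k x) = (fun x => clip f x * k x).
  by apply/funext => x; rewrite /clip mulrA.
by rewrite !e => h1 ->; rewrite h1 opprK.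
Qed.

(** The same pairing for the explicit double primitive, by two integrations by parts on the line. *)
Lemma prim2_pairing h : L1R (clip h) ->
  I1 (fun x => clip (prim2 (clip h)) x * theta x) = I1 (fun x => clip h x * phi x).
Proof.
move=> Ih; have ra' := ra.
have c1 := ccontinuous_prim1 Ih.
(* The first primitive of h is in general a nonzero constant to the right of the interval; truncated
   it is integrable, as [cint_by_parts] requires. *)
pose G x := ind (- a <= x <= a) * prim1 (clip h) x.
have IG : L1R G.
  have [m hm] := ccontinuous_bounded (- a) a c1.
  exact: (bounded_itv_cintegrable (ccontinuous_measurable c1) hm).
have sdphi : csmooth dphi := csmooth_prim sth is_cderive_prim1.
have ph1 := cint_by_parts 0 Ih dphiP (csmooth_ccontinuous sdphi) phi0.
have ph2 := cint_by_parts 0 IG is_cderive_prim1 cth dphi0.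
transitivity (I1 (fun x => (0 + prim1 G x) * theta x)).
  apply: eq_I1 => x; have [h1|h1] := leP `|x| r; last by rewrite th0// !mulr0.
  congr (_ * _); rewrite add0r.
  move: (h1); rewrite ler_norml => /andP[h2 h3].
  rewrite clip_in; last by apply/andP; split; lra.
  rewrite (@prim2_prim1 _ _ a Ih (clip_supp h) (- a)); last by lra.
    apply: eq_I1 => y; rewrite /G mulrA indM; congr (ind _ * _).
    apply/idP/idP => [/andP[y1 y2]|/and3P[y1 y2 y3]]; last by rewrite y2 y1.
    by rewrite y2 y1/=; lra.
  by rewrite gtr0_norm.
rewrite ph2; apply: (etrans _ (etrans (congr1 -%R ph1) (opprK _))); congr (- _).
apply: eq_I1 => x.
rewrite add0r /G; have [h1|h1] := leP `|x| r; last by rewrite dphi0// !mulr0.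
rewrite -ler_norml (_ : `|x| <= a = true) ?ind1 ?mul1r//.
by apply/idP; lra.
Qed.

End TestPairing.

Lemma ccontinuous_at_approx (w : R -> R[i]) (c e : R) :
  {for c, continuous (re w)} -> {for c, continuous (im w)} -> 0 < e ->
  exists2 d, 0 < d & forall x, `|x - c| < d -> cnorm1 (w x - w c) <= e.
Proof.
move=> c1 c2 e0; have e2 : 0 < e / 2 by rewrite divr_gt0.
have /cvgrPdist_lt/(_ _ e2) n1 := c1; have /cvgrPdist_lt/(_ _ e2) n2 := c2.
have [d /= d0 hd] := (nbhs_ballP _ _).1 (filterI n1 n2).
exists d => // x xd; have [] := hd x; first by rewrite /ball /= distrC.
rewrite /cnorm1 cReD cImD cReN cImN /re /im (distrC (complex.Re (w c))) (distrC (complex.Im (w c))).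
by move=> h1 h2; apply: (le_trans (lerD (ltW h1) (ltW h2))); rewrite -splitr.
Qed.

Lemma within_eq_closure (f g : R -> R) :
  {within `[-a, a], continuous f} -> {within `[-a, a], continuous g} ->
  (forall x, - a < x < a -> f x = g x) -> forall x, - a <= x <= a -> f x = g x.
Proof.
have aa : - a < a by rewrite gt0_cp.
move=> /(continuous_within_itvP _ aa)[_ f1 f2] /(continuous_within_itvP _ aa)[_ g1 g2] fg.
have l1 : f (- a) = g (- a).
  apply: (cvg_unique _ f1) => //; apply: cvg_trans g1; apply: near_eq_cvg; near=> x.
  by apply/esym/fg/andP; split; near: x; [exact: nbhs_right_gt|exact: nbhs_right_lt].
have l2 : f a = g a.
  apply: (cvg_unique _ f2) => //; apply: cvg_trans g2; apply: near_eq_cvg; near=> x.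
  by apply/esym/fg/andP; split; near: x; [exact: nbhs_left_gt|exact: nbhs_left_lt].
move=> x /andP[]; rewrite le_eqVlt => /predU1P[<-//|x1].
by rewrite le_eqVlt => /predU1P[->//|x2]; apply: fg; rewrite x1.
Unshelve. all: by end_near. Qed.

Lemma cint_bump_approx (w : R -> R[i]) (c d e : R) : 0 < d ->
  cmeasurable (clip w : mR -> _) -> 0 <= e ->
  (forall x, `|x - c| < d -> - a < x < a /\ cnorm1 (w x - w c) <= e) ->
  L1R (fun x => clip w x * (smooth_bump c d x)%:C) /\
  cnorm1 (I1 (fun x => clip w x * (smooth_bump c d x)%:C) - w c * (\int[leb]_x smooth_bump c d x)%:C)
    <= e * \int[leb]_x smooth_bump c d x.
Proof.
move=> d0 mw e0 hw.
have ib := integrable_bump c d0.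
have Ib : L1R (fun x => (smooth_bump c d x)%:C).
  by split => //; exact: integrable0.
have mb := cintegrable_measurable Ib.
have pw x : cnorm1 (clip w x * (smooth_bump c d x)%:C - w c * (smooth_bump c d x)%:C) <= e * smooth_bump c d x.
  rewrite -mulrBl; have [xd|dx] := ltP `|x - c| d; last first.
    by rewrite bump_supp// mulr0 cnorm1_0 mulr0.
  have [xa xe] := hw _ xd; rewrite clip_in//.
  apply: (le_trans (cnorm1M _ _)); rewrite cnorm1_real (ger0_norm (bump_ge0 _ _ _)).
  by apply: ler_wpM2r => //; exact: bump_ge0.
have ie : (@leb R).-integrable setT (EFin \o (fun x => e * smooth_bump c d x)).
  by have := integrableZl measurableT e ib; apply: eq_integrable.
have Id : L1R (fun x => clip w x * (smooth_bump c d x)%:C - w c * (smooth_bump c d x)%:C).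
  apply: (cintegrable_le _ ie pw); apply: cmeasurableB; apply: cmeasurableM => //.
  exact: cmeasurable_cst.
have Iw : L1R (fun x => clip w x * (smooth_bump c d x)%:C).
  have := cintegrableD Id (cintegrableZ (w c) Ib).
  by congr (cintegrable _ _ _); apply/funext => x; rewrite subrK.
split => //.
rewrite -cint_real -cintZ// -cintB//; last exact: cintegrableZ.
rewrite -RintegralZl//; exact: cnorm1_cint_le.
Qed.

Lemma bump_supp_norm (c d x : R) : `|c| + d < `|x| -> smooth_bump c d x = 0.
Proof. by move=> cx; apply: bump_supp; have := ler_normD (x - c) c; rewrite subrK; lra. Qed.

Lemma bump_translate (c d : R) : \int[leb]_x smooth_bump c d x = \int[leb]_x smooth_bump 0 d x.
Proof.
have mb : measurable_fun setT (smooth_bump c d : mR -> mR).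
  have [d0|d0] := ltP 0 d; first by apply: continuous_measurable_fun; exact: continuous_bump.
  rewrite (_ : smooth_bump c d = cst 0); first exact: measurable_cst.
  by apply/funext => x; rewrite /smooth_bump /bump_term ltNge (le_trans d0).
rewrite (@Rintegral_affine R 1 c (smooth_bump c d) (oner_neq0 R) mb) normr1 mul1r.
apply: eq_Rintegral => x _; rewrite mul1r /smooth_bump /bump_term addrK subr0.
by case: ifP => // _; rewrite !hornerE addrK subr0.
Qed.

(** Translation by c adds c times the mass. For bumps of equal width, mass and moment of a
    combination therefore vanish as soon as its coefficients annihilate the affine functions of the
    centres. *)
Lemma cint_bump_moment (c d : R) : 0 < d ->
  I1 (fun x => x%:C * (smooth_bump c d x)%:C) =
  c%:C * (\int[leb]_x smooth_bump 0 d x)%:C + I1 (fun x => x%:C * (smooth_bump 0 d x)%:C).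
Proof.
move=> d0.
have Ib : L1R (fun x => (smooth_bump 0 d x)%:C).
  by split; [exact: (integrable_bump 0 d0)|exact: integrable0].
have Ixb : L1R (fun x => x%:C * (smooth_bump 0 d x)%:C).
  apply: (@L1R_suppM R (fun x => (smooth_bump 0 d x)%:C) d Ib _ (fun x => x%:C) d).
  - by move=> s ds; rewrite bump_supp// subr0 ltW.
  - exact: cmeasurable_real.
  - by move=> s; rewrite cnorm1_real.
have mx : cmeasurable (fun x : mR => (x : R)%:C * (smooth_bump c d x)%:C).
  apply: cmeasurableM; first exact: cmeasurable_real.
  by apply: cmeasurable_real; apply: continuous_measurable_fun; exact: continuous_bump.
rewrite (cint_affine c (oner_neq0 R) mx) normr1 mul1r.
rewrite -cint_real -cintZ// -cintD//; last exact: cintegrableZ.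
apply: eq_I1 => x; rewrite mul1r.
have -> : smooth_bump c d (x + c) = smooth_bump 0 d x.
  rewrite /smooth_bump /bump_term addrK subr0; case: ifP => // _.
  by rewrite !hornerE addrK subr0.
by rewrite rmorphD/=; ring.
Qed.

Lemma cint_lin3 (k1 k2 k3 : R[i]) (f1 f2 f3 : R -> R[i]) : L1R f1 -> L1R f2 -> L1R f3 ->
  I1 (fun x => k1 * f1 x + k2 * f2 x + k3 * f3 x) = k1 * I1 f1 + k2 * I1 f2 + k3 * I1 f3.
Proof.
move=> i1 i2 i3; rewrite cintD; [|by apply: cintegrableD; exact: cintegrableZ|exact: cintegrableZ].
by rewrite cintD ?cintZ//; exact: cintegrableZ.
Qed.

(* Du Bois-Reymond: [u] and the double primitive of its weak second derivative have the same pairing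
   with every test function of vanishing mass and moment, in particular with combinations of three
   translated bumps; shrinking the bumps shows that the difference is affine. *)
Lemma weak_deriv2_representation (u h : R -> R[i]) :
  ccontinuous_on `[-a, a] u -> L1 a u -> weak_deriv2 a u h ->
  exists c0 c1, forall x, - a <= x <= a -> u x = c0 + c1 * x%:C + prim2 (clip h) x.
Proof.
move=> [cu1 cu2] Lu uh; have aa : - a < a by rewrite gt0_cp.
have Lh : L1R (clip h) by case: uh => g [_ /L1_clip].
have [cp1 cp2] : ccontinuous (prim2 (clip h)).
  exact: (is_cderive_ccontinuous (is_cderive_prim2 Lh (@clip_supp h))).
pose w x := u x - prim2 (clip h) x.
have cw1 c : - a < c < a -> {for c, continuous (re w)}.
  move=> ca; rewrite (_ : re w = (fun x => re u x - re (prim2 (clip h)) x)); last first.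
    by apply/funext => x; rewrite /re /w cReD cReN.
  by apply: continuousB; [exact: (within_continuous_continuous aa cu1)|exact: cp1].
have cw2 c : - a < c < a -> {for c, continuous (im w)}.
  move=> ca; rewrite (_ : im w = (fun x => im u x - im (prim2 (clip h)) x)); last first.
    by apply/funext => x; rewrite /im /w cImD cImN.
  by apply: continuousB; [exact: (within_continuous_continuous aa cu2)|exact: cp2].
have mcw : cmeasurable (clip w : mR -> _).
  rewrite (_ : clip w = (fun x => clip u x - clip (prim2 (clip h)) x)); last first.
    by apply/funext => x; rewrite /clip /w mulrBr.
  apply: cmeasurableB; first exact: (cintegrable_measurable ((L1_clip u).1 Lu)).
  apply: cmeasurableM; last exact: ccontinuous_measurable.
  apply: cmeasurable_bool; apply: measurable_and; apply: measurable_fun_ltr => //;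
    exact: measurable_cst.
(* The coefficients annihilate 1 and c, so the corresponding combination of bumps has vanishing mass
   and moment. The identity itself says that w is affine through any three points. *)
have three (c1 c2 c3 : R) : - a < c1 < a -> - a < c2 < a -> - a < c3 < a ->
    (c3 - c2)%:C * w c1 + (c1 - c3)%:C * w c2 + (c2 - c1)%:C * w c3 = 0.
  move=> h1 h2 h3; apply: cnorm1_eq0.
  pose La := `|c3 - c2| + `|c1 - c3| + `|c2 - c1|.
  suff small (e : R) : 0 < e ->
      cnorm1 ((c3 - c2)%:C * w c1 + (c1 - c3)%:C * w c2 + (c2 - c1)%:C * w c3) <= La * e.
    apply/ler_addgt0Pr => e e0; rewrite add0r.
    have La0 : 0 <= La by rewrite !addr_ge0.
    apply: le_trans (small (e / (La + 1)) _) _; first by rewrite divr_gt0// ltr_wpDl.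
    rewrite mulrCA ger_pMr// ler_pdivrMr ?mul1r; lra.
  move=> e0.
  have near_c c : - a < c < a -> exists d, [/\ 0 < d, `|c| + d < a & forall x, `|x - c| < d ->
      - a < x < a /\ cnorm1 (w x - w c) <= e].
    move=> ca; have [d d0 hd] := ccontinuous_at_approx (cw1 c ca) (cw2 c ca) e0.
    have a1 : 0 < a - `|c| by rewrite subr_gt0 ltr_norml.
    have [m1 m2] : Num.min d ((a - `|c|) / 2) <= d /\ Num.min d ((a - `|c|) / 2) <= (a - `|c|) / 2.
      by rewrite !ge_min !lexx orbT.
    exists (Num.min d ((a - `|c|) / 2)); split.
    - by rewrite lt_min d0 divr_gt0.
    - by lra.
    - move=> x xc; split; last by apply: hd; lra.
      by rewrite -ltr_norml; have := ler_normD (x - c) c; rewrite subrK; lra.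
  have [d1 [d10 da1 hd1]] := near_c _ h1; have [d2 [d20 da2 hd2]] := near_c _ h2.
  have [d3 [d30 da3 hd3]] := near_c _ h3.
  (* One width for all three bumps, so that they are translates of each other and have equal
     mass. *)
  pose d := Num.min d1 (Num.min d2 d3).
  have d0 : 0 < d by rewrite !lt_min d10 d20 d30.
  have [dd1 dd2 dd3] : [/\ d <= d1, d <= d2 & d <= d3] by rewrite !ge_min !lexx !orbT.
  pose M := \int[leb]_x smooth_bump 0 d x.
  have M0 : 0 < M by exact: bump_mass_gt0.
  have approx c dc : d <= dc -> (forall x, `|x - c| < dc ->
      - a < x < a /\ cnorm1 (w x - w c) <= e) ->
      L1R (fun x => clip w x * (smooth_bump c d x)%:C) /\
      cnorm1 (I1 (fun x => clip w x * (smooth_bump c d x)%:C) - w c * M%:C) <= e * M.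
    move=> ddc hc; rewrite /M -(bump_translate c); apply: cint_bump_approx => //; first exact: ltW.
    by move=> x xc; apply: hc; exact: lt_le_trans ddc.
  have [I_1 A_1] := approx _ _ dd1 hd1; have [I_2 A_2] := approx _ _ dd2 hd2.
  have [I_3 A_3] := approx _ _ dd3 hd3.
  pose theta x := (c3 - c2)%:C * (smooth_bump c1 d x)%:C + (c1 - c3)%:C * (smooth_bump c2 d x)%:C
    + (c2 - c1)%:C * (smooth_bump c3 d x)%:C.
  pose r := Num.max (`|c1| + d) (Num.max (`|c2| + d) (`|c3| + d)).
  have lec (c dc : R) : d <= dc -> `|c| + dc < a -> `|c| + d < a.
    by move=> hd; apply: le_lt_trans; rewrite lerD2l.
  have ra : r < a by rewrite !gt_max (lec _ _ dd1 da1) (lec _ _ dd2 da2) (lec _ _ dd3 da3).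
  have sth : csmooth theta.
    by do 2?apply: csmoothD; apply: csmoothZ; exact: bump_term_csmooth.
  have th0 x : r < `|x| -> theta x = 0.
    by rewrite !gt_max => /and3P[x1 x2 x3]; rewrite /theta !bump_supp_norm// !mulr0 !addr0.
  have Ib c : L1R (fun x => (smooth_bump c d x)%:C).
    by split; [exact: (integrable_bump c d0)|exact: integrable0].
  have Ixb c : L1R (fun x => x%:C * (smooth_bump c d x)%:C).
    apply: (@L1R_suppM R (fun x => (smooth_bump c d x)%:C) (`|c| + d) (Ib c) _ (fun x => x%:C) (`|c| + d)).
    - by move=> s ds; rewrite bump_supp_norm.
    - exact: cmeasurable_real.
    - by move=> s; rewrite cnorm1_real.
  have mass0 : I1 theta = 0.
    rewrite (cint_lin3 _ _ _ (Ib c1) (Ib c2) (Ib c3)).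
    by rewrite !cint_real !bump_translate !rmorphB/=; ring.
  have moment0 : I1 (fun x => x%:C * theta x) = 0.
    transitivity (I1 (fun x => (c3 - c2)%:C * (x%:C * (smooth_bump c1 d x)%:C) + (c1 - c3)%:C * (x%:C * (smooth_bump c2 d x)%:C)
        + (c2 - c1)%:C * (x%:C * (smooth_bump c3 d x)%:C))).
      by apply: eq_I1 => x; rewrite /theta; ring.
    rewrite (cint_lin3 _ _ _ (Ixb c1) (Ixb c2) (Ixb c3)).
    by rewrite (cint_bump_moment c1 d0) (cint_bump_moment c2 d0) (cint_bump_moment c3 d0) !rmorphB/=; ring.
  have cth := csmooth_ccontinuous sth.
  have [m hm] := ccontinuous_bounded (- r) r cth.
  have thb x : cnorm1 (theta x) <= `|m|.
    have [xr|rx] := leP `|x| r; last by rewrite th0// cnorm1_0.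
    by apply: le_trans (ler_norm _); apply: hm; rewrite -ler_norml.
  have mth := ccontinuous_measurable cth.
  have Iu : L1R (fun x => clip u x * theta x).
    exact: (cintegrableMr ((L1_clip u).1 Lu) mth thb).
  have Ip : L1R (fun x => clip (prim2 (clip h)) x * theta x).
    have cp : ccontinuous (prim2 (clip h)) by [].
    apply: (cintegrableMr _ mth thb); rewrite -L1_clip; apply/L1_clip.
    have [n hn] := ccontinuous_bounded (- a) a cp.
    have mc : cmeasurable (clip (prim2 (clip h)) : mR -> _).
      apply: cmeasurableM; last exact: ccontinuous_measurable.
      apply: cmeasurable_bool; apply: measurable_and; apply: measurable_fun_ltr => //;
        exact: measurable_cst.
    have := @bounded_itv_cintegrable R (- a) a `|n| (clip (prim2 (clip h))) mc.
    have bd x : - a <= x <= a -> cnorm1 (clip (prim2 (clip h)) x) <= `|n|.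
      by move=> /hn hx; apply: (le_trans (cnorm1_le_boolM _ _)); apply: (le_trans hx); exact: ler_norm.
    move=> /(_ bd); congr (cintegrable _ _ _); apply/funext => x.
    rewrite -ler_norml; have [xa|xa] := leP `|x| a; first by rewrite ind1 mul1r.
    by rewrite clip_supp// mulr0.
  have Z : I1 (fun x => clip w x * theta x) = 0.
    transitivity (I1 (fun x => clip u x * theta x - clip (prim2 (clip h)) x * theta x)).
      by apply: eq_I1 => x; rewrite /clip /w; ring.
    rewrite cintB// (weak_deriv2_pairing ra sth th0 mass0 moment0 uh).
    by rewrite (prim2_pairing ra sth th0 mass0 moment0 Lh) subrr.
  have Z' : (c3 - c2)%:C * I1 (fun x => clip w x * (smooth_bump c1 d x)%:C) +
      (c1 - c3)%:C * I1 (fun x => clip w x * (smooth_bump c2 d x)%:C) +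
      (c2 - c1)%:C * I1 (fun x => clip w x * (smooth_bump c3 d x)%:C) = 0.
    apply: (etrans (esym (cint_lin3 _ _ _ I_1 I_2 I_3))); apply: (etrans _ Z).
    by apply: eq_I1 => x; rewrite /theta; ring.
  rewrite -(ler_pM2r M0) -{1}(gtr0_norm M0) -cnorm1_realM.
  move: A_1 A_2 A_3 Z'.
  set J1 := cint _ _ _; set J2 := cint _ _ _; set J3 := cint _ _ _ => A_1 A_2 A_3 Z'.
  (* The combination of the pairings is exactly 0 by [Z'], so only the three approximation errors
     remain, each at most e M before weighting. *)
  have -> : ((c3 - c2)%:C * w c1 + (c1 - c3)%:C * w c2 + (c2 - c1)%:C * w c3) * M%:C =
      - ((c3 - c2)%:C * (J1 - w c1 * M%:C) + (c1 - c3)%:C * (J2 - w c2 * M%:C) +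
      (c2 - c1)%:C * (J3 - w c3 * M%:C)).
    by apply/eqP; rewrite -subr_eq0 -[X in _ == X]Z'; apply/eqP; ring.
  rewrite cnorm1N; apply: (le_trans (cnorm1D _ _)).
  apply: (le_trans (lerD (cnorm1D _ _) (lexx _))).
  have sc (s : R) z : cnorm1 z <= e * M -> cnorm1 (s%:C * z) <= `|s| * (e * M).
    by move=> zM; rewrite mulrC cnorm1_realM mulrC; apply: ler_wpM2l.
  apply: (le_trans (lerD (lerD (sc _ _ A_1) (sc _ _ A_2)) (sc _ _ A_3))).
  by rewrite -!mulrDl -mulrA.
(* The affine function that takes the values of w at 0 and at a / 2. *)
pose k0 := w 0; pose k1 := (w (a / 2) - w 0) / (a / 2)%:C.
exists k0, k1.
have a2 : 0 < a / 2 by rewrite divr_gt0.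
have open x : - a < x < a -> u x = k0 + k1 * x%:C + prim2 (clip h) x.
  move=> xa; have ha : a / 2 < a by rewrite ltr_pdivrMr// ltr_pMr// ltr1n.
  have := three 0 (a / 2) x _ _ xa.
  rewrite oppr_lt0 a0 ha (lt_trans _ a2) ?oppr_lt0// sub0r subr0 => /(_ isT isT) E.
  have wE : w x = k0 + k1 * x%:C.
    have n0 : (a / 2)%:C != 0 :> R[i] by apply/eqP => -[/eqP]; rewrite gt_eqF.
    apply: (mulfI n0); transitivity ((a / 2)%:C * w 0 + (w (a / 2) - w 0) * x%:C).
      by apply/eqP; rewrite -subr_eq0 -[X in _ == X]E rmorphB rmorphN/=; apply/eqP; ring.
    have na : a%:C != 0 :> R[i] by apply/eqP => -[/eqP]; rewrite gt_eqF.
    by rewrite /k0 /k1; field; exact: na.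
  by rewrite -wE /w subrK.
have [cr1 cr2] : ccontinuous (fun x => k0 + k1 * x%:C + prim2 (clip h) x).
  apply: (@is_cderive_ccontinuous _ _ (fun x => k1 + prim1 (clip h) x)) => x.
  apply: is_cderiveD; first exact: is_cderive_affine.
  exact: (is_cderive_prim2 Lh (@clip_supp h)).
move=> x xa; apply: complex_eqP.
- apply: (within_eq_closure cu1 (continuous_subspaceT cr1)) xa => y /open.
  by rewrite /re => ->.
- apply: (within_eq_closure cu2 (continuous_subspaceT cr2)) xa => y /open.
  by rewrite /im => ->.
Qed.

End SobolevRepresentation.

(** * From double primitives back to Sobolev functions *)

Section RepresentationToSobolev.
Context {R : realType} (a : R).
Hypothesis a0 : 0 < a.
Local Notation mR := (measurableTypeR R).
Local Notation I1 f := (cint (@leb R) setT f).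
Local Notation L1R f := (cintegrable (@leb R) setT f).
Local Notation ind := (@ind R).

Lemma test_function_vanish (phi : R -> R[i]) : test_function `]-a, a[ phi ->
  [/\ forall x, is_cderive phi x (cD (1 : R) phi x), ccontinuous (cD (1 : R) phi) &
   forall x, ~~ (- a < x < a) -> phi x = 0 /\ cD (1 : R) phi x = 0].
Proof.
move=> [s1 s2 cs sub].
have d x : is_cderive phi x (cD (1 : R) phi x).
  by split; split => //; [have [_] := s1 [::]|have [_] := s2 [::]]; exact.
split => //.
- by split; [have [+ _] := s1 [:: 1]|have [+ _] := s2 [:: 1]].
- move=> x xa; have nx : (~` csupp phi) x.
    by move=> /sub /=; rewrite in_itv/=; apply/negP.
  have op : open (~` csupp phi) by apply: closed_openC; exact: closed_closure.
  have [e /= e0 he] := (nbhs_ballP _ _).1 (open_nbhs_nbhs (conj op nx)).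
  have z y : `|y - x| < e -> phi y = 0.
    move=> yx; apply/eqP; rewrite -[_ == _]negbK; apply/negP => py.
    by apply: (he y); [rewrite /ball /= distrC|exact: subset_closure].
  split; first by apply: z; rewrite subrr normr0.
  by apply: cD_cderive; apply: (is_cderive_eq_near e0 z (is_cderive_cst 0 x)).
Qed.

Lemma weak_deriv_prim1 (v G g : R -> R[i]) (c : R[i]) : L1R G ->
  (forall x, - a < x < a -> v x = c + prim1 G x) ->
  (forall x, - a < x < a -> g x = G x) -> weak_deriv a v g.
Proof.
move=> IG vG gG phi /test_function_vanish[dp cdp p0].
rewrite !cint_clip.
transitivity (I1 (fun x => (c + prim1 G x) * cD (1 : R) phi x)).
  apply: eq_I1 => x; rewrite /clip; have [xa|xa] := boolP (- a < x < a).
    by rewrite ind1 mul1r vG.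
  by rewrite (p0 _ xa).2 !mulr0.
rewrite (cint_by_parts c IG dp cdp (A := a)); last first.
  by move=> x ax; apply: (p0 _ _).1; rewrite -ltr_norml -leNgt ltW.
congr (- _); apply: eq_I1 => x; rewrite /clip; have [xa|xa] := boolP (- a < x < a).
  by rewrite ind1 mul1r gG.
by rewrite (p0 _ xa).1 !mulr0.
Qed.

Lemma ccontinuous_L1 (F u : R -> R[i]) : ccontinuous F ->
  (forall x, - a < x < a -> u x = F x) -> L1 a u.
Proof.
move=> cF uF; apply/L1_clip.
have -> : clip a u = (fun x => ind (- a < x < a) * (ind (- a <= x <= a) * F x)).
  apply/funext => x; rewrite /clip; have [xa|xa] := boolP (- a < x < a); last by rewrite ind0 !mul0r.
  by move: (xa) => /andP[/ltW -> /ltW ->]; rewrite !ind1 !mul1r uF.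
apply: cintegrable_bool.
  by apply: measurable_and; apply: measurable_fun_ltr => //; exact: measurable_cst.
have [m hm] := ccontinuous_bounded (- a) a cF.
exact: (bounded_itv_cintegrable (ccontinuous_measurable cF) hm).
Qed.

Lemma ccontinuousD (f g : R -> R[i]) : ccontinuous f -> ccontinuous g ->
  ccontinuous (fun x => f x + g x).
Proof.
move=> [f1 f2] [g1 g2]; split => x.
- rewrite (_ : re _ = re f \+ re g); first by apply: continuousD; [exact: f1|exact: g1].
  by apply/funext => y; rewrite /re cReD.
- rewrite (_ : im _ = im f \+ im g); first by apply: continuousD; [exact: f2|exact: g2].
  by apply/funext => y; rewrite /im cImD.
Qed.

Lemma ccontinuous_cst (c : R[i]) : ccontinuous (fun=> c : R[i]).
Proof. by split => x; exact: cvg_cst. Qed.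

Lemma ccontinuous_on_eq (F u : R -> R[i]) : ccontinuous F ->
  (forall x, - a <= x <= a -> u x = F x) -> ccontinuous_on `[-a, a] u.
Proof.
move=> [F1 F2] uF.
split.
- have := continuous_subspaceT (A := `[-a, a]%classic) F1.
  apply: (@subspace_eq_continuous _ _ _ (re F) (re u)) => x.
  by rewrite mem_setE in_itv/= => /uF xa; rewrite /from_subspace/= /re xa.
- have := continuous_subspaceT (A := `[-a, a]%classic) F2.
  apply: (@subspace_eq_continuous _ _ _ (im F) (im u)) => x.
  by rewrite mem_setE in_itv/= => /uF xa; rewrite /from_subspace/= /im xa.
Qed.

Context (u f : R -> R[i]) (c0 c1 : R[i]).
Hypothesis Lf : L1 a f.
Hypothesis uE : forall x, - a <= x <= a -> u x = c0 + c1 * x%:C + prim2 (clip a f) x.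

Let F x := c0 + c1 * x%:C + prim2 (clip a f) x.
Let g x := c1 + prim1 (clip a f) x.

Let dF x : is_cderive F x (g x).
Proof.
apply: is_cderiveD; first exact: is_cderive_affine.
exact: (is_cderive_prim2 ((L1_clip a f).1 Lf) (@clip_supp R a f)).
Qed.

Let cF : ccontinuous F := is_cderive_ccontinuous dF.

Let cg : ccontinuous g.
Proof.
by apply: ccontinuousD; [exact: ccontinuous_cst|exact/ccontinuous_prim1/L1_clip].
Qed.

Let uEo x : - a < x < a -> u x = F x.
Proof. by move=> /andP[/ltW ? /ltW ?]; apply: uE; apply/andP. Qed.

Lemma is_cderive_representation x : - a < x < a -> is_cderive u x (g x).
Proof.
move=> xa; have e0 : 0 < a - `|x| by rewrite subr_gt0 ltr_norml.
apply: (is_cderive_eq_near e0 _ (dF x)) => y yx; apply: uEo.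
by rewrite -ltr_norml; have := ler_normD (y - x) x; rewrite subrK; lra.
Qed.

Lemma weak_deriv2_prim2 : weak_deriv2 a u f.
Proof.
have If := (L1_clip a f).1 Lf.
exists g; split => //.
- exact: (ccontinuous_L1 cg).
(* Cut off to [-a, a], g is integrable and its primitive from minus infinity starts at - a; hence
   the constant F (- a). *)
- pose G x := ind (- a <= x <= a) * g x.
  have IG : L1R G.
    have [m hm] := ccontinuous_bounded (- a) a cg.
    exact: (bounded_itv_cintegrable (ccontinuous_measurable cg) hm).
  apply: (@weak_deriv_prim1 _ G g (F (- a)) IG) => x /andP[x1 x2]; last first.
    by rewrite /G (ltW x1) (ltW x2) ind1 mul1r.
  rewrite uEo ?x1//; have ax : - a <= x by exact: ltW.
  have -> : prim1 G x = I1 (fun y => ind (- a <= y <= x) * g y).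
    apply: eq_I1 => y; rewrite /G mulrA indM; congr (ind _ * _).
    apply/idP/idP => [/andP[y1 /andP[y2 y3]]|/andP[y1 y2]]; first by rewrite y2.
    by rewrite y2 y1 (le_trans y2 (ltW x2)).
  by rewrite (cint_FTC2 ax dF cg) addrC subrK.
- apply: (@weak_deriv_prim1 _ (clip a f) f c1 If) => // x xa.
  by rewrite clip_in.
Qed.

Lemma W21_prim2 : W21 a u.
Proof.
split; first exact: (ccontinuous_L1 cF).
- split; first exact: (ccontinuous_on_eq cF).
  exists g; split; first exact: (ccontinuous_on_eq cg).
  by move=> x; rewrite in_itv/= => xa; exact: is_cderive_representation.
- by exists f; exact: weak_deriv2_prim2.
Qed.

End RepresentationToSobolev.

(** * The operators with kernels K(x, t) and K(t, x) *)

Section VolterraOperator.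
Context {R : realType}.
Local Notation mR := (measurableTypeR R).
Local Notation I1 f := (cint (@leb R) setT f).
Local Notation I2 f := (cint (@leb2 R) setT f).
Local Notation L1R f := (cintegrable (@leb R) setT f).
Local Notation L1R2 f := (cintegrable (@leb2 R) setT f).
Local Notation ind := (@ind R).

Lemma cint_set1 (f : R -> R[i]) (x : R) : cint leb `[x, x] f = 0.
Proof. by rewrite set_itv1; apply: complex_eqP; rewrite /= Rintegral_set1. Qed.

(** Absorbs the point 0, at which indicators of closed half-lines overlap. *)
Lemma eq_I1_off0 (f g : R -> R[i]) : L1R f -> L1R g ->
  (forall x, x != 0 -> f x = g x) -> I1 f = I1 g.
Proof.
move=> If Ig fg; apply/eqP; rewrite -subr_eq0 -cintB//; apply/eqP.
transitivity (cint leb `[0, 0] (fun x => f x - g x)); last exact: cint_set1.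
rewrite [RHS]cint_mkcond; apply: eq_I1 => x; rewrite mem_setE in_itv/= -eq_le eq_sym.
by have [->|x0] := eqVneq x 0; rewrite ?ind1 ?ind0 ?mul1r ?mul0r// fg// subrr.
Qed.

Lemma L1R_reflect (f : R -> R[i]) : L1R f -> L1R (fun x => f (- x)).
Proof.
have n0 : (-1 : R) != 0 by rewrite oppr_eq0 oner_neq0.
move=> /(cintegrable_affine 0 n0).
by congr (cintegrable _ _ _); apply/funext => x; rewrite mulN1r addr0.
Qed.

Lemma I1_reflect (f : R -> R[i]) : cmeasurable (f : mR -> _) -> I1 (fun x => f (- x)) = I1 f.
Proof.
have n0 : (-1 : R) != 0 by rewrite oppr_eq0 oner_neq0.
move=> mf; rewrite [RHS](cint_affine 0 n0 mf) normrN1 mul1r.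
by apply: eq_I1 => x; rewrite mulN1r addr0.
Qed.

(* [prim2 f] integrates from minus infinity; [jint f] vanishes to first order at 0. *)
Definition jint (f : R -> R[i]) (x : R) : R[i] :=
  prim2 f x - prim2 f 0 - x%:C * prim1 f 0.

Section Jint.
Context (f : R -> R[i]) (A : R).
Hypotheses (If : L1R f) (fA : forall s, A < `|s| -> f s = 0).

(** For x >= 0 and s != 0 the kernel (x - s)_+ - (- s)_+ - x 1_(s <= 0) equals [jkernel x s]; at s =
    0 the two differ. *)
Lemma jint_pos x : 0 <= x -> jint f x = I1 (fun y => jkernel x y * f y).
Proof.
move=> x0; rewrite /jint /prim2 /prim1.
have I0 := L1R_prim2 If fA.
have Ii : L1R (fun s => ind (s <= 0) * f s) by apply: cintegrable_bool => //; exact: measurable_le_cst.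
have Ij : L1R (fun y => jkernel x y * f y).
  apply: (cintegrableMl (c := x) If); first exact: (cintegrable_measurable (L1R_jkernel x)).
  move=> y; rewrite /jkernel; case: (boolP (0 <= y <= x)) => [/andP[h1 h2]|_].
    by rewrite ind1 mul1r cnorm1_real ger0_norm; lra.
  by rewrite ind0 mul0r cnorm1_0.
rewrite -cintB// -cintZ// -cintB//; last 2 first.
- exact: cintegrableB.
- exact: cintegrableZ.
apply: eq_I1_off0 => //.
  by apply: cintegrableB; [exact: cintegrableB|exact: cintegrableZ].
move=> s s0; rewrite mulrA -!mulrBl; congr (_ * _); rewrite /jkernel.
have [sp|sn] := ltP 0 s.
  rewrite ind0 mulr0 subr0 (max_l (y := 0 - s)) ?subr0; last by rewrite sub0r oppr_le0 ltW.
  rewrite (ltW sp)/=; have [sx|xs] := leP s x; first by rewrite max_r ?ind1 ?mul1r ?subr_ge0// subr0.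
  by rewrite max_l ?subr_le0 ?(ltW xs)// ind0 mul0r.
have sn' : s < 0 by rewrite lt_neqAle s0.
rewrite (leNgt 0 s) sn'/= ind0 mul0r ind1 mulr1 max_r ?max_r ?sub0r ?oppr_ge0//; last by lra.
by rewrite -!rmorphB/=; apply/eqP; rewrite -subr_eq0; apply/eqP; rewrite -rmorphB/= -(rmorph0 (real_complex R)); congr (_ %:C); ring.
Qed.

(** From y_+ = y + (- y)_+, applied to both positive parts. This lets identities proved for x >= 0
    be transferred to x < 0. *)
Lemma jint_reflect x : jint (fun y => f (- y)) x = jint f (- x).
Proof.
rewrite /jint /prim2 /prim1.
have I0 := L1R_prim2 If fA.
have mf := cintegrable_measurable If.
have mle : cmeasurable (fun s : mR => ind (- (s : R) <= 0)).
  apply: cmeasurable_bool; apply: measurable_fun_ler; last exact: measurable_cst.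
  exact: measurable_funN.
have Ii : L1R (fun s => ind (s <= 0) * f s) by apply: cintegrable_bool => //; exact: measurable_le_cst.
have Ii' : L1R (fun s => ind (- s <= 0) * f s).
  by apply: (cintegrableMl (c := 1) If mle) => s; exact: cnorm1_bool.
have mm (z : R) : cmeasurable (fun s : mR => (Num.max 0 (z + s))%:C).
  apply: cmeasurable_real; apply: measurable_maxr; first exact: measurable_cst.
  by apply: measurable_funD => //; exact: measurable_cst.
have I0' (z : R) : L1R (fun s => (Num.max 0 (z + s))%:C * f s).
  have := L1R_reflect (@L1R_prim2 _ (fun y => f (- y)) A (L1R_reflect If) _ z).
  have h s : A < `|s| -> f (- s) = 0 by move=> sA; apply: fA; rewrite normrN.
  move=> /(_ h); congr (cintegrable _ _ _); apply/funext => s.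
  by rewrite !opprK.
have e (z : R) : I1 (fun s => (Num.max 0 (z - s))%:C * f (- s)) = I1 (fun s => (Num.max 0 (z + s))%:C * f s).
  rewrite -[RHS]I1_reflect; first by [].
  by apply: cmeasurableM.
have e' : I1 (fun s => ind (s <= 0) * f (- s)) = I1 (fun s => ind (- s <= 0) * f s).
  rewrite -[RHS]I1_reflect; first by apply: eq_I1 => s; rewrite opprK.
  exact: cmeasurableM.
rewrite !e e' -!cintB// -!cintZ// -!cintB//; do ?[exact: cintegrableB|exact: cintegrableZ].
apply: eq_I1_off0.
- by apply: cintegrableB; [exact: cintegrableB|exact: cintegrableZ].
- by apply: cintegrableB; [exact: cintegrableB|exact: cintegrableZ].
move=> s s0; rewrite !mulrA -!mulrBl; congr (_ * _).
have mx (y : R) : Num.max 0 y = y + Num.max 0 (- y).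
  by have [h|h] := leP 0 y; [rewrite max_l ?addr0// oppr_le0|rewrite max_r ?subrr// oppr_ge0 ltW].
rewrite (mx (x + s)) (mx (0 + s)) opprD add0r sub0r oppr_le0 indE indE.
rewrite -!rmorphM -!rmorphB/=; congr (_ %:C).
have [sp|sn] := ltP 0 s; first by rewrite (ltW sp); ring.
by rewrite (leNgt 0 s) lt_neqAle s0 sn/=; ring.
Qed.

End Jint.

(* The integral of [k x t * v t] for [t] from [- x] to [x], oriented as in the statement. *)
Definition volt (k : R -> R -> R[i]) (v : R -> R[i]) (x : R) : R[i] :=
  (if 0 <= x then 1 else -1) * I1 (fun t => ind (`|t| <= `|x|) * k x t * v t).

Section VoltBounded.
Context (k : R -> R -> R[i]) (B : R).
Hypotheses (mk : cmeasurable (fun p : mR * mR => k p.1 p.2)) (kB : forall x t, cnorm1 (k x t) <= B).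

Let w x t := ind (`|t| <= `|x|) * k x t.

Let mw : cmeasurable (fun p : mR * mR => w p.1 p.2).
Proof.
apply: cmeasurableM => //; apply: cmeasurable_bool; apply: measurable_fun_ler; exact: measurableT_comp.
Qed.

Let wB x t : cnorm1 (w x t) <= B.
Proof. exact: (le_trans (cnorm1_le_boolM _ _)). Qed.

Lemma L1R_volt_integrand v x : L1R v -> L1R (fun t => ind (`|t| <= `|x|) * k x t * v t).
Proof. by move=> Iv; exact: (@cintegrable_kernel R _ _ _ _ (@sleb R) w B mw wB x v Iv). Qed.

Lemma cmeasurable_volt v : L1R v -> cmeasurable (volt k v : mR -> _).
Proof.
move=> Iv; apply: cmeasurableM.
  rewrite (_ : (fun x => _) = (fun x : mR => ind (0 <= (x : R)) - ind (~~ (0 <= (x : R))))); last first.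
    by apply/funext => x; case: (0 <= _); rewrite ?ind1 ?ind0 ?subr0 ?sub0r.
  by apply: cmeasurableB; apply: cmeasurable_bool; [|apply: measurable_neg];
    apply: measurable_fun_ler => //; exact: measurable_cst.
exact: (@cmeasurable_cint_kernel R _ _ _ _ (@sleb R) w mw v (cintegrable_measurable Iv)).
Qed.

Lemma cnorm1_volt v x : L1R v -> cnorm1 (volt k v x) <= B * \int[leb]_t cnorm1 (v t).
Proof.
move=> Iv; have h : cnorm1 (volt k v x) <= cnorm1 (I1 (fun t => w x t * v t)).
  by rewrite /volt; case: ifP => _; rewrite ?mul1r// mulN1r cnorm1N.
apply: (le_trans h); exact: (@cnorm1_kernel R _ _ _ _ (@sleb R) w B mw wB x v Iv).
Qed.

Lemma voltD v u x : L1R v -> L1R u -> volt k (fun t => v t + u t) x = volt k v x + volt k u x.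
Proof.
move=> Iv Iu; rewrite /volt -mulrDr -cintD; [|exact: L1R_volt_integrand..].
by congr (_ * _); apply: eq_I1 => t; rewrite mulrDr.
Qed.

Lemma voltZ c v x : L1R v -> volt k (fun t => c * v t) x = c * volt k v x.
Proof.
move=> Iv; rewrite /volt mulrCA -[c * _]cintZ; last exact: L1R_volt_integrand.
by congr (_ * _); apply: eq_I1 => t; ring.
Qed.

(** The change of orientation is absorbed by the sign of the kernel - k(- x, - t). At x = 0 the sign
    factor of [volt] is 1 on both sides, so this computation does not apply; there both sides are 0,
    see [volt_reflect0]. *)
Lemma volt_reflect v x : x != 0 -> L1R v ->
  volt k v (- x) = volt (fun y t => - k (- y) (- t)) (fun t => v (- t)) x.
Proof.
move=> x0 Iv; rewrite /volt normrN.
have -> : (if 0 <= - x then 1 else -1 : R[i]) = - (if 0 <= x then 1 else -1).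
  rewrite oppr_ge0; have [xp|xn] := ltP 0 x; first by rewrite (ltW xp).
  by rewrite (leNgt 0 x) lt_neqAle x0 xn/= opprK.
rewrite mulNr -mulrN -cintN; last by have := L1R_volt_integrand (- x) Iv; rewrite normrN.
congr (_ * _); rewrite -[LHS]I1_reflect.
  by apply: eq_I1 => t; rewrite normrN; ring.
apply: cmeasurableN; apply: cmeasurableM; last exact: (cintegrable_measurable Iv).
apply: cmeasurableM; last exact: (cmeasurable_kernel2 mk).
by apply: cmeasurable_bool; apply: measurable_fun_ler; [exact: normr_measurable|exact: measurable_cst].
Qed.

End VoltBounded.

Section SourceRepresentation.
Context (qh : R -> R[i]) (P : R * R -> R[i]) (k : R -> R -> R[i]) (B a : R).
Hypotheses (Iq : L1R qh) (IP : L1R2 P) (PS : forall p, p.1 < `|p.2| -> P p = 0).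
Hypotheses (mk : cmeasurable (fun p : mR * mR => k p.1 p.2)) (kB : forall x t, cnorm1 (k x t) <= B).

Let IP2 : cintegrable (@sleb2 R) setT P. Proof. exact: IP. Qed.

Let rho1 s := ind (0 <= s) * qh s.
Let Irho1 : cintegrable (@sleb R) setT rho1.
Proof.
apply: cintegrable_bool => //; apply: measurable_fun_ler => //; exact: measurable_cst.
Qed.
Let supp1 (s : R) : s < `|s| -> rho1 s = 0.
Proof.
move=> h; rewrite /rho1 (_ : 0 <= s = false) ?ind0 ?mul0r//.
by apply/negbTE; apply: contraTN h => /ger0_norm ->; rewrite ltxx.
Qed.

(** Sources [qh] on the half-diagonal (s, s), s >= 0, together with a density P in the forward cone
    of the origin. *)
Definition source_kernel x t : R[i] :=
  cone_kernel (@sleb R) rho1 id id x t + cone_kernel (@sleb2 R) P fst snd x t.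

Hypothesis Psec : forall y, L1R (fun tau => P (y, tau)).
Hypothesis kE : forall x t, 0 <= x <= a -> ind (`|t| <= x) * k x t = source_kernel x t.

Let m1 : measurable_fun setT (id : mR -> mR). Proof. exact: measurable_id. Qed.
Let mf : measurable_fun setT (fst : mR * mR -> mR). Proof. exact: measurable_fst. Qed.
Let ms : measurable_fun setT (snd : mR * mR -> mR). Proof. exact: measurable_snd. Qed.

Lemma volt_source v x : 0 <= x <= a -> L1R v ->
  volt k v x = cone_operator (@sleb R) rho1 id id v x + cone_operator (@sleb2 R) P fst snd v x.
Proof.
move=> xa Iv; have /andP[x0 _] := xa; rewrite /volt x0 mul1r /cone_operator -cintD.
- by apply: eq_I1 => t; rewrite -mulrDl (ger0_norm x0) kE.
- apply: (@cintegrableMl R _ mR _ v _ (cnorm1 (2^-1 : R[i]) * \int[sleb]_p cnorm1 (rho1 p)) Iv).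
    apply: cmeasurableM; first exact: cmeasurable_cst.
    exact: (cmeasurable_cint_kernel sleb (cmeasurable_cone_t m1 m1 x) (cintegrable_measurable Irho1)).
  move=> t; apply: (le_trans (cnorm1M _ _)); apply: ler_wpM2l; first exact: cnorm1_ge0.
  have := @cnorm1_kernel R _ _ _ _ (@sleb R) (cone id id x) 1 (cmeasurable_cone_t m1 m1 x) (cnorm1_cone id id x) t rho1 Irho1.
  by rewrite mul1r.
- apply: (@cintegrableMl R _ mR _ v _ (cnorm1 (2^-1 : R[i]) * \int[sleb2]_p cnorm1 (P p)) Iv).
    apply: cmeasurableM; first exact: cmeasurable_cst.
    exact: (cmeasurable_cint_kernel sleb2 (cmeasurable_cone_t mf ms x) (cintegrable_measurable IP)).
  move=> t; apply: (le_trans (cnorm1M _ _)); apply: ler_wpM2l; first exact: cnorm1_ge0.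
  have := @cnorm1_kernel R _ _ _ _ (@sleb2 R) (cone fst snd x) 1 (cmeasurable_cone_t mf ms x) (cnorm1_cone fst snd x) t P IP.
  by rewrite mul1r.
Qed.

(** [cone_operator_prim2] for the two families of sources, added up. A diagonal source at time y
    sees u y; the sources in the plane at time y integrate u over their positions. [Psec] is asked
    for every y because the outcome is compared pointwise in y. *)
Lemma volt_source_prim2 (f u : R -> R[i]) (A x : R) (c0 c1 : R[i]) : L1R f ->
  (forall s, A < `|s| -> f s = 0) -> 0 <= x <= a ->
  (forall t, `|t| <= x -> u t = c0 + c1 * t%:C + prim2 f t) ->
  volt k u x = I1 (fun y => jkernel x y *
    (qh y * u y + I1 (fun tau => P (y, tau) * u tau) + volt k f y)).
Proof.
move=> If fA xa uE; have /andP[x0 xlea] := xa.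
pose kk t := c0 + c1 * t%:C + prim2 f t.
(* At x the operator only sees |t| <= x, and there the representation of u is available. *)
pose k1 t := ind (`|t| <= x) * kk t.
have k1u t : `|t| <= x -> k1 t = u t by move=> tx; rewrite /k1 tx ind1 mul1r uE.
have ckk : ccontinuous kk.
  apply: (@is_cderive_ccontinuous _ _ (fun y => c1 + prim1 f y)) => y.
  by apply: is_cderiveD; [exact: is_cderive_affine|exact: (is_cderive_prim2 If fA)].
have [m hm] := ccontinuous_bounded (- x) x ckk.
have Ik1 : L1R k1.
  have := bounded_itv_cintegrable (ccontinuous_measurable ckk) hm.
  by congr (cintegrable _ _ _); apply/funext => t; rewrite /k1 -ler_norml.
have k1b : exists c, forall t, cnorm1 (k1 t) <= c.
  exists `|m| => t; rewrite /k1; have [tx|] := leP `|t| x; last by rewrite ind0 mul0r cnorm1_0.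
  by rewrite ind1 mul1r; apply: le_trans (ler_norm _); apply: hm; rewrite -ler_norml.
have -> : volt k u x = volt k k1 x.
  congr (_ * _); apply: eq_I1 => t; rewrite (ger0_norm x0).
  by have [tx|] := leP `|t| x; [rewrite k1u|rewrite ind0 !mul0r].
rewrite volt_source// (cone_operator_prim2 Irho1 m1 m1 supp1 If fA x0 Ik1 k1b).
rewrite (cone_operator_prim2 IP2 mf ms PS If fA x0 Ik1 k1b).
have mj := cintegrable_measurable (L1R_jkernel x).
have jc y : cnorm1 (jkernel x y) <= x.
  rewrite /jkernel; case: (boolP (0 <= y <= x)) => [/andP[h1 h2]|_].
    by rewrite ind1 mul1r cnorm1_real ger0_norm; lra.
  by rewrite ind0 mul0r cnorm1_0.
have mk1 := cintegrable_measurable Ik1.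
have [c hc] := k1b.
have c00 : 0 <= c by apply: le_trans (hc 0); exact: cnorm1_ge0.
have E1 : cint sleb setT (fun p => jkernel x p * k1 p * rho1 p) =
    I1 (fun y => jkernel x y * (qh y * k1 y)).
  apply: eq_I1 => y; rewrite /rho1 /jkernel; have [y0|] := leP 0 y; last by rewrite !ind0 !mul0r.
  by rewrite ind1; ring.
have IPk : L1R2 (fun p => P p * k1 p.2).
  apply: (@cintegrableMr _ _ _ (@leb2 R) P (fun p : mR * mR => k1 p.2) c IP) => //.
  exact: (cmeasurable_comp mk1 ms).
have IPj : L1R2 (fun p => jkernel x p.1 * (P p * k1 p.2)).
  apply: (@cintegrableMl _ _ _ (@leb2 R) _ (fun p : mR * mR => jkernel x p.1) x IPk) => //.
  exact: (cmeasurable_comp mj mf).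
have E2 : cint sleb2 setT (fun p => jkernel x p.1 * k1 p.2 * P p) =
    I1 (fun y => I1 (fun tau => jkernel x y * (P (y, tau) * k1 tau))).
  rewrite (fub1 IPj); congr (cint _ _ _); apply/funext => p.
  by rewrite -mulrA [k1 _ * _]mulrC.
have L1q : L1R (fun y => jkernel x y * (qh y * k1 y)).
  apply: (cintegrableMl (c := x) _ mj jc).
  exact: (cintegrableMr Iq mk1 hc).
have L1P : L1R (fun y => I1 (fun tau => jkernel x y * (P (y, tau) * k1 tau))).
  exact: (L1R_section IPj).
have Lc1 : L1R (fun y => jkernel x y * cone_operator sleb rho1 id id f y).
  have mw : cmeasurable (fun p : mR * mR => cone_kernel sleb rho1 id id p.1 p.2).
    apply: cmeasurableM; first exact: cmeasurable_cst.
    exact: (@cmeasurable_cint_kernel R _ _ _ _ (@sleb R) (fun (p : mR * mR) s => cone id id p.1 p.2 s)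
      (cmeasurable_cone m1 m1) rho1 (cintegrable_measurable Irho1)).
  apply: (cintegrableMr (L1R_jkernel x)).
    exact: (@cmeasurable_cint_kernel R _ _ _ _ (@sleb R) (fun y t => cone_kernel sleb rho1 id id y t) mw f (cintegrable_measurable If)).
  move=> y; apply: (@cnorm1_kernel R _ _ _ _ (@sleb R) (fun y t => cone_kernel sleb rho1 id id y t) _ mw _ y f If) => z t.
  apply: (le_trans (cnorm1M _ _)); apply: ler_wpM2l; first exact: cnorm1_ge0.
  exact: (@cnorm1_kernel R _ _ _ _ (@sleb R) (cone id id z) 1 (cmeasurable_cone_t m1 m1 z) (cnorm1_cone id id z) t rho1 Irho1).
have Lc2 : L1R (fun y => jkernel x y * cone_operator sleb2 P fst snd f y).
  have mw : cmeasurable (fun p : mR * mR => cone_kernel sleb2 P fst snd p.1 p.2).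
    apply: cmeasurableM; first exact: cmeasurable_cst.
    exact: (@cmeasurable_cint_kernel R _ _ _ _ (@sleb2 R) (fun (p : mR * mR) s => cone fst snd p.1 p.2 s)
      (cmeasurable_cone mf ms) P (cintegrable_measurable IP)).
  apply: (cintegrableMr (L1R_jkernel x)).
    exact: (@cmeasurable_cint_kernel R _ _ _ _ (@sleb R) (fun y t => cone_kernel sleb2 P fst snd y t) mw f (cintegrable_measurable If)).
  move=> y; apply: (@cnorm1_kernel R _ _ _ _ (@sleb R) (fun y t => cone_kernel sleb2 P fst snd y t) _ mw _ y f If) => z t.
  apply: (le_trans (cnorm1M _ _)); apply: ler_wpM2l; first exact: cnorm1_ge0.
  exact: (@cnorm1_kernel R _ _ _ _ (@sleb2 R) (cone fst snd z) 1 (cmeasurable_cone_t mf ms z) (cnorm1_cone fst snd z) t P IP).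
rewrite E1 E2 addrACA -(cintD L1q L1P) -(cintD Lc1 Lc2) -(cintD (cintegrableD L1q L1P) (cintegrableD Lc1 Lc2)).
apply: eq_I1 => y.
rewrite /jkernel; case: (boolP (0 <= y <= x)) => [/andP[y0 yx]|_]; last first.
  rewrite ind0 !mul0r !addr0 add0r.
  rewrite (_ : (fun tau => _) = fun=> 0) ?cint0//.
  by apply/funext => tau; rewrite !mul0r.
rewrite ind1 !mul1r !mulrDr volt_source//; last by rewrite y0 (le_trans yx).
rewrite mulrDr k1u ?(ger0_norm y0)//; congr (_ + _ + _).
have Ip : L1R (fun tau => P (y, tau) * k1 tau).
  exact: (cintegrableMr (Psec y) mk1 hc).
rewrite cintZ//; congr (_ * _); apply: eq_I1 => tau.
have [tau_y|h] := leP `|tau| y; first by rewrite k1u// (le_trans tau_y).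
by rewrite (PS (p := (y, tau)))// !mul0r.
Qed.

End SourceRepresentation.
End VolterraOperator.

(** * Continuity in the plane and extension of the kernel *)

Section ContinuousPlane.
Context {R : realType}.
Local Notation mR := (measurableTypeR R).

(** Measurability is for the product sigma-algebra, continuity for the product topology: an open set
    of the plane is the countable union of the boxes with rational centre and radius that it
    contains. *)
Lemma measurable_continuous2 (F : R * R -> R) : continuous F ->
  measurable_fun setT (F : mR * mR -> mR).
Proof.
move=> cF mD; apply: (measurability _ (RGenOInfty.measurableE R)) => //.
move=> _ [_ [y ->] <-]; rewrite setTI.
set U := (X in measurable X).
have oU : open (U : set (R * R)).
  by apply: open_comp; [move=> ? _; exact: cF|exact: interval_open].
pose box (c d r : rat) := ((fun s : mR => `|(s : R) - ratr c|) @^-1` `]-oo, ratr r[) `*`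
  ((fun s : mR => `|(s : R) - ratr d|) @^-1` `]-oo, ratr r[).
have -> : U = \bigcup_c \bigcup_d \bigcup_r (if `[< box c d r `<=` U >] then box c d r else set0).
  apply/seteqP; split=> p; last first.
    by move=> [c _ [d _ [r _]]]; case: asboolP => [h /h|].
  move=> Up; have /nbhs_ballP[e /= e0 he] : nbhs (p : R * R) U by exact: open_nbhs_nbhs.
  have e2 : 0 < e / 2 by rewrite divr_gt0.
  have [r] := rat_in_itvoo e2; rewrite in_itv/= => /andP[r0 re].
  have pr (z : R) : z < z + ratr r by rewrite ltrDl.
  have [c] := rat_in_itvoo (pr p.1); rewrite in_itv/= => /andP[c1 c2].
  have [d] := rat_in_itvoo (pr p.2); rewrite in_itv/= => /andP[d1 d2].
  exists c => //; exists d => //; exists r => //.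
  rewrite asboolT; first by split; rewrite /= in_itv/= ltr_distl; apply/andP; split; lra.
  move=> z [/=]; rewrite !in_itv/= !ltr_distl => /andP[z1 z2] /andP[z3 z4].
  by apply: he; split; rewrite /= -ball_normE/= ltr_distl; apply/andP; split; lra.
apply: bigcupT_measurable_rat => c; apply: bigcupT_measurable_rat => d.
apply: bigcupT_measurable_rat => r; case: asboolP => // _; apply: measurableX.
- rewrite -[X in measurable X]setTI.
  have h : measurable_fun setT (fun s : mR => `|(s : R) - ratr c| : mR).
    by apply: measurableT_comp => //; apply: measurable_funB => //; exact: measurable_cst.
  exact: (h measurableT _ (measurable_itv _)).
- rewrite -[X in measurable X]setTI.
  have h : measurable_fun setT (fun s : mR => `|(s : R) - ratr d| : mR).
    by apply: measurableT_comp => //; apply: measurable_funB => //; exact: measurable_cst.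
  exact: (h measurableT _ (measurable_itv _)).
Qed.

Lemma within_continuous_comp (T U : topologicalType) (A : set U) (f : U -> R) (g : T -> U) :
  {within A, continuous f} -> continuous g -> (forall x, A (g x)) -> continuous (f \o g).
Proof.
move=> /subspace_continuousP cf cg gA x V Vf.
have /= := cf _ (gA x) V Vf; rewrite /within /= => h.
have := cg x _ h; rewrite !nbhs_simpl/=.
by apply: filterS => y /= /(_ (gA y)).
Qed.

Lemma continuous2_bounded (F : R * R -> R) (a : R) : continuous F ->
  exists c, forall p : R * R, (`[-a, a] `*` `[-a, a])%classic p -> `|F p| <= c.
Proof.
move=> cF.
have cp : compact ((`[-a, a] : set R) `*` (`[-a, a] : set R)).
  by apply: compact_setX; exact: segment_compact.
have := continuous_compact (continuous_subspaceT cF) cp.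
move=> /compact_bounded [M [_ hM]]; exists (`|M| + 1) => p pA.
by apply: (hM (`|M| + 1)); [rewrite (le_lt_trans (ler_norm _))// ltrDl|exists p].
Qed.

Definition clamp (a x : R) : R := Num.max (- a) (Num.min a x).

Lemma clamp_norm (a x : R) : 0 < a -> `|clamp a x| <= a.
Proof.
move=> a0; rewrite /clamp ler_norml le_max lexx/= ge_max ge_min lexx/= andbT.
by rewrite ge0_cp// ltW.
Qed.

Lemma clamp_id (a x : R) : `|x| <= a -> clamp a x = x.
Proof.
by rewrite ler_norml => /andP[h1 h2]; rewrite /clamp min_r// max_r.
Qed.

Lemma continuous_clamp (a : R) : continuous (clamp a).
Proof.
rewrite (_ : clamp a = (fun=> - a) \max ((fun=> a) \min id))//.
by move=> x; apply: continuous_max; [exact: cvg_cst|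
  apply: continuous_min; [exact: cvg_cst|exact: cvg_id]].
Qed.

Lemma Omega1_rotate (a x t : R) : `|x| <= a -> `|t| <= a ->
  Omega1 a ((x + t) / 2, (x - t) / 2).
Proof.
rewrite /Omega1/= !normrM [`|2^-1|]ger0_norm// !ler_norml => /andP[x1 x2] /andP[t1 t2].
by have [h1|h1] := ger0P (x + t); have [h2|h2] := ger0P (x - t); lra.
Qed.

End ContinuousPlane.

Section ExtendedKernel.
Context {R : realType} (a : R) (H : R -> R -> R[i]).
Hypothesis a0 : 0 < a.
Hypothesis Hc : ccontinuous_on (Omega1 a) (unc H).
Local Notation mR := (measurableTypeR R).

(** Retracting both variables onto [-a, a] makes the kernel bounded and continuous on the whole
    plane, so Fubini and the linear changes of variables need no care about its domain. *)
Definition extended_kernel (x t : R) : R[i] :=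
  H ((clamp a x + clamp a t) / 2) ((clamp a x - clamp a t) / 2).

Let phi (p : R * R) : R * R :=
  ((clamp a p.1 + clamp a p.2) / 2, (clamp a p.1 - clamp a p.2) / 2).

Let cphi : continuous phi.
Proof.
have c1 (p : R * R) : {for p, continuous (fun p : R * R => clamp a p.1)}.
  by apply: continuous_comp; [exact: cvg_fst|exact: continuous_clamp].
have c2 (p : R * R) : {for p, continuous (fun p : R * R => clamp a p.2)}.
  by apply: continuous_comp; [exact: cvg_snd|exact: continuous_clamp].
move=> p.
have h1 : {for p, continuous (fun p : R * R => (clamp a p.1 + clamp a p.2) / 2)}.
  by apply: cvgM; [apply: cvgD; [exact: c1|exact: c2]|exact: cvg_cst].
have h2 : {for p, continuous (fun p : R * R => (clamp a p.1 - clamp a p.2) / 2)}.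
  by apply: cvgM; [apply: cvgB; [exact: c1|exact: c2]|exact: cvg_cst].
exact: (cvg_pair h1 h2).
Qed.

Lemma continuous_extended_kernel :
  continuous (re (unc extended_kernel)) /\ continuous (im (unc extended_kernel)).
Proof.
have h p : Omega1 a (phi p) by apply: Omega1_rotate; exact: clamp_norm.
split; first exact: (within_continuous_comp Hc.1 cphi h).
exact: (within_continuous_comp Hc.2 cphi h).
Qed.

Lemma extended_kernel_measurable :
  cmeasurable (fun p : mR * mR => extended_kernel p.1 p.2).
Proof.
have [c1 c2] := continuous_extended_kernel.
by split; [have := measurable_continuous2 c1|have := measurable_continuous2 c2].
Qed.

Lemma extended_kernel_bounded : exists B, forall x t, cnorm1 (extended_kernel x t) <= B.
Proof.
have [c1 c2] := continuous_extended_kernel.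
have [m1 h1] := continuous2_bounded a c1; have [m2 h2] := continuous2_bounded a c2.
have cc x : clamp a (clamp a x) = clamp a x by rewrite clamp_id// clamp_norm.
exists (m1 + m2) => x t.
have hx : (`[-a, a] `*` `[-a, a])%classic (clamp a x, clamp a t).
  by split; rewrite /= in_itv/= -ler_norml clamp_norm.
have := h1 _ hx; have := h2 _ hx; rewrite /re /im /unc /extended_kernel /= !cc => g2 g1.
exact: lerD.
Qed.

Lemma extended_kernelE x t : `|x| <= a -> `|t| <= a ->
  extended_kernel x t = goursat_kernel H x t.
Proof. by move=> xa ta; rewrite /extended_kernel !clamp_id. Qed.

End ExtendedKernel.

(** * The integral equation as d'Alembert's formula *)

Section KernelEquation.
Context {R : realType}.
Local Notation mR := (measurableTypeR R).
Local Notation I1 f := (cint (@leb R) setT f).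
Local Notation I2 f := (cint (@leb2 R) setT f).
Local Notation L1R f := (cintegrable (@leb R) setT f).
Local Notation L1R2 f := (cintegrable (@leb2 R) setT f).
Local Notation ind := (@ind R).

Lemma cint_itv_I1 (x y : R) (f : R -> R[i]) :
  cint leb `[x, y] f = I1 (fun s => ind (x <= s <= y) * f s).
Proof. by rewrite cint_mkcond; apply: eq_I1 => s; rewrite mem_setE in_itv. Qed.

Lemma oint_ge0 (x : R) (f : R -> R[i]) : 0 <= x ->
  oint 0 x f = I1 (fun s => ind (0 <= s <= x) * f s).
Proof. by move=> x0; rewrite /oint x0 cint_itv_I1. Qed.

Lemma eq_oint (x y : R) (f g : R -> R[i]) : (forall s, f s = g s) -> oint x y f = oint x y g.
Proof. by move=> fg; congr oint; apply/funext. Qed.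

Lemma ointN (x y : R) (f : R -> R[i]) : L1R f -> oint x y (fun s => - f s) = - oint x y f.
Proof.
move=> If; rewrite !oint_prim1//; last exact: cintegrableN.
have key z : prim1 (fun s => - f s) z = - prim1 f z.
  rewrite /prim1 -cintN; first by apply: eq_I1 => s; rewrite mulrN.
  by apply: cintegrable_bool => //; exact: measurable_le_cst.
by rewrite !key; ring.
Qed.

Lemma oint_reflect (x : R) (f : R -> R[i]) : cmeasurable (f : mR -> _) ->
  oint 0 (- x) f = - oint 0 x (fun s => f (- s)).
Proof.
move=> mf; have key (al be : R) : I1 (fun s => ind (al <= s <= be) * f (- s)) =
    I1 (fun s => ind (- be <= s <= - al) * f s).
  rewrite -[RHS]I1_reflect; first by apply: eq_I1 => s; rewrite lerN2 lerN2 andbC.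
  by apply: cmeasurableM => //; exact: cmeasurable_bool_itv.
rewrite /oint oppr_ge0; have [xp|xn|<-] := ltgtP 0 x.
- by rewrite !cint_itv_I1 key oppr0.
- by rewrite opprK !cint_itv_I1 key; apply: eq_I1 => s; rewrite (oppr0 R).
- by rewrite !oppr0 !cint_set1 oppr0.
Qed.

(* The equation for H, with [k (u + v) (u - v)] for [H u v]. *)
Definition kernel_equation (a : R) (qh : R -> R[i]) (k : R -> R -> R[i]) :=
  forall u v : R, `|u| + `|v| <= a -> k (u + v) (u - v) = 2^-1 * oint 0 u qh +
    oint 0 u (fun al => oint 0 v (fun be => qh (al + be) * k (al + be) (al - be))).

Section Equation.
Context (a B : R) (qh : R -> R[i]) (k : R -> R -> R[i]).
Hypothesis a0 : 0 < a.
Hypotheses (Iq : L1R qh) (mk : cmeasurable (fun p : mR * mR => k p.1 p.2)).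
Hypothesis kB : forall x t, cnorm1 (k x t) <= B.

Let F al be := qh (al + be) * k (al + be) (al - be).

Lemma L1R_characteristic al : L1R (F al).
Proof.
apply: (@cintegrableMr _ _ _ (@leb R) (fun be => qh (al + be)) (fun be => k (al + be) (al - be)) B) => //.
  have := cintegrable_affine al (oner_neq0 R) Iq.
  by congr (cintegrable _ _ _); apply/funext => x; rewrite mul1r addrC.
apply: (@cmeasurable_comp _ _ _ _ _ (fun p : mR * mR => k p.1 p.2)
  (fun be : mR => (al + be : mR, al - be : mR)) mk); apply: measurable_fun_pair.
  by apply: measurable_funD => //; exact: measurable_cst.
by apply: measurable_funB => //; exact: measurable_cst.
Qed.

Lemma L1R_itv (al be : R) : L1R (fun x => ind (al <= x <= be)).
Proof.
have := @bounded_itv_cintegrable R al be 1 (fun=> 1) (cmeasurable_cst _).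
have h x : al <= x <= be -> cnorm1 (1 : R[i]) <= 1 by rewrite (cnorm1_real 1) normr1.
by move=> /(_ h); congr (cintegrable _ _ _); apply/funext => x; rewrite mulr1.
Qed.

(** It is enough to confine one variable: after a shear, qh (al + be) with that indicator is a
    tensor product of integrable functions, and k is bounded. *)
Lemma L1R2_characteristic al be : L1R2 (fun p => ind (al <= p.2 <= be) * F p.1 p.2).
Proof.
have It : L1R2 (fun p : R * R => ind (al <= p.1 <= be) * qh p.2).
  exact: (cintegrable_tensor (L1R_itv al be) Iq).
have := L1R2_swap (L1R2_shear 1 (oner_neq0 R) It) => /= Is.
have mk' : cmeasurable (fun p : mR * mR => k (p.1 + p.2) (p.1 - p.2)).
  apply: (@cmeasurable_comp _ _ _ _ _ (fun p : mR * mR => k p.1 p.2)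
    (fun p : mR * mR => (p.1 + p.2 : mR, p.1 - p.2 : mR)) mk).
  apply: measurable_fun_pair.
    by apply: measurable_funD; [exact: measurable_fst|exact: measurable_snd].
  by apply: measurable_funB; [exact: measurable_fst|exact: measurable_snd].
have := @cintegrableMr _ _ _ _ _ _ B Is mk'.
move=> /(_ (fun p => kB _ _)); congr (cintegrable _ _ _); apply/funext => p.
by rewrite /F !mul1r mulrA.
Qed.

Lemma L1R_oint_characteristic v : L1R (fun al => oint 0 v (F al)).
Proof.
rewrite /oint; case: (0 <= v); last apply: cintegrableN.
- have := L1R_section (L1R2_characteristic 0 v); congr (cintegrable _ _ _).
  by apply/funext => al; rewrite cint_itv_I1.
- have := L1R_section (L1R2_characteristic v 0); congr (cintegrable _ _ _).
  by apply/funext => al; rewrite cint_itv_I1.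
Qed.

(** With u and v both reversed, the single integral changes sign once and the double integral twice;
    the sign of the new kernel restores the first and is carried along in the second. *)
Lemma kernel_equation_reflect : kernel_equation a qh k ->
  kernel_equation a (fun s => qh (- s)) (fun x t => - k (- x) (- t)).
Proof.
move=> E u v uv.
have -> : - (u + v) = (- u) + (- v) by ring.
have -> : - (u - v) = (- u) - (- v) by ring.
rewrite E ?normrN// oint_reflect; last exact: (cintegrable_measurable Iq).
rewrite oint_reflect; last exact: (cintegrable_measurable (L1R_oint_characteristic (- v))).
rewrite mulrN opprD !opprK; apply: (congr1 (GRing.add _)); apply: eq_oint => al.
rewrite oint_reflect; last exact: (cintegrable_measurable (L1R_characteristic (- al))).
rewrite -(ointN _ _ (L1R_reflect (L1R_characteristic (- al)))).
by apply: eq_oint => be; rewrite /F mulrN; congr (- (qh _ * k _ _)); ring.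
Qed.

(** In the coordinates x = u + v, t = u - v the backward cone of (x, t) meets the forward cone of
    the origin in the rectangle [0, (x + t) / 2] x [0, (x - t) / 2], and the Jacobian cancels the
    factor 1/2. The bound s <= a holds throughout it because x <= a. *)
Lemma cone_kernel_rotate (Q : R * R -> R[i]) (x t : R) :
  let P p := ind (`|p.2| <= p.1 <= a) * Q p in L1R2 P -> `|t| <= x <= a ->
  cone_kernel (@sleb2 R) P fst snd x t =
  oint 0 ((x + t) / 2) (fun al => oint 0 ((x - t) / 2) (fun be => Q (al + be, al - be))).
Proof.
move=> P IP /andP[tx xa]; have := tx; rewrite ler_norml => /andP[t1 t2].
pose f p := cone fst snd x t p * P p.
have If : L1R2 f.
  apply: (@cintegrableMl _ _ _ (@leb2 R) P (cone fst snd x t) 1 IP) => //; last exact: cnorm1_cone.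
  exact: (cmeasurable_kernel2 (w := cone fst snd x) (cmeasurable_cone_t measurable_fst measurable_snd x)).
rewrite /cone_kernel -[RHS]/(oint _ _ _) -(I2_rotate If).
have u0 : 0 <= (x + t) / 2 by lra.
have v0 : 0 <= (x - t) / 2 by lra.
rewrite oint_ge0//; apply: eq_I1 => al.
have [h|h] := boolP (0 <= al <= (x + t) / 2); last first.
  rewrite ind0 mul0r (_ : (fun be => _) = fun=> 0) ?cint0//; apply/funext => be.
  rewrite /f /cone /P /= mulrA indM.
  rewrite (_ : _ && _ = false) ?ind0 ?mul0r//; apply/negbTE; apply: contra h.
  by rewrite !ler_norml => /andP[/andP[? ?] /andP[/andP[? ?] ?]]; apply/andP; split; lra.
rewrite ind1 mul1r oint_ge0//; apply: eq_I1 => be.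
rewrite /f /cone /P /= mulrA indM; congr (ind _ * _).
have /andP[h1 h2] := h; rewrite !ler_norml; apply/idP/idP.
  by move=> /andP[/andP[? ?] /andP[/andP[? ?] ?]]; apply/andP; split; lra.
by move=> /andP[? ?]; apply/andP; split; [|apply/andP; split]; try (apply/andP; split); lra.
Qed.

(** A diagonal source (s, s) with s >= 0 lies in the backward cone of (x, t) exactly when s <= (x +
    t) / 2, which gives the single integral; for |t| > x no source is in the cone. *)
Lemma source_kernel_oint (Q : R * R -> R[i]) (x t : R) :
  let P p := ind (`|p.2| <= p.1 <= a) * Q p in L1R2 P -> 0 <= x <= a ->
  source_kernel qh P x t = ind (`|t| <= x) * (2^-1 * oint 0 ((x + t) / 2) qh +
    oint 0 ((x + t) / 2) (fun al => oint 0 ((x - t) / 2) (fun be => Q (al + be, al - be)))).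
Proof.
move=> P IP /andP[x0 xa]; have [tx|xt] := leP `|t| x; last first.
  rewrite ind0 mul0r /source_kernel !cone_kernel_supp ?addr0// => p h.
    by rewrite /P (leNgt `|p.2|) h ind0 mul0r.
  rewrite (_ : 0 <= p = false) ?ind0 ?mul0r//.
  by apply/negbTE; apply: contraTN h => /ger0_norm ->; rewrite ltxx.
rewrite ind1 mul1r /source_kernel cone_kernel_rotate ?tx//; congr (_ + _).
have := tx; rewrite ler_norml => /andP[t1 t2].
rewrite /cone_kernel oint_ge0; last by lra.
congr (_ * _); apply: eq_I1 => s; rewrite mulrA /cone indM; congr (ind _ * _).
rewrite ler_norml; apply/idP/idP.
  by move=> /andP[/andP[? ?] ?]; apply/andP; split; lra.
by move=> /andP[? ?]; apply/andP; split => //; apply/andP; split; lra.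
Qed.

End Equation.
End KernelEquation.

(** * Action of the two kernels on Sobolev functions *)

Section TransmutationRepresentation.
Context {R : realType}.
Local Notation mR := (measurableTypeR R).
Local Notation I1 f := (cint (@leb R) setT f).
Local Notation L1R f := (cintegrable (@leb R) setT f).
Local Notation L1R2 f := (cintegrable (@leb2 R) setT f).
Local Notation ind := (@ind R).
Context (a : R).

(** Normal form of a Sobolev function: value and slope at 0 together with the second derivative,
    extended by 0 beyond [-a, a]. *)
Definition rep (c0 c1 : R[i]) (f : R -> R[i]) (t : R) : R[i] :=
  ind (`|t| <= a) * (c0 + c1 * t%:C + jint f t).

Lemma bool_norm_measurable (c : R) : measurable_fun setT (fun t : mR => `|(t : R)| <= c).
Proof.
by apply: measurable_fun_ler; [exact: normr_measurable|exact: measurable_cst].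
Qed.

Section Rep.
Context (f : R -> R[i]).
Hypotheses (If : L1R f) (fA : forall s, a < `|s| -> f s = 0).

Lemma is_cderive_jint c0 c1 x :
  is_cderive (fun t => c0 + c1 * t%:C + jint f t) x (c1 + (prim1 f x - prim1 f 0)).
Proof.
have := is_cderiveD (is_cderive_affine (c0 - prim2 f 0) (c1 - prim1 f 0) x) (is_cderive_prim2 If fA x).
rewrite -addrA [- _ + _]addrC; congr is_cderive; apply/funext => t.
by rewrite /jint; ring.
Qed.

Lemma rep_bounded c0 c1 : exists c, forall t, cnorm1 (rep c0 c1 f t) <= c.
Proof.
have [m hm] := ccontinuous_bounded (- a) a (is_cderive_ccontinuous (is_cderive_jint c0 c1)).
exists `|m| => t; rewrite /rep; have [ta|_] := leP `|t| a.
  by rewrite ind1 mul1r (le_trans _ (ler_norm _))//; apply: hm; rewrite -ler_norml.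
by rewrite ind0 mul0r cnorm1_0.
Qed.

Lemma L1R_rep c0 c1 : L1R (rep c0 c1 f).
Proof.
have cr := is_cderive_ccontinuous (is_cderive_jint c0 c1).
have [m hm] := ccontinuous_bounded (- a) a cr.
have := bounded_itv_cintegrable (ccontinuous_measurable cr) hm.
by congr (cintegrable _ _ _); apply/funext => t; rewrite /rep ler_norml.
Qed.

Lemma rep_reflect c0 c1 t : rep c0 c1 f (- t) = rep c0 (- c1) (fun s => f (- s)) t.
Proof. by rewrite /rep normrN (jint_reflect If fA) rmorphN/= mulrN mulNr. Qed.

End Rep.

Lemma volt0 (k : R -> R -> R[i]) v : volt k v 0 = 0.
Proof.
rewrite /volt (_ : I1 _ = 0) ?mulr0// -(cint_set1 (fun t => k 0 t * v t) 0) cint_itv_I1.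
apply: eq_I1 => t; rewrite normr0 mulrA; congr (ind _ * _ * _).
by rewrite normr_le0 -eq_le eq_sym.
Qed.

Lemma eq_volt (k : R -> R -> R[i]) (v w : R -> R[i]) x :
  (forall t, `|t| <= `|x| -> v t = w t) -> volt k v x = volt k w x.
Proof.
move=> vw; congr (_ * _); apply: eq_I1 => t.
by have [/vw ->|] := leP `|t| `|x|; rewrite ?ind0 ?mul0r.
Qed.

Section Kernel.
Context (B : R) (qh : R -> R[i]) (k : R -> R -> R[i]).
Hypothesis a0 : 0 < a.
Hypotheses (Iq : L1R qh) (qA : forall s, a < `|s| -> qh s = 0).
Hypotheses (mk : cmeasurable (fun p : mR * mR => k p.1 p.2)) (kB : forall x t, cnorm1 (k x t) <= B).
Hypothesis kE : kernel_equation a qh k.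

Let kT x t := k t x.
Let mkT : cmeasurable (fun p : mR * mR => kT p.1 p.2).
Proof. exact: cmeasurable_swap mk. Qed.
Let kTB x t : cnorm1 (kT x t) <= B. Proof. exact: kB. Qed.

Lemma volt_reflect0 (kk : R -> R -> R[i]) v x :
  cmeasurable (fun p : mR * mR => kk p.1 p.2) -> (forall x t, cnorm1 (kk x t) <= B) -> L1R v ->
  volt kk v (- x) = volt (fun y t => - kk (- y) (- t)) (fun t => v (- t)) x.
Proof.
move=> mkk kkB Iv; have [->|x0] := eqVneq x 0; first by rewrite oppr0 !volt0.
exact: (volt_reflect mkk kkB).
Qed.

Let itv_norm : L1R (fun x : R => ind (`|x| <= a)).
Proof.
by have := L1R_itv (- a) a; congr (cintegrable _ _ _); apply/funext => x; rewrite ler_norml.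
Qed.

Let mtri : cmeasurable (fun p : mR * mR => ind (`|p.2| <= p.1 <= a)).
Proof.
apply: cmeasurable_bool; apply: measurable_and; apply: measurable_fun_ler.
- exact: measurableT_comp.
- exact: measurable_fst.
- exact: measurable_fst.
- exact: measurable_cst.
Qed.

Section Direct.
Let Q (p : R * R) := qh p.1 * k p.1 p.2.
Let P p := ind (`|p.2| <= p.1 <= a) * Q p.
Let w (p : R * R) := ind (`|p.2| <= p.1 <= a) * k p.1 p.2.

Let mw : cmeasurable (w : mR * mR -> _). Proof. exact: cmeasurableM. Qed.
Let wB p : cnorm1 (w p) <= B. Proof. exact: (le_trans (cnorm1_le_boolM _ _)). Qed.

Let PE p : P p = w p * (qh p.1 * ind (`|p.2| <= a)).
Proof.
rewrite /P /Q /w; case: (boolP (`|p.2| <= p.1 <= a)) => [/andP[h1 h2]|_]; last by rewrite ind0 !mul0r.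
by rewrite (le_trans h1 h2) !ind1 mulr1 !mul1r mulrC.
Qed.

Let IP : L1R2 P.
Proof.
rewrite (_ : P = fun p => w p * (qh p.1 * ind (`|p.2| <= a))); last by apply/funext => p; exact: PE.
exact: (cintegrableMl (cintegrable_tensor Iq itv_norm) mw wB).
Qed.

Let Psec y : L1R (fun tau => P (y, tau)).
Proof.
rewrite (_ : (fun _ => _) = fun tau => w (y, tau) * (qh y * ind (`|tau| <= a))); last first.
  by apply/funext => tau; exact: (PE (y, tau)).
apply: (@cintegrableMl _ _ _ (@leb R) _ (fun tau => w (y, tau)) B (cintegrableZ _ itv_norm)) => //.
exact: cmeasurable_pair1.
Qed.

Let PS p : p.1 < `|p.2| -> P p = 0.
Proof. by move=> h; rewrite /P (leNgt `|p.2|) h ind0 mul0r. Qed.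

Let kS x t : 0 <= x <= a -> ind (`|t| <= x) * k x t = source_kernel qh P x t.
Proof.
move=> xa; rewrite (source_kernel_oint qh t IP xa).
have [tx|_] := leP `|t| x; last by rewrite ind0 !mul0r.
have /andP[x0 x1] := xa; have := tx; rewrite ler_norml => /andP[t1 t2].
rewrite !ind1 !mul1r.
rewrite -kE; first by congr k; field.
by rewrite !ger0_norm; lra.
Qed.

(** The density q(s) K(s, tau) depends on the position through K alone, so q y leaves the integral
    over positions and multiplies the operator applied to u. *)
Lemma volt_rep_ge0 (f : R -> R[i]) (c0 c1 : R[i]) x : L1R f ->
  (forall s, a < `|s| -> f s = 0) -> 0 <= x <= a ->
  let u := rep c0 c1 f in
  volt k u x = I1 (fun y => jkernel x y * (ind (`|y| <= a) *
    (qh y * (u y + volt k u y) + volt k f y))).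
Proof.
move=> If fA xa u; have /andP[x0 x1] := xa.
have uE t : `|t| <= x -> u t = (c0 - prim2 f 0) + (c1 - prim1 f 0) * t%:C + prim2 f t.
  by move=> tx; rewrite /u /rep (le_trans tx x1) ind1 mul1r /jint; ring.
rewrite (volt_source_prim2 Iq IP PS Psec kS If fA xa uE).
apply: eq_I1 => y; rewrite /jkernel.
case: (boolP (0 <= y <= x)) => [/andP[y0 yx]|_]; last by rewrite ind0 !mul0r.
rewrite (ger0_norm y0) (le_trans yx x1) !ind1 !mul1r [qh y * (_ + _)]mulrDr.
congr (_ * (_ + _ + _)); rewrite /volt y0 mul1r (ger0_norm y0) -cintZ.
  apply: eq_I1 => t; rewrite /P /Q/= (le_trans yx x1) andbT; ring.
by have := L1R_volt_integrand mk kB y (L1R_rep If fA c0 c1); rewrite (ger0_norm y0).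
Qed.
End Direct.

Section Inverse.
Let Q (p : R * R) := - (qh p.2 * k p.2 p.1).
Let P p := ind (`|p.2| <= p.1 <= a) * Q p.
Let w (p : R * R) := - (ind (`|p.2| <= p.1 <= a) * kT p.1 p.2).

Let mw : cmeasurable (w : mR * mR -> _). Proof. by apply: cmeasurableN; exact: cmeasurableM. Qed.
Let wB p : cnorm1 (w p) <= B. Proof. by rewrite cnorm1N; exact: (le_trans (cnorm1_le_boolM _ _)). Qed.

Let PE p : P p = w p * (ind (`|p.1| <= a) * qh p.2).
Proof.
rewrite /P /Q /w /kT; case: (boolP (`|p.2| <= p.1 <= a)) => [/andP[h1 h2]|_].
  have p0 : 0 <= p.1 by apply: le_trans h1.
  by rewrite (ger0_norm p0) h2 !ind1 !mul1r mulNr mulrC.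
by rewrite ind0 !mul0r oppr0 mul0r.
Qed.

Let IP : L1R2 P.
Proof.
rewrite (_ : P = fun p => w p * (ind (`|p.1| <= a) * qh p.2)); last by apply/funext => p; exact: PE.
exact: (cintegrableMl (cintegrable_tensor itv_norm Iq) mw wB).
Qed.

Let Psec y : L1R (fun tau => P (y, tau)).
Proof.
rewrite (_ : (fun _ => _) = fun tau => w (y, tau) * (ind (`|y| <= a) * qh tau)); last first.
  by apply/funext => tau; exact: (PE (y, tau)).
apply: (@cintegrableMl _ _ _ (@leb R) _ (fun tau => w (y, tau)) B (cintegrableZ _ Iq)) => //.
exact: cmeasurable_pair1.
Qed.

Let PS p : p.1 < `|p.2| -> P p = 0.
Proof. by move=> h; rewrite /P (leNgt `|p.2|) h ind0 mul0r. Qed.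

(** k t x is the left side of the equation at ((x + t) / 2, - (x - t) / 2). The single integral does
    not involve v; reversing the inner variable of the double integral changes its sign and turns al
    + be into the position al - be, whence the density Q. *)
Let kS x t : 0 <= x <= a -> ind (`|t| <= x) * kT x t = source_kernel qh P x t.
Proof.
move=> xa; rewrite (source_kernel_oint qh t IP xa).
have [tx|_] := leP `|t| x; last by rewrite ind0 !mul0r.
have /andP[x0 x1] := xa; have := tx; rewrite ler_norml => /andP[t1 t2].
rewrite !ind1 !mul1r /kT.
have -> : k t x = k ((x + t) / 2 + (- ((x - t) / 2))) ((x + t) / 2 - (- ((x - t) / 2))).
  by congr k; field.
rewrite kE; last by rewrite normrN !ger0_norm; lra.
apply: (congr1 (GRing.add _)); apply: eq_oint => al.
rewrite oint_reflect; last exact: (cintegrable_measurable (L1R_characteristic Iq mk kB al)).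
rewrite -(ointN _ _ (L1R_reflect (L1R_characteristic Iq mk kB al))).
by apply: eq_oint => be; rewrite /Q/= opprK.
Qed.

(** Here q is evaluated at the position of the source, so it stays under the integral and appears as
    the operator applied to q u, with the minus sign of Q. *)
Lemma volt_transpose_rep_ge0 (f : R -> R[i]) (c0 c1 : R[i]) x : L1R f ->
  (forall s, a < `|s| -> f s = 0) -> 0 <= x <= a ->
  let u := rep c0 c1 f in
  volt kT u x = I1 (fun y => jkernel x y * (ind (`|y| <= a) *
    (qh y * u y - volt kT (fun t => qh t * u t) y + volt kT f y))).
Proof.
move=> If fA xa u; have /andP[x0 x1] := xa.
have uE t : `|t| <= x -> u t = (c0 - prim2 f 0) + (c1 - prim1 f 0) * t%:C + prim2 f t.
  by move=> tx; rewrite /u /rep (le_trans tx x1) ind1 mul1r /jint; ring.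
rewrite (volt_source_prim2 Iq IP PS Psec kS If fA xa uE).
apply: eq_I1 => y; rewrite /jkernel.
case: (boolP (0 <= y <= x)) => [/andP[y0 yx]|_]; last by rewrite ind0 !mul0r.
rewrite (ger0_norm y0) (le_trans yx x1) !ind1 !mul1r.
congr (_ * (_ + _ + _)); rewrite /volt y0 mul1r (ger0_norm y0) -cintN.
  apply: eq_I1 => t; rewrite /P /Q/= (le_trans yx x1) andbT /kT; ring.
have [c hc] := rep_bounded If fA c0 c1.
have Iqu : L1R (fun t => qh t * u t).
  exact: (cintegrableMr Iq (cintegrable_measurable (L1R_rep If fA c0 c1)) hc).
by have := L1R_volt_integrand mkT kTB y Iqu; rewrite (ger0_norm y0).
Qed.
End Inverse.
End Kernel.
End TransmutationRepresentation.

Section Operators.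
Context {R : realType}.
Local Notation mR := (measurableTypeR R).
Local Notation I1 f := (cint (@leb R) setT f).
Local Notation L1R f := (cintegrable (@leb R) setT f).
Local Notation ind := (@ind R).
Context (a : R).

Definition cutoff (f : R -> R[i]) (x : R) : R[i] := ind (`|x| <= a) * f x.

Lemma cut_in f x : `|x| <= a -> cutoff f x = f x.
Proof. by move=> xa; rewrite /cutoff xa ind1 mul1r. Qed.

Lemma cut_out f x : a < `|x| -> cutoff f x = 0.
Proof. by move=> xa; rewrite /cutoff leNgt xa ind0 mul0r. Qed.

Lemma L1R_cut_bounded f c : cmeasurable (f : mR -> _) -> (forall x, cnorm1 (f x) <= c) -> L1R (cutoff f).
Proof.
move=> mf fc; have := @bounded_itv_cintegrable R (- a) a c f mf (fun x _ => fc x).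
by congr (cintegrable _ _ _); apply/funext => x; rewrite /cutoff ler_norml.
Qed.

Lemma L1R_cut f : L1R f -> L1R (cutoff f).
Proof. by move=> If; apply: cintegrable_bool => //; exact: bool_norm_measurable. Qed.

Lemma prim1D (f g : R -> R[i]) x : L1R f -> L1R g ->
  prim1 (fun s => f s + g s) x = prim1 f x + prim1 g x.
Proof.
move=> If Ig; rewrite /prim1 -cintD; first by apply: eq_I1 => s; rewrite mulrDr.
  by apply: cintegrable_bool => //; exact: measurable_le_cst.
by apply: cintegrable_bool => //; exact: measurable_le_cst.
Qed.

Lemma jintD (f g : R -> R[i]) x : L1R f -> L1R g ->
  (forall s, a < `|s| -> f s = 0) -> (forall s, a < `|s| -> g s = 0) ->
  jint (fun s => f s + g s) x = jint f x + jint g x.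
Proof.
move=> If Ig fA gA; rewrite /jint prim1D//.
have key y : prim2 (fun s => f s + g s) y = prim2 f y + prim2 g y.
  rewrite /prim2 -cintD; first by apply: eq_I1 => s; rewrite mulrDr.
    exact: (L1R_prim2 If fA).
  exact: (L1R_prim2 Ig gA).
by rewrite !key; ring.
Qed.

Section Kernel.
Context (B : R) (qh : R -> R[i]) (k : R -> R -> R[i]).
Hypothesis a0 : 0 < a.
Hypotheses (Iq : L1R qh) (qA : forall s, a < `|s| -> qh s = 0).
Hypotheses (mk : cmeasurable (fun p : mR * mR => k p.1 p.2)) (kB : forall x t, cnorm1 (k x t) <= B).

Lemma voltB v u x : L1R v -> L1R u -> volt k (fun t => v t - u t) x = volt k v x - volt k u x.
Proof.
move=> Iv Iu; rewrite (voltD mk kB)//; last exact: cintegrableN.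
congr (_ + _); rewrite -[RHS]mulN1r -(voltZ mk kB)//.
by congr volt; apply/funext => t; rewrite mulN1r.
Qed.

Lemma L1R_cut_volt v : L1R v -> L1R (cutoff (volt k v)).
Proof.
move=> Iv; apply: L1R_cut_bounded; first exact: (cmeasurable_volt mk Iv).
by move=> x; exact: (cnorm1_volt mk kB).
Qed.

Lemma kernel_reflect_measurable : cmeasurable (fun p : mR * mR => - k (- p.1) (- p.2)).
Proof.
apply: cmeasurableN; apply: (@cmeasurable_comp _ _ _ _ _ (fun p : mR * mR => k p.1 p.2)
  (fun p : mR * mR => (- p.1 : mR, - p.2 : mR)) mk).
apply: measurable_fun_pair; apply: measurable_funN; [exact: measurable_fst|exact: measurable_snd].
Qed.

Lemma kernel_reflect_bounded x t : cnorm1 (- k (- x) (- t)) <= B.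
Proof. by rewrite cnorm1N. Qed.
End Kernel.

Section Representation.
Context (B : R) (qh : R -> R[i]) (k : R -> R -> R[i]).
Hypothesis a0 : 0 < a.
Hypotheses (Iq : L1R qh) (qA : forall s, a < `|s| -> qh s = 0).
Hypotheses (mk : cmeasurable (fun p : mR * mR => k p.1 p.2)) (kB : forall x t, cnorm1 (k x t) <= B).
Hypothesis kE : kernel_equation a qh k.
Context (f : R -> R[i]) (c0 c1 : R[i]).
Hypotheses (If : L1R f) (fA : forall s, a < `|s| -> f s = 0).
Let u := rep a c0 c1 f.
Let kT x t := k t x.
Let mkT : cmeasurable (fun p : mR * mR => kT p.1 p.2).
Proof. exact: cmeasurable_swap mk. Qed.
Let kTB x t : cnorm1 (kT x t) <= B. Proof. exact: kB. Qed.
Let Iu : L1R u. Proof. exact: L1R_rep. Qed.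
Let fA' s : a < `|s| -> f (- s) = 0. Proof. by move=> h; apply: fA; rewrite normrN. Qed.

Let L1Rq v : cmeasurable (v : mR -> _) -> (exists c, forall x, cnorm1 (v x) <= c) ->
  L1R (fun x => qh x * v x).
Proof. by move=> mv [c hc]; exact: (cintegrableMr Iq mv hc). Qed.

Let uE (x : R) : rep a c0 (- c1) (fun s => f (- s)) x = u (- x).
Proof. by rewrite /u (rep_reflect If fA). Qed.

(** For x < 0 the identity on the half-line is applied at - x to the reflected kernel, potential and
    function; both [volt] and [jint] commute with this reflection. *)
Lemma volt_rep x : `|x| <= a ->
  volt k u x = jint (cutoff (fun y => qh y * (u y + volt k u y) + volt k f y)) x.
Proof.
set F := cutoff _ => xa.
have mv := cmeasurable_volt mk Iu.
have vb := cnorm1_volt mk kB _ Iu.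
have [cu hu] := rep_bounded If fA c0 c1.
have IF : L1R F.
  rewrite (_ : F = fun y => cutoff (fun y => qh y * (u y + volt k u y)) y + cutoff (volt k f) y).
    apply: cintegrableD; last exact: (L1R_cut_volt mk kB If).
    apply: L1R_cut; apply: L1Rq; first by apply: cmeasurableD => //; exact: (cintegrable_measurable Iu).
    by eexists => y; apply: (le_trans (cnorm1D _ _)); apply: lerD; [exact: hu|exact: vb].
  by apply/funext => y; rewrite /F /cutoff mulrDr.
have FA s : a < `|s| -> F s = 0 by exact: cut_out.
have [x0|xn] := leP 0 x.
  have x0a : 0 <= x <= a by rewrite x0 -(ger0_norm x0).
  by rewrite (volt_rep_ge0 Iq mk kB kE)// (jint_pos IF FA).
have x0 : 0 <= - x by lra.
have x0a : 0 <= - x <= a by rewrite x0 -(ger0_norm x0) normrN.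
have FA' s : a < `|s| -> F (- s) = 0 by move=> h; apply: FA; rewrite normrN.
rewrite -[x]opprK -(jint_reflect IF FA) (jint_pos (L1R_reflect IF) FA')//.
rewrite (volt_reflect0 _ mk kB)//.
have eu : (fun t => u (- t)) = rep a c0 (- c1) (fun s => f (- s)) by apply/funext => t; rewrite uE.
have E1 := volt_rep_ge0 (L1R_reflect Iq) (kernel_reflect_measurable mk) (kernel_reflect_bounded kB)
  (kernel_equation_reflect Iq mk kB kE) c0 (- c1) (L1R_reflect If) fA' x0a.
rewrite -eu in E1; apply: (etrans E1) => {E1}.
apply: eq_I1 => y; rewrite /F /cutoff normrN.
by rewrite -(volt_reflect0 _ mk kB Iu) -(volt_reflect0 _ mk kB If).
Qed.

Lemma volt_transpose_rep x : `|x| <= a ->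
  volt kT u x = jint (cutoff (fun y => qh y * u y - volt kT (fun t => qh t * u t) y + volt kT f y)) x.
Proof.
set F := cutoff _ => xa.
have [cu hu] := rep_bounded If fA c0 c1.
have Iqu : L1R (fun y => qh y * u y).
  by apply: L1Rq; [exact: (cintegrable_measurable Iu)|exists cu].
have IF : L1R F.
  rewrite (_ : F = fun y => cutoff (fun y => qh y * u y) y - cutoff (volt kT (fun t => qh t * u t)) y
     + cutoff (volt kT f) y).
    apply: cintegrableD; last exact: (L1R_cut_volt mkT kTB If).
    by apply: cintegrableB; [exact: L1R_cut|exact: (L1R_cut_volt mkT kTB)].
  by apply/funext => y; rewrite /F /cutoff mulrDr mulrBr.
have FA s : a < `|s| -> F s = 0 by exact: cut_out.
have [x0|xn] := leP 0 x.
  have x0a : 0 <= x <= a by rewrite x0 -(ger0_norm x0).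
  by rewrite (volt_transpose_rep_ge0 Iq mk kB kE)// (jint_pos IF FA).
have x0 : 0 <= - x by lra.
have x0a : 0 <= - x <= a by rewrite x0 -(ger0_norm x0) normrN.
have FA' s : a < `|s| -> F (- s) = 0 by move=> h; apply: FA; rewrite normrN.
rewrite -[x]opprK -(jint_reflect IF FA) (jint_pos (L1R_reflect IF) FA')//.
rewrite (volt_reflect0 _ mkT kTB)//.
have eu : (fun t => u (- t)) = rep a c0 (- c1) (fun s => f (- s)) by apply/funext => t; rewrite uE.
have E1 := volt_transpose_rep_ge0 (L1R_reflect Iq) (kernel_reflect_measurable mk) (kernel_reflect_bounded kB)
  (kernel_equation_reflect Iq mk kB kE) c0 (- c1) (L1R_reflect If) fA' x0a.
rewrite -eu in E1; apply: (etrans E1) => {E1}.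
apply: eq_I1 => y; rewrite /F /cutoff normrN.
by rewrite (volt_reflect0 _ mkT kTB Iqu) (volt_reflect0 _ mkT kTB If).
Qed.

End Representation.
End Operators.

(** * Inversion *)

Section MomentUniqueness.
Context {R : realType}.
Local Notation mR := (measurableTypeR R).
Local Notation I1 f := (cint (@leb R) setT f).
Local Notation L1R f := (cintegrable (@leb R) setT f).
Local Notation ind := (@ind R).

Lemma bernoulli_sub (y : R) n : 0 <= y <= 1 -> 1 - n%:R * y <= (1 - y) ^+ n.
Proof.
move=> /andP[y0 y1]; elim: n => [|n IH]; first by rewrite mul0r subr0 expr0.
rewrite exprS; have h : (1 - y) * (1 - n%:R * y) <= (1 - y) * (1 - y) ^+ n.
  by apply: ler_wpM2l IH; rewrite subr_ge0.
apply: le_trans h; rewrite -natr1 mulrDl mul1r.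
have : 0 <= n%:R * y * y by rewrite !mulr_ge0.
lra.
Qed.

Lemma bernoulli_add (y : R) n : 0 <= y -> 1 + n%:R * y <= (1 + y) ^+ n.
Proof.
move=> y0; elim: n => [|n IH]; first by rewrite mul0r addr0 expr0.
rewrite exprS; have h : (1 + y) * (1 + n%:R * y) <= (1 + y) * (1 + y) ^+ n.
  by apply: ler_wpM2l IH; rewrite addr_ge0.
apply: le_trans h; rewrite -natr1 mulrDl mul1r.
have : 0 <= n%:R * y * y by rewrite !mulr_ge0.
lra.
Qed.

(* Stone's polynomials: on [0, 1] they tend boundedly to the indicator of [0, 1/2[. *)
Definition stone (n : nat) (s : R) : R := (1 - s ^+ n) ^+ (2 ^ n).

Lemma stone_itv n s : 0 <= s <= 1 -> 0 <= stone n s <= 1.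
Proof.
move=> /andP[s0 s1]; have y1 : s ^+ n <= 1 by rewrite exprn_ile1.
have y0 : 0 <= s ^+ n by rewrite exprn_ge0.
by rewrite /stone exprn_ge0 ?subr_ge0//= exprn_ile1 ?subr_ge0// lerBlDr lerDl.
Qed.

(** Bernoulli's inequality for (1 - y)^N with y = s^n and N = 2^n: the defect N y = (2 s)^n tends to
    0 since 2 s < 1. *)
Lemma stone_cvg1 s : 0 <= s -> s < 2^-1 -> stone n s @[n --> \oo] --> (1 : R).
Proof.
move=> s0 s1.
have z : (fun n => 1 - (2 * s) ^+ n) @ \oo --> (1 : R).
  rewrite -[X in _ --> X]subr0; apply: cvgB; first exact: cvg_cst.
  by apply: cvg_expr; rewrite ger0_norm ?mulr_ge0//; lra.
have s01 : 0 <= s <= 1 by apply/andP; split => //; lra.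
have h : \forall n \near \oo, 1 - (2 * s) ^+ n <= stone n s <= 1.
  near=> n.
  have [_ -> ] := andP (stone_itv n s01); rewrite andbT.
  rewrite exprMn -natrX; apply: bernoulli_sub.
  by rewrite exprn_ge0//= exprn_ile1//; case/andP: s01.
apply: (squeeze_cvgr h z); exact: cvg_cst.
Unshelve. all: by end_near. Qed.

(** With y = s^n and N = 2^n, (1 - y)^N (1 + y)^N <= 1, while (1 + y)^N >= N y = (2 s)^n, which
    tends to infinity since 2 s > 1. *)
Lemma stone_cvg0 s : 2^-1 < s -> s <= 1 -> stone n s @[n --> \oo] --> (0 : R).
Proof.
move=> s0 s1; have sp : 0 < s by lra.
have z : (fun n => ((2 * s)^-1) ^+ n) @ \oo --> (0 : R).
  apply: cvg_expr; rewrite ger0_norm ?invr_ge0 ?mulr_ge0 ?(ltW sp)//.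
  by rewrite invf_lt1; lra.
have s01 : 0 <= s <= 1 by apply/andP; split => //; exact: ltW.
suff h : \forall n \near \oo, 0 <= stone n s <= (2 * s)^-1 ^+ n.
  by apply: (squeeze_cvgr h) z; exact: cvg_cst.
near=> n.
have [-> _] := andP (stone_itv n s01) => /=.
have y0 : 0 <= s ^+ n by rewrite exprn_ge0// ltW.
have y1 : s ^+ n <= 1 by rewrite exprn_ile1// ltW.
have p0 : 0 < (2 * s) ^+ n by rewrite exprn_gt0// mulr_gt0.
rewrite exprVn -[X in _ <= X]mul1r ler_pdivlMr//.
have h : (2 * s) ^+ n <= (1 + s ^+ n) ^+ (2 ^ n).
  by apply: le_trans (bernoulli_add _ y0); rewrite exprMn natrX lerDr.
apply: (@le_trans _ _ (stone n s * (1 + s ^+ n) ^+ (2 ^ n))).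
  by apply: ler_wpM2l => //; case/andP: (stone_itv n s01).
rewrite /stone -exprMn exprn_ile1//; first by rewrite mulr_ge0 ?subr_ge0// addr_ge0.
have : 0 <= s ^+ n * s ^+ n by rewrite mulr_ge0.
nra.
Unshelve. all: by end_near. Qed.

Lemma continuous_horner (p : {poly R}) : continuous (fun t : R => p.[t]).
Proof.
elim/poly_ind: p => [|p c IH] t; first by under eq_fun do rewrite horner0; exact: cvg_cst.
under eq_fun do rewrite hornerMXaddC.
by apply: cvgD; [apply: cvgM; [exact: IH|exact: cvg_id]|exact: cvg_cst].
Qed.

Section Moments.
Context (a C : R) (e : R -> R[i]).
Hypothesis a0 : 0 < a.
Hypotheses (me : cmeasurable (e : mR -> _)) (eC : forall t, cnorm1 (e t) <= C).
Hypothesis eA : forall t, a < `|t| -> e t = 0.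
Hypothesis moments : forall n, I1 (fun t => e t * (t ^+ n)%:C) = 0.

Lemma L1R_bounded_supp g c : cmeasurable (g : mR -> _) -> (forall t, `|t| <= a -> cnorm1 (g t) <= c) ->
  L1R (fun t => e t * g t).
Proof.
move=> mg gc; have := @bounded_itv_cintegrable R (- a) a (C * c) (fun t => e t * g t) (cmeasurableM me mg).
have h t : - a <= t <= a -> cnorm1 (e t * g t) <= C * c.
  move=> ta; apply: (le_trans (cnorm1M _ _)).
  by apply: ler_pM; rewrite ?cnorm1_ge0//; apply: gc; rewrite ler_norml.
move=> /(_ h); congr (cintegrable _ _ _); apply/funext => t; rewrite -ler_norml.
by have [_|/eA ->] := leP `|t| a; rewrite ?ind1 ?mul1r// !(mul0r, mulr0).
Qed.

Lemma L1R_poly (p : {poly R}) : L1R (fun t => e t * (p.[t])%:C).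
Proof.
have cp : ccontinuous (fun t : R => (p.[t])%:C).
  by split; [exact: continuous_horner|move=> t; exact: cvg_cst].
have [c hc] := ccontinuous_bounded (- a) a cp.
by apply: (L1R_bounded_supp (c := c)) (ccontinuous_measurable cp) _ => t; rewrite ler_norml; exact: hc.
Qed.

(** Induction on the Horner form; the auxiliary factor X^m takes up the X split off at each step. *)
Lemma poly_moment (p : {poly R}) : I1 (fun t => e t * (p.[t])%:C) = 0.
Proof.
suff h m : I1 (fun t => e t * (('X^m * p).[t])%:C) = 0.
  by rewrite -(h 0%N); apply: eq_I1 => t; rewrite expr0 mul1r.
elim/poly_ind: p m => [|p c IH] m.
  transitivity (I1 (fun=> 0)); last exact: cint0.
  by apply: eq_I1 => t; rewrite hornerM horner0 mulr0 mulr0.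
transitivity (I1 (fun t => e t * (('X^(m.+1) * p).[t])%:C + c%:C * (e t * (('X^m : {poly R}).[t])%:C))).
  by apply: eq_I1 => t; rewrite !hornerE /=  !rmorphM !rmorphD/= !rmorphM/= !rmorphXn exprS; ring.
rewrite cintD; [|exact: L1R_poly|by apply: cintegrableZ; exact: L1R_poly].
rewrite IH cintZ; last exact: L1R_poly.
rewrite (_ : I1 _ = I1 (fun t => e t * (t ^+ m)%:C)); first by rewrite moments mulr0 addr0.
by apply: eq_I1 => t; rewrite hornerXn.
Qed.

(** Sends c to 1/2 and, as |t - c| <= 2 a, all of [-a, a] into [0, 1]. *)
Let sarg (c t : R) := (t - c) * (4 * a)^-1 + 2^-1.

Let stone_poly c n : exists p : {poly R}, forall t, p.[t] = stone n (sarg c t).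
Proof.
exists ((1 - (('X - c%:P) * ((4 * a)^-1)%:P + (2^-1)%:P) ^+ n) ^+ (2 ^ n)) => t.
by rewrite /stone /sarg !hornerE.
Qed.

Let sarg_itv c t : `|c| <= a -> `|t| <= a -> 0 <= sarg c t <= 1.
Proof.
move=> ca ta; have h : `|t - c| <= 2 * a by apply: (le_trans (ler_normB _ _)); lra.
have d : `|(t - c) * (4 * a)^-1| <= 2^-1.
  rewrite normrM [`|_^-1|]ger0_norm ?invr_ge0 ?mulr_ge0 ?(ltW a0)//.
  by rewrite ler_pdivrMr ?mulr_gt0//; lra.
by move: d; rewrite /sarg ler_norml; lra.
Qed.

(** The Stone polynomials in [sarg c] approximate the indicator of t <= c boundedly on [-a, a],
    except at t = c. Their pairings with e vanish, so dominated convergence forces the integral of e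
    up to c to vanish. *)
Lemma prim1_moment0 c : `|c| <= a -> prim1 e c = 0.
Proof.
move=> ca; pose f n (t : mR) : R := if `|(t : R)| <= a then stone n (sarg c t) else 0.
pose g (t : mR) : R := if (`|(t : R)| <= a) && ((t : R) <= c) then 1 else 0.
have mf n : measurable_fun setT (f n).
  apply: measurable_fun_ifT => //; first exact: bool_norm_measurable.
  have [p hp] := stone_poly c n.
  rewrite (_ : (fun x => _) = fun t => p.[t]); last by apply/funext => t; rewrite hp.
  by apply: continuous_measurable_fun; exact: continuous_horner.
have mg : measurable_fun setT g.
  apply: measurable_fun_ifT => //; apply: measurable_and; first exact: bool_norm_measurable.
  exact: measurable_le_cst.
have fg_ae : {ae leb, forall t : mR, setT t -> (EFin \o f n) t @[n --> \oo] --> (EFin \o g) t}.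
  exists [set c]; split; [exact: measurable_set1|exact: lebesgue_measure_set1|].
  move=> t /= ht; apply: contrapT => tc; apply: ht => _.
  apply: cvg_EFin; first by near=> n.
  rewrite /f /g; have [ta|_] := leP `|(t : R)| a; last exact: cvg_cst.
  have st := sarg_itv ca ta; have /andP[s0 s1] := st.
  have i0 : 0 < (4 * a)^-1 by rewrite invr_gt0 mulr_gt0.
  have [tlt|tgt|/tc//] := ltgtP (t : R) c.
    apply: stone_cvg1 => //; rewrite /sarg gtrDr nmulr_rlt0 //; last by rewrite subr_lt0.
  apply: stone_cvg0 => //; rewrite /sarg ltrDr mulr_gt0// subr_gt0//.
have Ia : (@leb R).-integrable setT (EFin \o (fun t : mR => (\1_(`[-a, a]%classic) t : R))).
  exact: integrable_indic_itv.
have dom : {ae leb, forall (t : mR) n, setT t -> (`|(EFin \o f n) t| <= (EFin \o (fun t : mR => (\1_(`[(-a)%R, a]%classic) t : R))) t)%E}.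
  apply: aeW => t n _; rewrite /= lee_fin /f indicE mem_setE in_itv/= -ler_norml.
  case: ifP => ta; last by rewrite normr0.
  by have /andP[h1 h2] := stone_itv n (sarg_itv ca ta); rewrite ger0_norm.
have mfE n : measurable_fun setT (EFin \o f n) by exact/measurable_EFinP.
have mgE : measurable_fun setT (EFin \o g) by exact/measurable_EFinP.
have [Ig lim0 _] := dominated_convergence measurableT mfE mgE fg_ae Ia dom.
have C0 : 0 <= C by apply: le_trans (eC 0); exact: cnorm1_ge0.
have bound n : cnorm1 (prim1 e c) <= C * \int[leb]_t `|f n t - g t|.
  have fb t : cnorm1 ((f n t)%:C : R[i]) <= 1.
    rewrite cnorm1_real /f; case: ifP => [ta|_]; last by rewrite normr0.
    by have /andP[h1 h2] := stone_itv n (sarg_itv ca ta); rewrite ger0_norm.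
  have gb t : cnorm1 ((g t)%:C : R[i]) <= 1.
    by rewrite cnorm1_real /g; case: ifP; rewrite ?normr1 ?normr0.
  have If : L1R (fun t => e t * (f n t)%:C).
    exact: (L1R_bounded_supp (cmeasurable_real (mf n)) (fun t _ => fb t)).
  have Ige : L1R (fun t => e t * (g t)%:C).
    exact: (L1R_bounded_supp (cmeasurable_real mg) (fun t _ => gb t)).
  have -> : prim1 e c = I1 (fun t => e t * (g t)%:C - e t * (f n t)%:C).
    rewrite cintB//.
    have [p hp] := stone_poly c n.
    rewrite (_ : I1 (fun t => e t * (f n t)%:C) = 0); last first.
      rewrite -(poly_moment p); apply: eq_I1 => t; rewrite /f hp.
      by have [//|/eA ->] := leP `|t| a; rewrite !mul0r.
    rewrite subr0; apply: eq_I1 => t; rewrite /g mulrC.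
    have [ta|/eA ->] := leP `|t| a; last by rewrite !mul0r.
    by case: (t <= c); rewrite ?ind1 ?ind0.
  have Ir : (@leb R).-integrable setT (EFin \o (fun t => `|f n t - g t|)).
    apply: (@le_integrable _ _ _ _ _ measurableT _ (EFin \o (fun t : mR => 2 * (\1_(`[(-a)%R, a]%classic) t : R)))).
    - apply/measurable_EFinP; apply: measurableT_comp => //; exact: measurable_funB.
    - move=> t _; rewrite /= lee_fin normr_id indicE mem_setE in_itv/= -ler_norml.
      rewrite /f /g; case: ifP => ta /=; last by rewrite subrr normr0 mulr0 normr0.
      have /andP[h1 h2] := stone_itv n (sarg_itv ca ta).
      rewrite mulr1 [leRHS]ger0_norm// ler_norml.
      by case: (_ <= c) => /=; apply/andP; split; lra.
    - exact: (integrableZl measurableT 2 Ia).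
  have h t : cnorm1 (e t * (g t)%:C - e t * (f n t)%:C) <= C * `|f n t - g t|.
    rewrite -mulrBr -rmorphB/=; apply: (le_trans (cnorm1M _ _)).
    by rewrite cnorm1_real distrC; apply: ler_wpM2r.
  have Ic := integrableZl measurableT C Ir.
  apply: (le_trans (cnorm1_cint_le (cintegrableB Ige If) Ic h)).
  by rewrite RintegralZl.
apply: cnorm1_eq0; rewrite leNgt; apply/negP => np.
have dn : (fun n => \int[leb]_t `|f n t - g t|) @ \oo --> (0 : R).
  exact: (fine_cvg lim0).
have ep : 0 < cnorm1 (prim1 e c) / (C + 1) by rewrite divr_gt0//; lra.
near \oo => n.
have := bound n; rewrite leNgt => /negP; apply.
have h : \int[leb]_t `|f n t - g t| < cnorm1 (prim1 e c) / (C + 1).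
  by near: n; apply: (cvgr_lt _ dn).
have h0 : 0 <= \int[leb]_t `|f n t - g t| by apply: Rintegral_ge0.
move: h; rewrite ltr_pdivlMr; last by lra.
by apply: le_lt_trans; rewrite mulrC; apply: ler_wpM2l => //; lra.
Unshelve. all: by end_near. Qed.

(** All integrals of e up to a point vanish, so e is 0 almost everywhere by Lebesgue's
    differentiation theorem. *)
Lemma cint_moment0 (f : R -> R[i]) : L1R f -> I1 (fun t => e t * f t) = 0.
Proof.
have aeF := ae_filter_ringOfSetsType (@leb R).
move=> If; have Ie : L1R e.
  have := L1R_bounded_supp (cmeasurable_cst (1 : R[i])) (fun t _ => lexx _).
  by congr (cintegrable _ _ _); apply/funext => t; rewrite mulr1.
have p0 c : prim1 e c = 0.
  have [ca|] := leP `|c| a; first exact: prim1_moment0.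
  have [cp|cn] := leP 0 c => ca.
    transitivity (prim1 e a); last by apply: prim1_moment0; rewrite ger0_norm ?lexx // ltW.
    apply: eq_I1 => t; have [ta|/eA ->] := leP `|t| a; last by rewrite !mulr0.
    by move: ta; rewrite ler_norml => /andP[_ ta]; rewrite ta (le_trans ta)// ltW// -(ger0_norm cp).
  transitivity (I1 (fun=> 0)); last exact: cint0.
  apply: eq_I1 => t; have [ta|/eA ->] := leP `|t| a; last by rewrite mulr0.
  move: ta; rewrite ler_norml => /andP[ta _].
  rewrite (_ : t <= c = false) ?ind0 ?mul0r//; apply/negbTE; rewrite -ltNge.
  by apply: lt_le_trans ta; move: ca; rewrite ltr0_norm; lra.
have key (r : mR -> R) : (@leb R).-integrable setT (EFin \o r) ->
    (forall c, \int[leb]_(s in `]-oo, c]) r s = 0) -> {ae @leb R, forall t, r t = 0}.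
  move=> Ir r0; have loc : locally_integrable setT (r : R -> R).
    by apply: open_integrable_locally Ir; exact: openT.
  have iy (y : R) : (@leb R).-integrable `]-oo, y] (EFin \o r) by apply: integrableS Ir.
  have := @FTC1Ny R r iy loc.
  apply: filterS => t [_].
  rewrite (_ : (fun _ => _) = fun=> 0); last by apply/funext => y; exact: r0.
  by rewrite derive1_cst.
have e' (z : R) : prim1 e z = cint leb `]-oo, z] e.
  by rewrite [RHS]cint_mkcond; apply: eq_I1 => s; rewrite mem_setE in_itv.
have [I1e I2e] := Ie.
have ae1 : {ae @leb R, forall t, re e t = 0}.
  by apply: key => // c; have := p0 c; rewrite e' => /(congr1 (@complex.Re R)).
have ae2 : {ae @leb R, forall t, im e t = 0}.
  by apply: key => // c; have := p0 c; rewrite e' => /(congr1 (@complex.Im R)).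
have mf := cintegrable_measurable If.
have [m1 m2] := cmeasurableM me mf.
have z (r : mR -> R) : measurable_fun setT r -> {ae @leb R, forall t, r t = 0} -> \int[leb]_t r t = 0.
  move=> mr r0; rewrite /Rintegral (ae_eq_integral (cst 0%E))//.
  - by rewrite integral0.
  - exact/measurable_EFinP.
  - by move: r0; apply: filterS => t rt _; rewrite /= rt.
apply: complex_eqP => /=; apply: z => //.
- by move: ae1 ae2; apply: filterS2 => t h1 h2; rewrite /re cReM -/(re e t) -/(im e t) h1 h2 !mul0r subrr.
- by move: ae1 ae2; apply: filterS2 => t h1 h2; rewrite /im cImM -/(re e t) -/(im e t) h1 h2 !mul0r addr0.
Qed.

End Moments.
End MomentUniqueness.

(** * The operators T and S on the line and their composition *)

Section InverseOperators.
Context {R : realType}.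
Local Notation mR := (measurableTypeR R).
Local Notation I1 f := (cint (@leb R) setT f).
Local Notation L1R f := (cintegrable (@leb R) setT f).
Local Notation ind := (@ind R).
Context (a B : R) (qh : R -> R[i]) (k : R -> R -> R[i]).
Hypothesis a0 : 0 < a.
Hypotheses (Iq : L1R qh) (qA : forall s, a < `|s| -> qh s = 0).
Hypotheses (mk : cmeasurable (fun p : mR * mR => k p.1 p.2)) (kB : forall x t, cnorm1 (k x t) <= B).

Let kT x t := k t x.
Let mkT : cmeasurable (fun p : mR * mR => kT p.1 p.2).
Proof. exact: cmeasurable_swap mk. Qed.
Let kTB x t : cnorm1 (kT x t) <= B. Proof. exact: kB. Qed.

(** T and the claimed inverse S, cut off to [-a, a] so that they act on integrable functions on the
    whole line and can be composed. *)
Definition top (v : R -> R[i]) : R -> R[i] := cutoff a (fun x => v x + volt k v x).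
Definition sop (v : R -> R[i]) : R -> R[i] := cutoff a (fun x => v x - volt kT v x).

Lemma L1R_top v : L1R v -> L1R (top v).
Proof.
move=> Iv; rewrite (_ : top v = fun x => cutoff a v x + cutoff a (volt k v) x).
  by apply: cintegrableD; [exact: L1R_cut|exact: (L1R_cut_volt _ mk kB)].
by apply/funext => x; rewrite /top /cutoff mulrDr.
Qed.

Lemma L1R_sop v : L1R v -> L1R (sop v).
Proof.
move=> Iv; rewrite (_ : sop v = fun x => cutoff a v x - cutoff a (volt kT v) x).
  by apply: cintegrableB; [exact: L1R_cut|exact: (L1R_cut_volt _ mkT kTB)].
by apply/funext => x; rewrite /sop /cutoff mulrBr.
Qed.

Lemma top_out v x : a < `|x| -> top v x = 0. Proof. exact: cut_out. Qed.
Lemma sop_out v x : a < `|x| -> sop v x = 0. Proof. exact: cut_out. Qed.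

Section RepOperators.
Hypothesis kE : kernel_equation a qh k.
Context (f : R -> R[i]) (c0 c1 : R[i]).
Hypotheses (If : L1R f) (fA : forall s, a < `|s| -> f s = 0).
Let u := rep a c0 c1 f.
Let Iu : L1R u. Proof. exact: L1R_rep. Qed.
Let Iqu : L1R (fun y => qh y * u y).
Proof.
have [c hc] := rep_bounded If fA c0 c1.
exact: (cintegrableMr Iq (cintegrable_measurable Iu) hc).
Qed.
Let top_bounded : exists c, forall x, cnorm1 (top u x) <= c.
Proof.
have [c hc] := rep_bounded If fA c0 c1.
exists (c + B * \int[leb]_t cnorm1 (u t)) => x.
apply: (le_trans (cnorm1_le_boolM _ _)); apply: (le_trans (cnorm1D _ _)).
by apply: lerD; [exact: hc|exact: (cnorm1_volt mk kB)].
Qed.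

Lemma L1R_mul_top : L1R (fun y => qh y * top u y).
Proof.
have [c hc] := top_bounded.
exact: (cintegrableMr Iq (cintegrable_measurable (L1R_top Iu)) hc).
Qed.

(** In [volt_rep] the double primitive contains q (T u) plus the Volterra part of T f; adding u
    contributes the missing f. *)
Lemma top_rep : top u = rep a c0 c1 (fun y => qh y * top u y + top f y).
Proof.
apply/funext => x; have [xa|xa] := leP `|x| a; last by rewrite top_out// /rep leNgt xa ind0 mul0r.
rewrite /top (cut_in _ xa) /rep xa ind1 mul1r (volt_rep Iq mk kB kE c0 c1 If fA xa) -/u.
set F := cutoff a _.
rewrite {1}/u /rep xa ind1 mul1r -addrA; congr (_ + _).
have FE y : F y = (qh y * top u y + top f y) - f y.
  rewrite /F /top /cutoff; have [ya|ya] := leP `|y| a; first by rewrite !ind1 !mul1r /=; ring.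
  by rewrite !ind0 !mul0r mulr0 fA// subr0 addr0.
have IF : L1R F.
  rewrite (_ : F = fun y => (qh y * top u y + top f y) - f y); last by apply/funext.
  by apply: cintegrableB => //; apply: cintegrableD; [exact: L1R_mul_top|exact: L1R_top].
rewrite -(jintD x If IF fA); last by move=> s h; exact: cut_out.
by apply: (congr1 (fun f => jint f x)); apply/funext => y; rewrite FE addrC subrK.
Qed.

(** By [volt_transpose_rep] the function under J is f - q u minus the Volterra operator applied to f
    - q u, that is, S (f - q u). *)
Lemma sop_rep : sop u = rep a c0 c1 (sop (fun y => f y - qh y * u y)).
Proof.
apply/funext => x; have [xa|xa] := leP `|x| a; last by rewrite sop_out// /rep leNgt xa ind0 mul0r.
rewrite /sop (cut_in _ xa) [RHS]/rep xa ind1 mul1r (volt_transpose_rep Iq mk kB kE c0 c1 If fA xa) -/u.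
set F := cutoff a _; set G := cutoff a _.
rewrite {1}/u /rep xa ind1 mul1r -addrA; congr (_ + _).
have GE y : G y = f y - F y.
  rewrite /F /G /cutoff; have [ya|ya] := leP `|y| a; last by rewrite !ind0 !mul0r fA// subrr.
  rewrite !ind1 !mul1r (voltB mkT kTB)//. rewrite /=; ring.
have IG : L1R G by apply: L1R_sop; exact: cintegrableB.
have IF : L1R F.
  rewrite (_ : F = fun y => f y - G y); last by apply/funext => y; rewrite GE; ring.
  exact: cintegrableB.
have GA s : a < `|s| -> G s = 0 by exact: cut_out.
have FA s : a < `|s| -> F s = 0 by exact: cut_out.
apply/eqP; rewrite subr_eq -(jintD x IG IF GA FA).
by apply/eqP; apply: (congr1 (fun f => jint f x)); apply/funext => y; rewrite GE subrK.
Qed.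
End RepOperators.

(** [sop_rep] is applied to T u, whose second derivative is q (T u) + T f by [top_rep]; the
    potential cancels and S (T f) = f is left under J. *)
Lemma sop_top_rep (f : R -> R[i]) (c0 c1 : R[i]) : kernel_equation a qh k ->
  L1R f -> (forall s, a < `|s| -> f s = 0) -> sop (top f) = f ->
  sop (top (rep a c0 c1 f)) = rep a c0 c1 f.
Proof.
move=> kE If fA STf; have TE := top_rep kE c0 c1 If fA.
set u := rep a c0 c1 f in TE *.
set w := (fun y => qh y * top u y + top f y) in TE.
have Iw : L1R w.
  by apply: cintegrableD; [exact: (L1R_mul_top c0 c1 If fA)|exact: L1R_top].
have wA s : a < `|s| -> w s = 0 by move=> h; rewrite /w !top_out// mulr0 addr0.
rewrite {1}TE (sop_rep kE c0 c1 Iw wA) -TE /u -[in RHS]STf; congr (rep _ _ _ (sop _)).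
by apply/funext => y; rewrite /w addrAC subrr add0r.
Qed.

(** Orientation and range of integration are absorbed into the kernel, so that composition of the
    operators is an instance of [fubini_kernel]. *)
Definition volt_kernel (kk : R -> R -> R[i]) x t : R[i] :=
  (if 0 <= x then 1 else -1) * (ind (`|t| <= `|x|) * kk x t).

Section VoltKernel.
Context (kk : R -> R -> R[i]).
Hypotheses (mkk : cmeasurable (fun p : mR * mR => kk p.1 p.2)) (kkB : forall x t, cnorm1 (kk x t) <= B).

Lemma volt_kernel_measurable : cmeasurable (fun p : mR * mR => volt_kernel kk p.1 p.2).
Proof.
apply: cmeasurableM; last first.
  apply: cmeasurableM => //; apply: cmeasurable_bool; apply: measurable_fun_ler; exact: measurableT_comp.
rewrite (_ : (fun p => _) = (fun p : mR * mR => ind (0 <= (p.1 : R)) - ind (~~ (0 <= (p.1 : R))))).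
  by apply: cmeasurableB; apply: cmeasurable_bool; [|apply: measurable_neg];
    apply: measurable_fun_ler; (exact: measurable_cst || exact: measurable_fst).
by apply/funext => p; case: (0 <= _); rewrite ?ind1 ?ind0 ?subr0 ?sub0r.
Qed.

Lemma volt_kernel_bounded x t : cnorm1 (volt_kernel kk x t) <= B.
Proof.
rewrite /volt_kernel; apply: le_trans (kkB x t); apply: le_trans (cnorm1_le_boolM _ _).
by case: ifP => _; rewrite ?mul1r// mulN1r cnorm1N.
Qed.

Lemma volt_kernelE v x : L1R v -> volt kk v x = I1 (fun t => volt_kernel kk x t * v t).
Proof.
move=> Iv; rewrite /volt -cintZ; last exact: (L1R_volt_integrand mkk kkB).
by apply: eq_I1 => t; rewrite /volt_kernel !mulrA.
Qed.
End VoltKernel.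

(* [S T - 1] is an integral operator with a bounded kernel. *)
Lemma error_kernel x : exists e : R -> R[i], [/\ cmeasurable (e : mR -> _),
  exists C, forall t, cnorm1 (e t) <= C, forall t, a < `|t| -> e t = 0 &
  forall v, L1R v -> (forall s, a < `|s| -> v s = 0) ->
    sop (top v) x - cutoff a v x = I1 (fun t => e t * v t)].
Proof.
have m1 := volt_kernel_measurable mk; have m2 := volt_kernel_measurable mkT.
have b1 := volt_kernel_bounded kB; have b2 := volt_kernel_bounded kTB.
pose g s := volt_kernel kT x s * ind (`|s| <= a).
have mg : cmeasurable (g : mR -> _).
  apply: cmeasurableM; first exact: (cmeasurable_kernel2 m2 x).
  by apply: cmeasurable_bool; exact: bool_norm_measurable.
have Ig : L1R g.
  have := L1R_cut_bounded a (cmeasurable_kernel2 m2 x) (fun t => b2 x t).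
  by congr (cintegrable _ _ _); apply/funext => s; rewrite /g /cutoff mulrC.
(* Kernel at (x, t) of the product V' V of the Volterra parts of S and T; the intermediate variable
   s is confined to [-a, a] in [g]. *)
pose h t := I1 (fun s => volt_kernel k s t * g s).
(* From (1 - V') (1 + V) - 1 = V - V' - V' V, restricted to [-a, a] in both variables. *)
pose e t := ind ((`|t| <= a) && (`|x| <= a)) * (volt_kernel k x t - volt_kernel kT x t - h t).
have mh : cmeasurable (h : mR -> _).
  apply: (@cmeasurable_cint_kernel _ _ _ _ _ (@sleb R) (fun t s => volt_kernel k s t) _ g mg).
  exact: (cmeasurable_swap m1).
have hb t : cnorm1 (h t) <= B * \int[leb]_s cnorm1 (g s).
  apply: (@cnorm1_kernel _ _ _ _ _ (@sleb R) (fun t s => volt_kernel k s t) B _ _ t g Ig) => //.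
  exact: (cmeasurable_swap m1).
exists e; split.
- apply: cmeasurableM.
    apply: cmeasurable_bool; apply: measurable_and; first exact: bool_norm_measurable.
    exact: measurable_cst.
  apply: cmeasurableB => //; apply: cmeasurableB.
    exact: (cmeasurable_kernel2 m1 x).
  exact: (cmeasurable_kernel2 m2 x).
- eexists => t; apply: (le_trans (cnorm1_le_boolM _ _)).
  apply: (le_trans (cnorm1D _ _)); rewrite cnorm1N.
  apply: lerD; last exact: hb.
  apply: (le_trans (cnorm1D _ _)); rewrite cnorm1N.
  by apply: lerD; [exact: b1|exact: b2].
- by move=> t ta; rewrite /e (leNgt `|t|) ta ind0 mul0r.
move=> v Iv vA; have [xa|xa] := leP `|x| a; last first.
  rewrite /sop !cut_out// subrr; symmetry; transitivity (I1 (fun=> 0)); last exact: cint0.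
  by apply: eq_I1 => t; rewrite /e (leNgt `|x|) xa andbF ind0 !mul0r.
have Icv := L1R_cut_volt a mk kB Iv.
rewrite /sop !(cut_in _ xa) {1}/top (cut_in _ xa).
have -> : volt kT (top v) x = volt kT v x + volt kT (cutoff a (volt k v)) x.
  rewrite -(voltD mkT kTB)//; apply: eq_volt => t tx.
  by rewrite /top !(cut_in _ (le_trans tx xa)).
have I2v : L1R (fun t => volt_kernel k x t * v t) by exact: (@cintegrable_kernel _ _ _ _ _ (@sleb R) _ _ m1 b1).
have I3v : L1R (fun t => volt_kernel kT x t * v t) by exact: (@cintegrable_kernel _ _ _ _ _ (@sleb R) _ _ m2 b2).
have I4v : L1R (fun t => h t * v t) by exact: (cintegrableMl Iv mh hb).
have E4 : volt kT (cutoff a (volt k v)) x = I1 (fun t => h t * v t).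
  rewrite (volt_kernelE mkT kTB)//.
  rewrite -(@fubini_kernel _ _ _ _ _ (@sleb R) (@sleb R) (volt_kernel k) B m1 b1 g v Ig Iv).
  apply: eq_I1 => s; rewrite /cutoff /g (volt_kernelE mk kB)//.
  by rewrite mulrA mulrC.
rewrite (volt_kernelE mk kB)// (volt_kernelE mkT kTB)// E4.
have -> : I1 (fun t => e t * v t) = I1 (fun t => volt_kernel k x t * v t - volt_kernel kT x t * v t - h t * v t).
  apply: eq_I1 => t; rewrite /e xa andbT.
  by have [_|/vA ->] := leP `|t| a; rewrite ?ind1 ?mulr0 ?subr0// mul1r !mulrBl.
rewrite cintB//; last exact: cintegrableB.
by rewrite cintB//; ring.
Qed.

End InverseOperators.

(** * S is a left inverse and a right inverse of T *)

Section Inversion.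
Context {R : realType}.
Local Notation mR := (measurableTypeR R).
Local Notation I1 f := (cint (@leb R) setT f).
Local Notation L1R f := (cintegrable (@leb R) setT f).
Local Notation ind := (@ind R).

Section C2Representation.
Context (a : R) (a0 : 0 < a).

Lemma oint_FTC (g h : R -> R[i]) x y : (forall x, is_cderive g x (h x)) -> ccontinuous h ->
  oint x y h = g y - g x.
Proof.
move=> dg ch; rewrite /oint; have [xy|yx] := leP x y; first by rewrite cint_itv_I1 (cint_FTC2 xy dg ch).
by rewrite cint_itv_I1 (cint_FTC2 (ltW yx) dg ch) opprB.
Qed.

Lemma L1R_cutoff_continuous h : ccontinuous h -> L1R (cutoff a h).
Proof.
move=> ch; have [c hc] := ccontinuous_bounded (- a) a ch.
have := bounded_itv_cintegrable (ccontinuous_measurable ch) hc.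
by congr (cintegrable _ _ _); apply/funext => x; rewrite /cutoff ler_norml.
Qed.

Lemma oint_cutoff h x : `|x| <= a -> oint 0 x (cutoff a h) = oint 0 x h.
Proof.
rewrite ler_norml => /andP[x1 x2]; rewrite /oint; case: leP => x0; last congr (- _).
  rewrite !cint_itv_I1; apply: eq_I1 => s; rewrite /cutoff ler_norml.
  case: (boolP (0 <= s <= x)) => [/andP[s1 s2]|_]; last by rewrite ind0 !mul0r.
  by rewrite (_ : _ && _) ?ind1 ?mul1r//; lra.
rewrite !cint_itv_I1; apply: eq_I1 => s; rewrite /cutoff ler_norml.
case: (boolP (x <= s <= 0)) => [/andP[s1 s2]|_]; last by rewrite ind0 !mul0r.
by rewrite (_ : _ && _) ?ind1 ?mul1r//; lra.
Qed.

(** The derivatives are compared: on [-a, a] that of the right side is g by the fundamental theorem,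
    and both sides take the value F 0 at 0. *)
Lemma rep_C2 (F g h : R -> R[i]) : (forall x, is_cderive F x (g x)) ->
  (forall x, is_cderive g x (h x)) -> ccontinuous h ->
  cutoff a F = rep a (F 0) (g 0) (cutoff a h).
Proof.
move=> dF dg ch; have Ih := L1R_cutoff_continuous ch.
have hA s : a < `|s| -> cutoff a h s = 0 by exact: cut_out.
pose r t := F 0 + g 0 * t%:C + jint (cutoff a h) t.
pose dr t := g 0 + (prim1 (cutoff a h) t - prim1 (cutoff a h) 0).
have dR t : is_cderive r t (dr t) by exact: (is_cderive_jint Ih hA).
have drE t : `|t| <= a -> dr t = g t.
  by move=> ta; rewrite /dr -(oint_prim1 0 t Ih) oint_cutoff// (oint_FTC 0 t dg ch) addrC subrK.
have cdr : ccontinuous dr.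
  apply: ccontinuousD; first exact: (ccontinuous_cst (g 0)).
  by apply: ccontinuousD; [exact: (ccontinuous_prim1 Ih)|exact: (ccontinuous_cst (- _))].
have cg := is_cderive_ccontinuous dg.
apply/funext => x; rewrite /cutoff /rep -/(r x).
have [xa|_] := leP `|x| a; last by rewrite ind0 !mul0r.
congr (_ * _); have E : oint 0 x dr = oint 0 x g.
  rewrite -(oint_cutoff dr xa) -(oint_cutoff g xa); apply: eq_oint => s.
  by rewrite /cutoff; have [sa|_] := leP `|s| a; rewrite ?ind0 ?mul0r// drE.
have r0 : r 0 = F 0 by rewrite /r /jint mulr0 mul0r subr0 subrr !addr0.
move: E; rewrite (oint_FTC 0 x dR cdr) (oint_FTC 0 x dF cg) r0 => /(congr1 (fun z => z + F 0)).
by rewrite !subrK.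
Qed.

Definition mono n : R -> R[i] := cutoff a (fun x => x%:C ^+ n).

Lemma is_cderive_real (f : R -> R) (x l : R) : is_derive x (1 : R) f l ->
  is_cderive (fun y => (f y)%:C) x l%:C.
Proof. by move=> df; split=> //; exact: is_derive_cst. Qed.

Lemma is_cderiveX n (x : R) : is_cderive (fun y : R => y%:C ^+ n) x (n%:R * x%:C ^+ n.-1).
Proof.
have := @is_cderive_real (fun y => y ^+ n) x (n%:R * x ^+ n.-1).
rewrite rmorphM/= rmorphXn/= rmorph_nat.
rewrite (_ : (fun y : R => (y ^+ n)%:C) = (fun y : R => y%:C ^+ n)); last first.
  by apply/funext => y; rewrite rmorphXn.
apply; rewrite (_ : (fun y : R => y ^+ n) = (id : R -> R) ^+ n).
  by apply: is_derive_eq; rewrite /GRing.scale/= mulr1.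
by apply/funext => y; rewrite exprfctE.
Qed.

Lemma ccontinuousX n : ccontinuous (fun y : R => y%:C ^+ n).
Proof. exact: (is_cderive_ccontinuous (is_cderiveX n)). Qed.

Lemma ccontinuousZ c (f : R -> R[i]) : ccontinuous f -> ccontinuous (fun x => c * f x).
Proof.
move=> [f1 f2]; split=> x.
- rewrite (_ : re _ = fun x => complex.Re c * re f x - complex.Im c * im f x).
    by apply: cvgB; apply: cvgM; [exact: cvg_cst|exact: f1|exact: cvg_cst|exact: f2].
  by apply/funext => y; rewrite /re cReM.
- rewrite (_ : im _ = fun x => complex.Re c * im f x + complex.Im c * re f x).
    by apply: cvgD; apply: cvgM; [exact: cvg_cst|exact: f2|exact: cvg_cst|exact: f1].
  by apply/funext => y; rewrite /im cImM.
Qed.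

(** For n < 2 the truncated exponents do no harm, since wherever a predecessor is truncated the
    coefficient in front is 0. *)
Lemma mono_rep n : mono n = rep a (0 ^+ n) (n%:R * 0 ^+ n.-1)
  (fun y => (n * n.-1)%N%:R * mono n.-2 y).
Proof.
have d2 x : is_cderive (fun y : R => n%:R * y%:C ^+ n.-1) x ((n * n.-1)%N%:R * x%:C ^+ n.-2).
  have := is_cderiveZ n%:R (is_cderiveX n.-1 x).
  by rewrite natrM -mulrA.
rewrite /mono (rep_C2 (is_cderiveX n) d2 (ccontinuousZ _ (ccontinuousX _))).
by congr rep; apply/funext => x; rewrite /cutoff mulrCA.
Qed.

Lemma L1R_mono n : L1R (mono n).
Proof. exact: (L1R_cutoff_continuous (ccontinuousX n)). Qed.

Lemma mono_out n s : a < `|s| -> mono n s = 0.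
Proof. exact: cut_out. Qed.

End C2Representation.

Section Inverses.
Context (a B : R) (qh : R -> R[i]) (k : R -> R -> R[i]).
Hypothesis a0 : 0 < a.
Hypotheses (Iq : L1R qh) (qA : forall s, a < `|s| -> qh s = 0).
Hypotheses (mk : cmeasurable (fun p : mR * mR => k p.1 p.2)) (kB : forall x t, cnorm1 (k x t) <= B).
Hypothesis kE : kernel_equation a qh k.
Let kT x t := k t x.
Let mkT : cmeasurable (fun p : mR * mR => kT p.1 p.2).
Proof. exact: cmeasurable_swap mk. Qed.
Let kTB x t : cnorm1 (kT x t) <= B. Proof. exact: kB. Qed.

Lemma cutoff_supp (v : R -> R[i]) : (forall s, a < `|s| -> v s = 0) -> cutoff a v = v.
Proof.
move=> vA; apply/funext => x; rewrite /cutoff.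
by have [_|/vA ->] := leP `|x| a; rewrite ?ind1 ?mul1r ?mulr0.
Qed.

(** Homogeneity is read off from the integral form of S T - 1 given by [error_kernel]. *)
Lemma sop_topZ c v : L1R v -> (forall s, a < `|s| -> v s = 0) -> sop a k (top a k v) = v ->
  sop a k (top a k (fun y => c * v y)) = (fun y => c * v y).
Proof.
move=> Iv vA STv; have cA s : a < `|s| -> c * v s = 0 by move=> h; rewrite vA ?mulr0.
apply/funext => x; have [e [me [C eC] _ eE]] := error_kernel a mk kB x.
have H := eE _ (cintegrableZ c Iv) cA; have := eE _ Iv vA.
rewrite (cutoff_supp vA) STv subrr => e0; rewrite (cutoff_supp cA) in H.
transitivity (I1 (fun t => c * (e t * v t)) + c * v x).
  rewrite -(subrK (c * v x) (sop a k _ x)) H; congr (_ + _); apply: eq_I1 => t; ring.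
rewrite cintZ -?e0 ?mulr0 ?add0r//.
exact: (cintegrableMl Iv me (eC)).
Qed.

(** By [mono_rep] the step goes from n - 2 to n, so two consecutive exponents are carried along; for
    n < 2 the second derivative is 0, which S T fixes. *)
Lemma sop_top_mono n : sop a k (top a k (mono a n)) = mono a n.
Proof.
suff h m : sop a k (top a k (mono a m)) = mono a m /\
    sop a k (top a k (mono a m.+1)) = mono a m.+1 by have [] := h n.
have ST0 : sop a k (top a k (fun=> 0)) = fun=> 0.
  have z x : top a k (fun=> 0) x = 0.
    by rewrite /top /cutoff /volt (_ : I1 _ = 0) ?mulr0 ?addr0 ?mulr0//; transitivity (I1 (fun=> 0)); [apply: eq_I1 => t; rewrite mulr0|exact: cint0].
  have z' : top a k (fun=> 0) = fun=> 0 by apply/funext.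
  rewrite z'; apply/funext => x.
  by rewrite /sop /cutoff /volt (_ : I1 _ = 0) ?mulr0 ?subr0 ?mulr0//; transitivity (I1 (fun=> 0)); [apply: eq_I1 => t; rewrite mulr0|exact: cint0].
have step j : sop a k (top a k (mono a j.-2)) = mono a j.-2 \/ (j < 2)%N ->
    sop a k (top a k (mono a j)) = mono a j.
  move=> hj; rewrite mono_rep//; apply: (sop_top_rep Iq mk kB) => //.
  - by apply: cintegrableZ; exact: L1R_mono.
  - by move=> s h; rewrite mono_out// mulr0.
  case: hj => [hj|j2]; first by apply: sop_topZ => //; [exact: L1R_mono|exact: mono_out].
  rewrite (_ : (fun y => _) = fun=> 0)//; apply/funext => y.
  by case: j j2 => [|[|]]//= _; rewrite ?muln0 ?mul0r.
elim: m => [|m [IH1 IH2]]; first by split; apply: step; right.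
by split => //; apply: step; left.
Qed.

(** For each fixed x, the fixed monomials say that all moments of the kernel e vanish, so it pairs
    to 0 with every v. The equality thus holds at every point, not only almost everywhere. *)
Lemma sop_top v : L1R v -> (forall s, a < `|s| -> v s = 0) -> sop a k (top a k v) = v.
Proof.
move=> Iv vA; apply/funext => x; have [e [me [C eC] eA eE]] := error_kernel a mk kB x.
have E := eE v Iv vA; rewrite (cutoff_supp vA) in E.
apply/eqP; rewrite -subr_eq0 E; apply/eqP.
apply: (cint_moment0 a0 me eC eA) => // n.
have mA s : a < `|s| -> mono a n s = 0 by exact: mono_out.
have := eE _ (L1R_mono a n) mA; rewrite sop_top_mono (cutoff_supp mA) subrr => ->.
apply: eq_I1 => t; rewrite /mono /cutoff rmorphXn.
by have [_|/eA ->] := leP `|t| a; rewrite ?ind1 ?mul1r// !mul0r.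
Qed.

Section Volterra.
Context (w : R -> R[i]).
Hypotheses (Iw : L1R w) (wE : w = cutoff a (volt kT w)).

(** Chosen so that 2 B / lam <= 1/2; the summand 1 keeps it positive when B = 0. *)
Let lam : R := 4 * (B + 1).
Let B0 : 0 <= B. Proof. by apply: le_trans (kB 0 0); exact: cnorm1_ge0. Qed.
Let lam0 : 0 < lam. Proof. by have h := B0; rewrite /lam; lra. Qed.

(** A smooth majorant of the weight expR (lam * |t|), with an explicit primitive. *)
Let E (t : R) : R := expR (lam * t) + expR (- lam * t).

Let dexp (c x : R) : is_derive x (1 : R) (fun t => expR (c * t)) (c * expR (c * x)).
Proof.
have := @is_derive1_comp R expR (fun t => c * t) x (expR (c * x)) c (is_derive_expR _).
rewrite mulrC; apply.
apply: is_derive_eq; by rewrite /GRing.scale/= mulr1.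
Qed.

Let dE x : is_cderive (fun t => (lam^-1 * (expR (lam * t) - expR (- lam * t)))%:C) x (E x)%:C.
Proof.
apply: is_cderive_real; apply: is_derive_eq.
rewrite /E /GRing.scale/=.
have l0 : lam != 0 by rewrite gt_eqF.
by field.
Qed.

(* The Volterra operator is a contraction for the sup norm with weight [expR (- lam * `|x|)]. *)
Lemma volterra_contraction M x : (forall t, cnorm1 (w t) <= M * expR (lam * `|t|)) ->
  cnorm1 (w x) <= M / 2 * expR (lam * `|x|).
Proof.
move=> wM; have M0 : 0 <= M.
  by have := le_trans (cnorm1_ge0 _) (wM 0); rewrite normr0 mulr0 expR0 mulr1.
rewrite wE /cutoff; apply: (le_trans (cnorm1_le_boolM _ _)).
set r := `|x|; have r0 : 0 <= r by exact: normr_ge0.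
have rr : - r <= r by lra.
have cE : ccontinuous (fun t => (E t)%:C).
  apply: (@is_cderive_ccontinuous _ _ (fun x => (lam * expR (lam * x) + - lam * expR (- lam * x))%:C)) => t.
  by apply: is_cderive_real; apply: is_deriveD.
pose G t := ind (- r <= t <= r) * (E t)%:C.
have [m hm] := ccontinuous_bounded (- r) r cE.
have IG : L1R G := bounded_itv_cintegrable (ccontinuous_measurable cE) hm.
have EG : I1 G = (lam^-1 * (expR (lam * r) - expR (- lam * r)))%:C - (lam^-1 * (expR (lam * - r) - expR (- lam * - r)))%:C.
  exact: (cint_FTC2 rr dE cE).
have hb : cnorm1 (volt kT w x) <= cnorm1 (I1 (fun t => ind (`|t| <= `|x|) * kT x t * w t)).
  by rewrite /volt; case: ifP => _; rewrite ?mul1r// mulN1r cnorm1N.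
apply: (le_trans hb); have [IG1 _] := IG.
have b t : cnorm1 (ind (`|t| <= `|x|) * kT x t * w t) <= B * M * re G t.
  rewrite /re /G -/r ler_norml; case: (- r <= t <= r); last first.
    by rewrite !ind0 !mul0r cnorm1_0 /= mulr0.
  rewrite !ind1 !mul1r /=; apply: (le_trans (cnorm1M _ _)); rewrite -mulrA; apply: ler_pM; rewrite ?cnorm1_ge0//.
  apply: (le_trans (wM t)); apply: ler_wpM2l => //; rewrite /E.
  have [t0|t0] := ger0P t; first by rewrite lerDl expR_ge0.
  by rewrite mulrN mulNr lerDr expR_ge0.
have := cnorm1_cint_le (L1R_volt_integrand mkT kTB x Iw) (integrableZl measurableT (B * M) IG1) b.
rewrite RintegralZl// => h; apply: (le_trans h).
have -> : \int[leb]_t re G t = lam^-1 * (expR (lam * r) - expR (- lam * r)) * 2.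
  have := congr1 (@complex.Re R) EG => /= ->.
  by rewrite mulrNN mulrN mulNr; ring.
have e0 : 0 <= expR (- lam * r) by exact: expR_ge0.
have e1 : 0 <= expR (lam * r) by exact: expR_ge0.
have l1 : B * lam^-1 <= 4^-1.
  by rewrite ler_pdivrMr// /lam; have h0 := B0; lra.
apply: (@le_trans _ _ (M * (B * lam^-1) * 2 * expR (lam * r))).
  rewrite (_ : B * M * _ = M * (B * lam^-1) * 2 * (expR (lam * r) - expR (- lam * r))); last by ring.
  apply: ler_wpM2l; last by lra.
  by rewrite !mulr_ge0// invr_ge0 ltW.
apply: ler_wpM2r => //.
have : M * (B * lam^-1) <= M * 4^-1 by apply: ler_wpM2l.
lra.
Qed.

(** Each use of [volterra_contraction] halves the constant in the weighted bound; the crude bound M0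
    starts the iteration. *)
Lemma volterra_unique x : w x = 0.
Proof.
pose M0 := B * \int[leb]_t cnorm1 (w t).
have M00 : 0 <= M0 by rewrite mulr_ge0//; apply: Rintegral_ge0 => t _; exact: cnorm1_ge0.
have h n y : cnorm1 (w y) <= M0 / 2 ^+ n * expR (lam * `|y|).
  elim: n y => [|n IH] y; last first.
    by have := volterra_contraction y IH; rewrite exprSr invfM mulrA.
  rewrite expr0 divr1 wE /cutoff; apply: (le_trans (cnorm1_le_boolM _ _)).
  apply: (le_trans (cnorm1_volt mkT kTB y Iw)); rewrite -[X in X <= _]mulr1; apply: ler_wpM2l => //.
  by rewrite -expR0 ler_expR mulr_ge0// ltW.
apply: cnorm1_eq0; rewrite leNgt; apply/negP => wp.
pose z := M0 * expR (lam * `|x|) / cnorm1 (w x).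
have z0 : 0 <= z by rewrite divr_ge0 ?cnorm1_ge0// mulr_ge0// expR_ge0.
pose n := Num.bound z.
have zn : z < n%:R by rewrite archi_boundP.
have n2 : n%:R <= (2 : R) ^+ n.
  apply: le_trans (bernoulli_add n ler01); by rewrite mulr1 lerDr.
have := h n x; rewrite leNgt => /negP; apply.
rewrite mulrAC ltr_pdivrMr ?exprn_gt0// [ltRHS]mulrC -ltr_pdivrMr//.
exact: lt_le_trans zn n2.
Qed.
End Volterra.

Lemma top_sop u : L1R u -> (forall s, a < `|s| -> u s = 0) -> top a k (sop a k u) = u.
Proof.
move=> Iu uA; have Is := L1R_sop a mk kB Iu; have sA := @sop_out _ a k u.
have It := L1R_top a mk kB Is.
have E : sop a k (top a k (sop a k u)) = sop a k u by exact: sop_top.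
pose w x := top a k (sop a k u) x - u x.
have Iw : L1R w by exact: cintegrableB.
have wA s : a < `|s| -> w s = 0 by move=> h; rewrite /w top_out// uA// subrr.
suff wE : w = cutoff a (volt kT w).
  apply/funext => x; have /eqP := volterra_unique Iw wE x.
  by rewrite subr_eq0 => /eqP.
apply/funext => x; have [xa|xa] := leP `|x| a; last by rewrite wA// cut_out.
have sE v : sop a k v x = v x - volt kT v x by rewrite /sop (cut_in _ xa).
have E1 : sop a k (top a k (sop a k u)) x = sop a k u x by rewrite E.
rewrite !sE in E1.
rewrite (cut_in _ xa) (voltB mkT kTB)// /w.
apply/eqP; rewrite -subr_eq0; apply/eqP.
transitivity ((top a k (sop a k u) x - volt kT (top a k (sop a k u)) x) - (u x - volt kT u x)); first by ring.
by rewrite E1 subrr.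
Qed.

End Inverses.
End Inversion.

(** * The Goursat problem *)

Section PlaneTestFunctions.
Context {R : realType}.
Local Notation mR := (measurableTypeR R).

Lemma is_derive_line (f : R * R -> R) (p d : R * R) (s : R) : derivable f (p + s *: d) d ->
  is_derive s (1 : R) (fun r => f (p + r *: d)) ('D_d f (p + s *: d)).
Proof.
have e (h : R) : p + (h *: (1 : R) + s) *: d = h *: d + (p + s *: d).
  by rewrite (_ : h *: (1 : R) = h) ?scalerDl 1?addrCA//; exact: mulr1.
have E : (fun h : R => h^-1 *: (((fun r => f (p + r *: d)) \o shift s) (h *: (1 : R)) - f (p + s *: d))) =
    (fun h : R => h^-1 *: ((f \o shift (p + s *: d)) (h *: d) - f (p + s *: d))).
  by apply/funext => h /=; rewrite e.
by move=> df; split; [rewrite /derivable E|rewrite /derive E].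
Qed.

Lemma continuous_line (p d : R * R) : continuous (fun s : R => p + s *: d).
Proof.
by move=> s; apply: cvgD; [exact: cvg_cst|apply: cvgZr_tmp => //; exact: cvg_id].
Qed.

(** [smooth] provides continuous directional derivatives, but not linearity in the direction. The
    increment along (h, h e) is split into a horizontal and a vertical one; by the mean value
    theorem the latter is a vertical derivative at height at most |h|, where |e| <= 1 enters, and
    continuity of that derivative gives the limit. *)
Lemma derive_direction (f : R * R -> R) (e : R) (p : R * R) : smooth f -> `|e| <= 1 ->
  'D_(1, e) f p = 'D_(1, 0) f p + e * 'D_(0, 1) f p.
Proof.
move=> sf e1; have [_ df] := sf [::]; have [cD1 _] := sf [:: (0, 1) : R * R].
rewrite /= in df cD1.
have line (h c : R) : is_derive c (1 : R) (fun r => f (p + (h, 0) + r *: (0, 1)))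
    ('D_(0, 1) f (p + (h, 0) + c *: (0, 1))) by apply: is_derive_line; exact: df.
have mv (h : R) : exists c, `|c| <= `|h| /\
    f (p + (h, h * e)) - f (p + (h, 0)) = 'D_(0, 1) f (p + (h, c)) * (h * e).
  have E (c : R) : p + (h, 0) + c *: (0, 1) = p + (h, c).
    rewrite -addrA; congr (_ + _).
    rewrite (_ : _ + _ = (h + c * 0, 0 + c * 1)); last by [].
    by rewrite mulr0 mulr1 addr0 add0r.
  have he : `|h * e| <= `|h| by rewrite normrM ler_piMr.
  have der (x : R) := line h x.
  have con (A : set R) : {within A, continuous (fun r => f (p + (h, 0) + r *: (0, 1)))}.
    apply: continuous_subspaceT => x; apply: differentiable_continuous.
    by apply/derivable1_diffP; have [] := der x.
  have [h0|h0] := leP 0 (h * e).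
    have [c /itvP cI Ec] := MVT_segment h0 (fun x _ => der x) (con _).
    exists c; split; first by apply: le_trans he; rewrite !ger0_norm ?cI.
    by move: Ec; rewrite !E subr0.
  have [c /itvP cI Ec] := MVT_segment (ltW h0) (fun x _ => der x) (con _).
  exists c; split; first by apply: le_trans he; rewrite !ler0_norm ?cI ?lerN2 ?cI// ltW.
  by move: Ec; rewrite !E sub0r mulrN => /(congr1 -%R); rewrite opprB opprK.
have [theta hth] := choice mv.
have c1 : (fun h : R => h^-1 *: (f (h *: (1, 0) + p) - f p)) @ 0^' --> 'D_(1, 0) f p.
  exact: df.
have c2 : (fun h : R => 'D_(0, 1) f (p + (h, theta h))) @ 0^' --> 'D_(0, 1) f p.
  apply/cvgrPdist_lt => eps eps0.
  have /cvgrPdist_lt /(_ eps eps0) /nbhs_ballP[dl /= dl0 hdl] := cD1 p.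
  apply: nbhs_dnbhs; apply/nbhs_ballP; exists dl => //= h.
  rewrite -ball_normE/= sub0r normrN => hd; apply: hdl.
  have [th _] := hth h.
  split; rewrite -ball_normE/= opprD addrA subrr sub0r normrN//.
  exact: le_lt_trans th hd.
have c3 : (fun h : R => h^-1 *: (f (h *: (1, 0) + p) - f p) + e * 'D_(0, 1) f (p + (h, theta h))) @ 0^'
    --> 'D_(1, 0) f p + e * 'D_(0, 1) f p.
  exact: (cvgD c1 (cvgM (cvg_cst e) c2)).
apply: cvg_lim => //; apply: cvg_trans c3; apply: near_eq_cvg.
near=> h; have h0 : h != 0 by near: h; exact: nbhs_dnbhs_neq.
have [_ Eh] := hth h.
have E1 : h *: (1, 0) + p = p + (h, 0).
  rewrite addrC; congr (_ + _); rewrite (_ : _ *: _ = (h * 1, h * 0)); last by [].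
  by rewrite mulr1 mulr0.
have E2 : h *: (1, e) + p = p + (h, h * e).
  rewrite addrC; congr (_ + _); rewrite (_ : _ *: _ = (h * 1, h * e)); last by [].
  by rewrite mulr1.
rewrite /= E1 E2 -[f (p + (h, h * e))](subrK (f (p + (h, 0)))) Eh /GRing.scale/=.
by field.
Unshelve. all: by end_near. Qed.

Lemma interior_Omega (a : R) (p : R * R) : (Omega a)° p -> `|p.1| < a /\ `|p.2| < a.
Proof.
move=> /nbhs_ballP[e /= e0 he].
have mem (x t : R) : `|x - p.1| < e -> `|t - p.2| < e -> `|x| <= a /\ `|t| <= a.
  move=> hx ht; have [] : Omega a (x, t) by apply: he; split; rewrite -ball_normE/= distrC.
  by rewrite /= !in_itv/= -!ler_norml.
have e2 : `|e / 2| < e by rewrite ger0_norm; lra.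
have n2 : `|- (e / 2)| < e by rewrite normrN.
have a1 : `|p.1 + e / 2 - p.1| < e by rewrite addrC addKr.
have a2 : `|p.1 - e / 2 - p.1| < e by rewrite addrC addKr.
have a3 : `|p.2 + e / 2 - p.2| < e by rewrite addrC addKr.
have a4 : `|p.2 - e / 2 - p.2| < e by rewrite addrC addKr.
have [] := mem _ _ a1 a3; have [] := mem _ _ a2 a4; rewrite !ler_norml !ltr_norml.
by move=> /andP[? ?] /andP[? ?] /andP[? ?] /andP[? ?]; split; apply/andP; split; lra.
Qed.

Lemma plane_test_function (a : R) (phi : R * R -> R[i]) : test_function (Omega a)° phi ->
  [/\ forall p d s, is_cderive (fun r => phi (p + r *: d)) s (cD d phi (p + s *: d)),
   forall d, continuous (re (cD d phi)) /\ continuous (im (cD d phi)),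
   continuous (re phi) /\ continuous (im phi) &
   forall p, ~ (`|p.1| < a /\ `|p.2| < a) -> phi p = 0 /\ forall d, cD d phi p = 0].
Proof.
move=> [s1 s2 cs sub].
have d p d s : is_cderive (fun r => phi (p + r *: d)) s (cD d phi (p + s *: d)).
  by split; apply: is_derive_line; [have [_] := s1 [::]|have [_] := s2 [::]]; exact.
split => //.
- by move=> v; split; [have [+ _] := s1 [:: v]|have [+ _] := s2 [:: v]].
- by split; [have [+ _] := s1 [::]|have [+ _] := s2 [::]].
- move=> p pa; have np : (~` csupp phi) p by move=> /sub /interior_Omega.
  have op : open (~` csupp phi) by apply: closed_openC; exact: closed_closure.
  have z y : (~` csupp phi) y -> phi y = 0.
    by move=> ny; apply/eqP; rewrite -[_ == _]negbK; apply/negP => py; apply: ny; exact: subset_closure.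
  split=> [|v]; first exact: z.
  have p0 : p + (0 : R) *: v = p by rewrite scale0r addr0.
  have nb : nbhs (p + (0 : R) *: v) (~` csupp phi) by rewrite p0; exact: open_nbhs_nbhs.
  have cl : continuous (fun s : R => p + s *: v) by exact: continuous_line.
  have /nbhs_ballP[e /= e0 he] := cl 0 _ nb.
  have zz (y : R) : `|y - 0| < e -> phi (p + y *: v) = 0.
    by move=> ye; apply: z; apply: he; rewrite /ball /= distrC.
  have [D1 D2] := d p v 0.
  have [E1 E2] := is_cderive_eq_near e0 zz (is_cderive_cst 0 0).
  rewrite -p0; apply: complex_eqP.
    by rewrite -(@derive_val _ _ _ _ _ _ _ D1) (@derive_val _ _ _ _ _ _ _ E1).
  by rewrite -(@derive_val _ _ _ _ _ _ _ D2) (@derive_val _ _ _ _ _ _ _ E2).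
Qed.

End PlaneTestFunctions.

(** * Integration by parts along characteristic lines *)

Section CharacteristicDerivatives.
Context {R : realType}.
Local Notation mR := (measurableTypeR R).
Local Notation I1 f := (cint (@leb R) setT f).
Local Notation I2 f := (cint (@leb2 R) setT f).
Local Notation L1R f := (cintegrable (@leb R) setT f).
Local Notation L1R2 f := (cintegrable (@leb2 R) setT f).
Local Notation ind := (@ind R).

Lemma L1R2_scale (c : R) (f : R * R -> R[i]) : c != 0 -> L1R2 f ->
  L1R2 (fun p => f (c * p.1, c * p.2)).
Proof.
move=> c0 If; have := L1R2_swap (L1R2_shear 0 c0 (L1R2_swap (L1R2_shear 0 c0 If))).
by congr (cintegrable _ _ _); apply/funext => p /=; rewrite !mul0r !addr0.
Qed.

Lemma ccontinuous2_measurable (f : R * R -> R[i]) : continuous (re f) -> continuous (im f) ->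
  cmeasurable (f : mR * mR -> _).
Proof.
by move=> c1 c2; split; [have := measurable_continuous2 c1|have := measurable_continuous2 c2].
Qed.

Definition diag (e : R) : R * R := (1, e).

Section Pairing.
Context (a : R) (phi : R * R -> R[i]).
Hypothesis tphi : test_function (Omega a)° phi.

Let box (p : R * R) := (`|p.1| <= a) && (`|p.2| <= a).

Lemma L1R2_box_mul (f psi : R * R -> R[i]) : L1R2 (fun p => ind (box p) * f p) ->
  continuous (re psi) -> continuous (im psi) ->
  (forall p, ~ (`|p.1| < a /\ `|p.2| < a) -> psi p = 0) ->
  L1R2 (fun p => f p * psi p).
Proof.
move=> If c1 c2 p0.
have [m1 h1] := continuous2_bounded a c1; have [m2 h2] := continuous2_bounded a c2.
have b p : cnorm1 (psi p) <= `|m1| + `|m2|.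
  have [pb|npb] := boolP (box p).
    have pO : ((`[-a, a] : set R) `*` (`[-a, a] : set R)) p.
      by move/andP: pb => [? ?]; split; rewrite /= in_itv/= -ler_norml.
    by apply: lerD; apply: le_trans (ler_norm _); [exact: h1|exact: h2].
  rewrite p0 ?cnorm1_0 ?addr_ge0//; move=> [? ?].
  by move/negP: npb; apply; apply/andP; split; exact: ltW.
have := cintegrableMr If (ccontinuous2_measurable c1 c2) b.
congr (cintegrable _ _ _); apply/funext => p.
have [pb|npb] := boolP (box p); first by rewrite ind1 mul1r.
rewrite p0 ?mulr0//; move=> [? ?].
by move/negP: npb; apply; apply/andP; split; exact: ltW.
Qed.

Lemma rotate_norm (u v : R) : (`|u + v| < a /\ `|u - v| < a) <-> `|u| + `|v| < a.
Proof.
split=> [[]|h]; last by split; [apply: le_lt_trans h; exact: ler_normD|apply: le_lt_trans h; exact: ler_normB].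
rewrite !ltr_norml => /andP[? ?] /andP[? ?].
by have [?|?] := ger0P u; have [?|?] := ger0P v; lra.
Qed.

(** Outside the open square phi and its derivatives vanish, so f1 has to be a primitive of f2 only
    on the part of the line inside the square. *)
Lemma line_by_parts (p d : R * R) (f1 f2 : R * R -> R[i]) (g : R -> R[i]) (c : R[i]) : L1R g ->
  (forall s, a < `|s| -> ~ (`|(p + s *: d).1| < a /\ `|(p + s *: d).2| < a)) ->
  (forall s, `|(p + s *: d).1| < a -> `|(p + s *: d).2| < a ->
     f1 (p + s *: d) = c + prim1 g s /\ f2 (p + s *: d) = g s) ->
  I1 (fun s => f1 (p + s *: d) * cD d phi (p + s *: d)) =
  - I1 (fun s => f2 (p + s *: d) * phi (p + s *: d)).
Proof.
move=> Ig out fE; have [dl cl _ zl] := plane_test_function tphi.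
have [c1 c2] := cl d.
have cd : ccontinuous (fun s => cD d phi (p + s *: d)).
  have L : continuous (fun s : R => p + s *: d) by exact: continuous_line.
  by split=> s; [have := continuous_comp (L s) (c1 (p + s *: d))|have := continuous_comp (L s) (c2 (p + s *: d))].
have zo s : a < `|s| -> phi (p + s *: d) = 0 by move=> /out /zl[].
have := cint_by_parts c Ig (dl p d) cd zo => E.
transitivity (I1 (fun s => (c + prim1 g s) * cD d phi (p + s *: d))).
  apply: eq_I1 => s; have [h|/zl[_ ->]] := pselect (`|(p + s *: d).1| < a /\ `|(p + s *: d).2| < a).
    by have [-> _] := fE s h.1 h.2.
  by rewrite !mulr0.
rewrite E; congr (- _); apply: eq_I1 => s.
have [h|/zl[-> _]] := pselect (`|(p + s *: d).1| < a /\ `|(p + s *: d).2| < a).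
  by have [_ ->] := fE s h.1 h.2.
by rewrite !mulr0.
Qed.

Let rotate_half (f : R * R -> R[i]) : L1R2 f ->
  I2 f = 2 * I1 (fun al => I1 (fun be => f (al + be, al - be))).
Proof. by move=> If; rewrite (I2_rotate If) mulrA mulfV ?mul1r. Qed.

Let rotate_swap (f : R * R -> R[i]) : L1R2 f ->
  I1 (fun al => I1 (fun be => f (al + be, al - be))) =
  I1 (fun be => I1 (fun al => f (al + be, al - be))).
Proof. by move=> If; exact: (@fub R (fun al be => f (al + be, al - be)) (L1R2_rotate If)). Qed.

(** The plane is sliced into the lines of constant u, which have direction (1, -1); on each of them
    [line_by_parts] applies. *)
Lemma pairing_v (f1 f2 : R * R -> R[i]) (c : R -> R[i]) (g : R -> R -> R[i]) :
  L1R2 (fun p => ind (box p) * f1 p) -> L1R2 (fun p => ind (box p) * f2 p) ->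
  (forall u, L1R (g u)) ->
  (forall u v, `|u| + `|v| < a -> f1 (u + v, u - v) = c u + prim1 (g u) v /\ f2 (u + v, u - v) = g u v) ->
  I2 (fun p => f1 p * cD (diag (-1)) phi p) = - I2 (fun p => f2 p * phi p).
Proof.
move=> If1 If2 Ig fE; have [_ cl [cp1 cp2] zl] := plane_test_function tphi.
have [c1 c2] := cl (diag (-1)).
have J1 := L1R2_box_mul If1 c1 c2 (fun p h => (zl p h).2 (diag (-1))).
have J2 := L1R2_box_mul If2 cp1 cp2 (fun p h => (zl p h).1).
rewrite (rotate_half J1) (rotate_half J2) -mulrN; congr (_ * _).
rewrite -cintN; last exact: (L1R_section (L1R2_rotate J2)).
apply: eq_I1 => u.
have E s : (u + s, u - s) = (u, u) + s *: diag (-1).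
  transitivity (u + s * 1, u + s * -1); last by [].
  by rewrite mulr1 mulrN1.
transitivity (I1 (fun s => f1 ((u, u) + s *: diag (-1)) * cD (diag (-1)) phi ((u, u) + s *: diag (-1)))).
  by apply: eq_I1 => s; rewrite -E.
rewrite (line_by_parts (f2 := f2) (c := c u) (Ig u)).
- by congr (- _); apply: eq_I1 => s; rewrite -E.
- move=> s sa; rewrite -E /= rotate_norm => h.
  by have := normr_ge0 u; lra.
- move=> s; rewrite -E /= => h1 h2; apply: fE; exact/rotate_norm.
Qed.

Lemma pairing_u (f1 f2 : R * R -> R[i]) (c : R -> R[i]) (g : R -> R -> R[i]) :
  L1R2 (fun p => ind (box p) * f1 p) -> L1R2 (fun p => ind (box p) * f2 p) ->
  (forall v, L1R (g v)) ->
  (forall u v, `|u| + `|v| < a -> f1 (u + v, u - v) = c v + prim1 (g v) u /\ f2 (u + v, u - v) = g v u) ->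
  I2 (fun p => f1 p * cD (diag 1) phi p) = - I2 (fun p => f2 p * phi p).
Proof.
move=> If1 If2 Ig fE; have [_ cl [cp1 cp2] zl] := plane_test_function tphi.
have [c1 c2] := cl (diag 1).
have J1 := L1R2_box_mul If1 c1 c2 (fun p h => (zl p h).2 (diag 1)).
have J2 := L1R2_box_mul If2 cp1 cp2 (fun p h => (zl p h).1).
rewrite (rotate_half J1) (rotate_half J2) -mulrN; congr (_ * _).
have K2 := L1R2_rotate J2.
rewrite (rotate_swap J1) (rotate_swap J2) -cintN; last exact: (L1R_section (L1R2_swap K2)).
apply: eq_I1 => v.
have E s : (s + v, s - v) = (v, - v) + s *: diag 1.
  transitivity (v + s * 1, - v + s * 1); last by [].
  by rewrite mulr1 addrC [- v + s]addrC.
transitivity (I1 (fun s => f1 ((v, - v) + s *: diag 1) * cD (diag 1) phi ((v, - v) + s *: diag 1))).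
  by apply: eq_I1 => s; rewrite -E.
rewrite (line_by_parts (f2 := f2) (c := c v) (Ig v)).
- by congr (- _); apply: eq_I1 => s; rewrite -E.
- move=> s sa; rewrite -E /= rotate_norm => h.
  by have := normr_ge0 v; lra.
- move=> s; rewrite -E /= => h1 h2; apply: fE; exact/rotate_norm.
Qed.

End Pairing.
End CharacteristicDerivatives.

(** * Characteristic derivatives of the kernel *)

Section GoursatCharacteristics.
Context {R : realType}.
Local Notation mR := (measurableTypeR R).
Local Notation I1 f := (cint (@leb R) setT f).
Local Notation I2 f := (cint (@leb2 R) setT f).
Local Notation L1R f := (cintegrable (@leb R) setT f).
Local Notation L1R2 f := (cintegrable (@leb2 R) setT f).
Local Notation ind := (@ind R).

Definition box (a : R) (p : R * R) := (`|p.1| <= a) && (`|p.2| <= a).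

Lemma measurable_box a : measurable_fun setT (box a : mR * mR -> bool).
Proof.
apply: measurable_and; apply: measurable_fun_ler; (exact: measurableT_comp || exact: measurable_cst).
Qed.

Lemma L1R_norm_itv (a : R) : L1R (fun x : R => ind (`|x| <= a)).
Proof.
by have := L1R_itv (- a) a; congr (cintegrable _ _ _); apply/funext => x; rewrite ler_norml.
Qed.

Lemma L1R2_box_bounded (a c : R) (f : R * R -> R[i]) : cmeasurable (f : mR * mR -> _) ->
  (forall p, cnorm1 (f p) <= c) -> L1R2 (fun p => ind (box a p) * f p).
Proof.
move=> mf fc; have := cintegrableMr (cintegrable_tensor (L1R_norm_itv a) (L1R_norm_itv a)) mf fc.
by congr (cintegrable _ _ _); apply/funext => p; rewrite indM.
Qed.

(** If |x| and |t| are at most a, so are |x + t| / 2 and |x - t| / 2; integrability over the larger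
    square in (u, v) therefore suffices. *)
Lemma L1R2_box_rotate (a : R) (W : R -> R -> R[i]) : L1R2 (fun p => ind (box a p) * W p.1 p.2) ->
  L1R2 (fun p => ind (box a p) * W ((p.1 + p.2) / 2) ((p.1 - p.2) / 2)).
Proof.
move=> IW; have h2 : (2^-1 : R) != 0 by rewrite invr_eq0.
have := cintegrable_bool (measurable_box a) (L1R2_rotate (L1R2_scale h2 IW)).
congr (cintegrable _ _ _); apply/funext => p /=.
rewrite ![2^-1 * _]mulrC; case: (boolP (box a p)) => [/andP[p1 p2]|_]; last by rewrite ind0 !mul0r.
rewrite [box a _](_ : _ = true) ?ind1 ?mul1r//; move: p1 p2; rewrite /box/= !ler_norml.
by move=> /andP[? ?] /andP[? ?]; apply/andP; split; apply/andP; split; lra.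
Qed.

(** A sign and a fixed interval: in this form oriented double integrals can be exchanged without
    distinguishing the signs of u and v. *)
Lemma oint_sgn (u : R) (f : R -> R[i]) : oint 0 u f =
  (if 0 <= u then 1 else -1) * I1 (fun s => ind (Num.min 0 u <= s <= Num.max 0 u) * f s).
Proof.
rewrite /oint; have [u0|u0] := leP 0 u; first by rewrite mul1r cint_itv_I1.
by rewrite mulN1r cint_itv_I1.
Qed.

Section OintKernel.
Context (a B : R) (qh : R -> R[i]) (k : R -> R -> R[i]).
Hypotheses (Iq : L1R qh) (mk : cmeasurable (fun p : mR * mR => k p.1 p.2)).
Hypothesis kB : forall x t, cnorm1 (k x t) <= B.
Let F al be := qh (al + be) * k (al + be) (al - be).
Let IF al : L1R (F al). Proof. exact: (L1R_characteristic Iq mk kB). Qed.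

Lemma conjugate_kernel_measurable : cmeasurable (fun p : mR * mR => k p.1 (- p.2)).
Proof.
apply: (@cmeasurable_comp _ _ _ _ _ (fun p : mR * mR => k p.1 p.2)
    (fun p : mR * mR => (p.1, - p.2 : mR)) mk).
apply: measurable_fun_pair; first exact: measurable_fst.
by apply: measurable_funN; exact: measurable_snd.
Qed.

(** Replacing k x t by k x (- t) exchanges the two characteristic variables, so each statement about
    one of them yields the one about the other. *)
Lemma characteristic_swap al be : qh (be + al) * k (be + al) (- (be - al)) = F al be.
Proof. by rewrite /F opprB [be + al]addrC. Qed.

Lemma L1R_characteristic_swap be : L1R (fun al => F al be).
Proof.
have := @L1R_characteristic R B qh (fun x t => k x (- t)) Iq conjugate_kernel_measurable
  (fun x t => kB x (- t)) be.
by congr (cintegrable _ _ _); apply/funext => al; exact: characteristic_swap.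
Qed.

Let mF : cmeasurable (fun p : mR * mR => F p.1 p.2).
Proof.
have ms : measurable_fun setT (fun p : mR * mR => (p.1 + p.2 : mR)).
  by apply: measurable_funD; [exact: measurable_fst|exact: measurable_snd].
apply: cmeasurableM; first exact: (cmeasurable_comp (cintegrable_measurable Iq) ms).
apply: (@cmeasurable_comp _ _ _ _ _ (fun p : mR * mR => k p.1 p.2)
    (fun p : mR * mR => (p.1 + p.2 : mR, p.1 - p.2 : mR)) mk).
apply: measurable_fun_pair => //.
by apply: measurable_funB; [exact: measurable_fst|exact: measurable_snd].
Qed.

Let mprim : cmeasurable (fun p : mR * mR => prim1 (F p.1) p.2).
Proof.
apply: (@cmeasurable_section _ _ _ _ _ (@leb R : {sigma_finite_measure set mR -> \bar R})
  (fun r : (mR * mR) * mR => ind ((r.2 : R) <= r.1.2) * F r.1.1 r.2)).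
apply: cmeasurableM.
  apply: cmeasurable_bool; apply: measurable_fun_ler; first exact: measurable_snd.
  exact: (measurableT_comp measurable_snd measurable_fst).
apply: (@cmeasurable_comp _ _ _ _ _ (fun p : mR * mR => F p.1 p.2)
    (fun r : (mR * mR) * mR => (r.1.1, r.2)) mF).
apply: measurable_fun_pair; last exact: measurable_snd.
exact: (measurableT_comp measurable_fst measurable_fst).
Qed.

Let prim_bounded u v : cnorm1 (prim1 (F u) v) <= B * \int[leb]_s cnorm1 (qh s).
Proof.
have Ind : L1R (fun s => ind (s <= v) * F u s).
  by apply: cintegrable_bool (IF u); exact: measurable_le_cst.
have Iqu : L1R (fun s => qh (1 * s + u)) := cintegrable_affine u (oner_neq0 R) Iq.
have b s : cnorm1 (ind (s <= v) * F u s) <= B * cnorm1 (qh (1 * s + u)).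
  apply: (le_trans (cnorm1_le_boolM _ _)); apply: (le_trans (cnorm1M _ _)).
  by rewrite mulrC mul1r [s + u]addrC; apply: ler_wpM2r => //; exact: cnorm1_ge0.
have := cnorm1_cint_le Ind (integrableZl measurableT B (integrable_cnorm1 Iqu)) b.
rewrite RintegralZl//; last exact: (integrable_cnorm1 Iqu).
by rewrite -[X in _ * X]mul1r -[X in X * \int[leb]_x _](@normr1 R)
   -(@Rintegral_affine R 1 u (fun s => cnorm1 (qh s)) (oner_neq0 R) (measurable_cnorm1 (cintegrable_measurable Iq))).
Qed.

Lemma L1R2_oint_characteristic : L1R2 (fun p => ind (box a p) * oint 0 p.2 (F p.1)).
Proof.
have m0 : cmeasurable (fun p : mR * mR => prim1 (F p.1) 0).
  apply: (@cmeasurable_comp _ _ _ _ _ (fun p : mR * mR => prim1 (F p.1) p.2)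
    (fun p : mR * mR => (p.1, 0 : mR)) mprim).
  by apply: measurable_fun_pair; [exact: measurable_fst|exact: measurable_cst].
have e p : oint 0 p.2 (F p.1) = prim1 (F p.1) p.2 - prim1 (F p.1) 0 by rewrite oint_prim1.
rewrite (_ : (fun p => _) = fun p => ind (box a p) * (prim1 (F p.1) p.2 - prim1 (F p.1) 0)).
  apply: (@L1R2_box_bounded a (B * \int[leb]_s cnorm1 (qh s) + B * \int[leb]_s cnorm1 (qh s))).
    exact: cmeasurableB.
  by move=> p; apply: (le_trans (cnorm1D _ _)); rewrite cnorm1N; apply: lerD; exact: prim_bounded.
by apply/funext => p; rewrite e.
Qed.

(** The equation has u as the outer variable; reading k as a primitive in v requires the other
    order. *)
Lemma oint_fubini u v : oint 0 u (fun al => oint 0 v (F al)) =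
  oint 0 v (fun be => oint 0 u (fun al => F al be)).
Proof.
pose iu s := ind (Num.min 0 u <= s <= Num.max 0 u); pose iv s := ind (Num.min 0 v <= s <= Num.max 0 v).
pose su : R[i] := if 0 <= u then 1 else -1; pose sv : R[i] := if 0 <= v then 1 else -1.
pose J (p : R * R) := iu p.1 * (iv p.2 * F p.1 p.2).
have IJ : L1R2 J.
  apply: (@cintegrable_bool _ _ _ _ (fun p : mR * mR => Num.min 0 u <= p.1 <= Num.max 0 u)).
    by apply: measurable_and; apply: measurable_fun_ler; (exact: measurable_cst || exact: measurable_fst).
  exact: (L1R2_characteristic Iq mk kB).
have E1 : oint 0 u (fun al => oint 0 v (F al)) = su * (sv * I1 (fun al => I1 (fun be => J (al, be)))).
  rewrite oint_sgn; apply: (congr1 (GRing.mul _)); rewrite -cintZ; last exact: (L1R_section IJ).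
  apply: eq_I1 => al; rewrite oint_sgn mulrCA; apply: (congr1 (GRing.mul _)).
  rewrite -cintZ//; apply: cintegrable_bool (IF al).
  by apply: measurable_and; apply: measurable_fun_ler; (exact: measurable_cst || exact: measurable_id).
have E2 : oint 0 v (fun be => oint 0 u (fun al => F al be)) = sv * (su * I1 (fun be => I1 (fun al => J (al, be)))).
  rewrite oint_sgn; apply: (congr1 (GRing.mul _)); rewrite -cintZ; last exact: (L1R_section (L1R2_swap IJ)).
  apply: eq_I1 => be; rewrite oint_sgn mulrCA; apply: (congr1 (GRing.mul _)).
  have Ib : L1R (fun al => iu al * F al be).
    apply: cintegrable_bool (L1R_characteristic_swap be).
    by apply: measurable_and; apply: measurable_fun_ler; (exact: measurable_cst || exact: measurable_id).
  rewrite -[iv be * _]cintZ// -/iu; apply: eq_I1 => al; rewrite /J/=; ring.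
apply: (etrans E1); apply: (etrans _ (esym E2)); rewrite [RHS]mulrCA.
apply: (congr1 (GRing.mul _)); apply: (congr1 (GRing.mul _)); exact: (@fub R (fun al be => J (al, be)) IJ).
Qed.
End OintKernel.

Section Identities.
Context (a B : R) (qh : R -> R[i]) (k : R -> R -> R[i]).
Hypothesis a0 : 0 < a.
Hypotheses (Iq : L1R qh) (mk : cmeasurable (fun p : mR * mR => k p.1 p.2)).
Hypothesis kB : forall x t, cnorm1 (k x t) <= B.
Hypothesis kE : kernel_equation a qh k.
Let F al be := qh (al + be) * k (al + be) (al - be).

Let kp x t := k x (- t).
Let mkp : cmeasurable (fun p : mR * mR => kp p.1 p.2) := conjugate_kernel_measurable mk.
Let kpB x t : cnorm1 (kp x t) <= B. Proof. exact: kB. Qed.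

(* The derivatives of K in the characteristic directions (1, 1) and (1, -1), in the coordinates
   x = u + v, t = u - v. *)
Definition char_u (u v : R) : R[i] := 2^-1 * qh u + oint 0 v (fun be => qh (u + be) * k (u + be) (u - be)).
Definition char_v (u v : R) : R[i] := oint 0 u (fun al => qh (al + v) * k (al + v) (al - v)).
Definition in_plane (W : R -> R -> R[i]) (p : R * R) : R[i] := W ((p.1 + p.2) / 2) ((p.1 - p.2) / 2).

Let in_planeE W u v : in_plane W (u + v, u - v) = W u v.
Proof. by rewrite /in_plane /=; congr W; field. Qed.

(** In the coordinates (u, v), q / 2 times the indicator in v is a tensor product, and the remaining
    integral is bounded. *)
Lemma L1R2_char_u : L1R2 (fun p => ind (box a p) * in_plane char_u p).
Proof.
apply: L1R2_box_rotate.
have mb : measurable_fun setT (fun p : mR * mR => `|(p.1 : R)| <= a).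
  by apply: measurable_fun_ler; [exact: measurableT_comp|exact: measurable_cst].
have It := cintegrable_bool mb (cintegrableZ 2^-1 (cintegrable_tensor Iq (L1R_norm_itv a))).
have := cintegrableD It (L1R2_oint_characteristic a Iq mk kB).
congr (cintegrable _ _ _); apply/funext => p; rewrite /char_u mulrDr; apply: (congr1 (fun z => z + _)).
by rewrite -indM; ring.
Qed.

Lemma L1R2_char_v : L1R2 (fun p => ind (box a p) * in_plane char_v p).
Proof.
apply: L1R2_box_rotate.
have := L1R2_swap (L1R2_oint_characteristic a Iq mkp kpB).
congr (cintegrable _ _ _); apply/funext => p; rewrite /= /box andbC; apply: (congr1 (GRing.mul _)).
by apply: eq_oint => al; exact: characteristic_swap.
Qed.

Lemma L1R2_kernel : L1R2 (fun p => ind (box a p) * k p.1 p.2).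
Proof. exact: (L1R2_box_bounded a mk (fun p => kB p.1 p.2)). Qed.

Lemma L1R2_mul_kernel : L1R2 (fun p => ind (box a p) * (qh p.1 * k p.1 p.2)).
Proof.
have mb : measurable_fun setT (fun p : mR * mR => `|(p.1 : R)| <= a).
  by apply: measurable_fun_ler; [exact: measurableT_comp|exact: measurable_cst].
have := cintegrable_bool mb (cintegrable_tensor Iq (L1R_norm_itv a)) => It.
have := cintegrableMr It mk (fun p => kB p.1 p.2).
by congr (cintegrable _ _ _); apply/funext => p; rewrite -indM; ring.
Qed.

Let IFv v : L1R (fun u => oint 0 v (F u)). Proof. exact: (L1R_oint_characteristic Iq mk kB). Qed.

Let Ichar_u v : L1R (fun u => char_u u v).
Proof. by apply: cintegrableD; [exact: cintegrableZ|exact: IFv]. Qed.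

Let Ichar_v u : L1R (char_v u).
Proof.
have := L1R_oint_characteristic Iq mkp kpB u.
by congr (cintegrable _ _ _); apply/funext => v; apply: eq_oint => al; exact: characteristic_swap.
Qed.

Let oint_char_u u v : oint 0 u (fun u => char_u u v) = 2^-1 * oint 0 u qh + oint 0 u (fun al => oint 0 v (F al)).
Proof.
rewrite (oint_prim1 0 u (Ichar_u v)) (oint_prim1 0 u Iq) (oint_prim1 0 u (IFv v)).
have e x : prim1 (fun u => char_u u v) x = 2^-1 * prim1 qh x + prim1 (fun al => oint 0 v (F al)) x.
  rewrite /char_u (prim1D _ (cintegrableZ 2^-1 Iq) (IFv v)); apply: (congr1 (fun z => z + _)).
  rewrite /prim1 -cintZ; first by apply: eq_I1 => s; rewrite mulrCA.
  by apply: cintegrable_bool Iq; exact: measurable_le_cst.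
by rewrite !e; ring.
Qed.

Section Test.
Context (phi : R * R -> R[i]).
Hypothesis tphi : test_function (Omega a)° phi.
Let D e := cD (diag e) phi.

(** At fixed v the equation is the integral of [char_u] from 0 to u, because the kernel vanishes at
    u = 0; the constant only converts this into a primitive from minus infinity. *)
Lemma weak_kernel_u : I2 (fun p => k p.1 p.2 * D 1 p) = - I2 (fun p => in_plane char_u p * phi p).
Proof.
apply: (pairing_u tphi (f1 := fun p => k p.1 p.2) (c := fun v => - prim1 (fun u => char_u u v) 0) L1R2_kernel L1R2_char_u Ichar_u).
move=> u v uv; rewrite in_planeE; split => //=.
by rewrite kE ?ltW// -oint_char_u (oint_prim1 0 u (Ichar_u v)) addrC.
Qed.

(** At fixed u the kernel is its value on v = 0, half the integral of q, plus the integral of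
    [char_v] from 0 to v, once the order of integration has been exchanged. *)
Lemma weak_kernel_v : I2 (fun p => k p.1 p.2 * D (-1) p) = - I2 (fun p => in_plane char_v p * phi p).
Proof.
apply: (pairing_v tphi (f1 := fun p => k p.1 p.2)
  (c := fun u => 2^-1 * oint 0 u qh - prim1 (char_v u) 0) L1R2_kernel L1R2_char_v Ichar_v).
move=> u v uv; rewrite in_planeE; split => //=.
rewrite kE ?ltW// (oint_fubini Iq mk kB) -/(char_v u) -[oint 0 v _]/(oint 0 v (char_v u)) (oint_prim1 0 v (Ichar_v u)).
by ring.
Qed.

(** The term q u / 2, which is merely integrable, is constant along lines of constant u, so it is
    never differentiated; the other term is an indefinite integral of q k in v. *)
Lemma weak_char_u : I2 (fun p => in_plane char_u p * D (-1) p) = - I2 (fun p => (qh p.1 * k p.1 p.2) * phi p).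
Proof.
apply: (pairing_v tphi (f1 := in_plane char_u) (f2 := fun p => qh p.1 * k p.1 p.2)
  (c := fun u => 2^-1 * qh u - prim1 (F u) 0) L1R2_char_u L1R2_mul_kernel (L1R_characteristic Iq mk kB)).
move=> u v uv; rewrite in_planeE; split => //=.
by rewrite /char_u (oint_prim1 0 v (L1R_characteristic Iq mk kB u)) -addrA [- _ + _]addrC.
Qed.

Lemma weak_char_v : I2 (fun p => in_plane char_v p * D 1 p) = - I2 (fun p => (qh p.1 * k p.1 p.2) * phi p).
Proof.
apply: (pairing_u tphi (f1 := in_plane char_v) (f2 := fun p => qh p.1 * k p.1 p.2)
  (c := fun v => - prim1 (fun u => F u v) 0) L1R2_char_v L1R2_mul_kernel (L1R_characteristic_swap Iq mk kB)).
move=> u v uv; rewrite in_planeE; split => //=.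
by rewrite /char_v (oint_prim1 0 u (L1R_characteristic_swap Iq mk kB v)) addrC.
Qed.

End Test.
End Identities.
End GoursatCharacteristics.

(** * The transmutation operator *)

Section TransmutationOperators.
Context {R : realType}.
Local Notation mR := (measurableTypeR R).
Local Notation I1 f := (cint (@leb R) setT f).
Local Notation L1R f := (cintegrable (@leb R) setT f).
Local Notation ind := (@ind R).

Lemma eq_oint_norm (x : R) (f g : R -> R[i]) : (forall s, `|s| <= `|x| -> f s = g s) ->
  oint 0 x f = oint 0 x g.
Proof.
move=> fg; rewrite /oint; have [x0|x0] := leP 0 x; last congr (- _).
  rewrite !cint_itv_I1; apply: eq_I1 => s; case: (boolP (_ <= s <= _)) => [/andP[s1 s2]|_]; last by rewrite ind0 !mul0r.
  by rewrite fg// !ger0_norm.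
rewrite !cint_itv_I1; apply: eq_I1 => s; case: (boolP (_ <= s <= _)) => [/andP[s1 s2]|_]; last by rewrite ind0 !mul0r.
by rewrite fg// (ler0_norm s2) (ltr0_norm x0) lerN2.
Qed.

Lemma volt_oint (kk : R -> R -> R[i]) (u v : R -> R[i]) (x : R) (K : R -> R[i]) :
  (forall t, `|t| <= `|x| -> K t = kk x t) -> (forall t, `|t| <= `|x| -> u t = v t) ->
  oint (- x) x (fun t => K t * u t) = volt kk v x.
Proof.
move=> Kk uv; rewrite /oint /volt; have -> : (- x <= x) = (0 <= x) by rewrite -subr_ge0 opprK -mulr2n pmulrn_lge0.
have [x0|x0] := leP 0 x; rewrite ?mul1r ?mulN1r; last congr (- _).
  rewrite cint_itv_I1; apply: eq_I1 => t; rewrite (ger0_norm x0) -ler_norml.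
  have [tx|_] := leP `|t| x; last by rewrite ind0 !mul0r.
  by rewrite !ind1 !mul1r Kk ?uv// (ger0_norm x0).
rewrite cint_itv_I1; apply: eq_I1 => t; rewrite (ltr0_norm x0) -[X in X <= t]opprK -ler_norml.
have [tx|_] := leP `|t| (- x); last by rewrite ind0 !mul0r.
by rewrite !ind1 !mul1r Kk ?uv// (ltr0_norm x0).
Qed.

Section Endpoints.
Context (a : R) (a0 : 0 < a).

(** The difference is kept as explicit functions carried by the end points, so that it is seen to be
    integrable and to have integral 0. *)
Lemma cutoff_clip (f : R -> R[i]) x : cutoff a f x =
  clip a f x + (f a * ind (a <= x <= a) + f (- a) * ind (- a <= x <= - a)).
Proof.
have h0 := a0; have na : a != - a by rewrite -subr_eq0 opprK gt_eqF// addr_gt0.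
rewrite -!eq_le /cutoff /clip.
have [<-|xa] := eqVneq a x.
  rewrite (ger0_norm (ltW a0)) lexx ltxx andbF [- a == a]eq_sym (negbTE na) !ind1 !ind0.
  by rewrite mul0r mul1r mulr0 mulr1 add0r addr0.
have [<-|xna] := eqVneq (- a) x.
  by rewrite normrN (ger0_norm (ltW a0)) lexx ltxx /= !ind1 !ind0 mul0r mul1r mulr0 mulr1 !add0r.
rewrite !ind0 !mulr0 !addr0; congr (ind _ * _).
by rewrite ler_norml !le_eqVlt (negbTE xna) [x == a]eq_sym (negbTE xa).
Qed.

Lemma L1R_endpoints (c d : R[i]) : L1R (fun x => c * ind (a <= x <= a) + d * ind (- a <= x <= - a)).
Proof. by apply: cintegrableD; apply: cintegrableZ; exact: L1R_itv. Qed.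

Lemma L1_cutoff (f : R -> R[i]) : L1 a f <-> L1R (cutoff a f).
Proof.
split=> [/(L1_clip a) If|If].
  rewrite (_ : cutoff a f = fun x => clip a f x + (f a * ind (a <= x <= a) + f (- a) * ind (- a <= x <= - a))).
    by apply: cintegrableD => //; exact: L1R_endpoints.
  by apply/funext => x; exact: cutoff_clip.
apply/(L1_clip a); rewrite (_ : clip a f = fun x => cutoff a f x - (f a * ind (a <= x <= a) + f (- a) * ind (- a <= x <= - a))).
  by apply: cintegrableB => //; exact: L1R_endpoints.
by apply/funext => x; rewrite cutoff_clip addrK.
Qed.

Lemma I1_endpoints (c d : R[i]) (g : R -> R[i]) :
  I1 (fun x => g x * (c * ind (a <= x <= a) + d * ind (- a <= x <= - a))) = 0.
Proof.
have e (b : R) (z : R[i]) : I1 (fun x => ind (b <= x <= b) * (z * g x)) = 0.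
  by rewrite -cint_itv_I1 cint_set1.
have L (b : R) (z : R[i]) : L1R (fun x => ind (b <= x <= b) * (z * g x)).
  have := cintegrableZ (z * g b) (L1R_itv b b); congr (cintegrable _ _ _); apply/funext => x.
  by rewrite -eq_le; have [->|] := eqVneq b x; rewrite ?ind1 ?ind0 ?mulr0 ?mul0r ?mul1r ?mulr1.
rewrite (_ : I1 _ = I1 (fun x => ind (a <= x <= a) * (c * g x) + ind (- a <= x <= - a) * (d * g x))).
  by rewrite cintD// !e addr0.
by apply: eq_I1 => x; ring.
Qed.

Lemma prim2_clip (f : R -> R[i]) x : L1R f -> (forall s, a < `|s| -> f s = 0) ->
  prim2 (clip a f) x = prim2 f x.
Proof.
move=> If fA; have Ic : L1R (clip a f) by apply/L1_clip/L1_cutoff; rewrite cutoff_supp.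
rewrite -[RHS]addr0 -(I1_endpoints (- f a) (- f (- a)) (fun s => (Num.max 0 (x - s))%:C)).
rewrite /prim2 -cintD.
- apply: eq_I1 => s; rewrite -mulrDr; congr (_ * _).
  by rewrite -[in X in _ = X + _](cutoff_supp fA) cutoff_clip; ring.
- exact: (L1R_prim2 If fA).
- apply: (L1R_prim2 (A := a)); first exact: L1R_endpoints.
  move=> s; rewrite -!eq_le => sa; have h0 := a0.
  rewrite (_ : a == s = false) 1?(_ : - a == s = false) ?ind0 ?mulr0 ?addr0//; apply/negbTE/eqP => e.
    by move: sa; rewrite -e normrN (ger0_norm (ltW a0)) ltxx.
  by move: sa; rewrite -e (ger0_norm (ltW a0)) ltxx.
Qed.

Section Representation.
Context (u f : R -> R[i]) (c0 c1 : R[i]).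
Hypotheses (If : L1R f) (fA : forall s, a < `|s| -> f s = 0).
Hypothesis uE : forall x, `|x| <= a -> u x = rep a c0 c1 f x.

Let Lf : L1 a f. Proof. by apply/L1_cutoff; rewrite cutoff_supp. Qed.

Let uE' x : - a <= x <= a ->
  u x = (c0 - prim2 f 0) + (c1 - prim1 f 0) * x%:C + prim2 (clip a f) x.
Proof.
rewrite -ler_norml => xa; rewrite (uE xa) (prim2_clip x If fA) /rep xa ind1 mul1r /jint; ring.
Qed.

Lemma W21_rep : W21 a u. Proof. exact: (W21_prim2 Lf uE'). Qed.
Lemma weak_deriv2_rep : weak_deriv2 a u f. Proof. exact: (weak_deriv2_prim2 Lf uE'). Qed.

Lemma rep_at0 : u 0 = c0.
Proof.
have h0 := a0; rewrite uE ?normr0 ?ltW// /rep normr0 (ltW a0) ind1 mul1r mulr0 addr0.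
by rewrite /jint mul0r subr0 subrr addr0.
Qed.

Lemma is_cderive_rep_at0 : is_cderive u 0 c1.
Proof.
have D := is_cderive_jint If fA c0 c1 0; rewrite subrr addr0 in D.
apply: (is_cderive_eq_near a0 _ D) => y; rewrite subr0 => ya.
by rewrite (uE (ltW ya)) /rep (ltW ya) ind1 mul1r.
Qed.
End Representation.

Lemma W21_representation (u h : R -> R[i]) : W21 a u -> weak_deriv2 a u h ->
  exists c0 c1, forall x, `|x| <= a -> u x = rep a c0 c1 (clip a h) x.
Proof.
move=> [Lu [cu _] _] uh; have [c0 [c1 E]] := weak_deriv2_representation a0 cu Lu uh.
exists (c0 + prim2 (clip a h) 0), (c1 + prim1 (clip a h) 0) => x xa.
by rewrite /rep xa ind1 mul1r /jint E -?ler_norml//; ring.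
Qed.

(** Coefficients and exponents are separate sequences, so that differentiation stays within this
    form and a polynomial can be fed to [rep_C2]. *)
Definition power_sum (n : nat) (c : nat -> R[i]) (e : nat -> nat) (x : R) : R[i] :=
  \sum_(i < n) c i * x%:C ^+ e i.

Lemma is_cderive_powers n c e x :
  is_cderive (power_sum n c e) x (power_sum n (fun i => c i * (e i)%:R) (fun i => (e i).-1) x).
Proof.
elim: n => [|n IH].
  rewrite /power_sum big_ord0; under eq_fun do rewrite big_ord0.
  exact: is_cderive_cst.
rewrite /power_sum big_ord_recr/= -mulrA; under eq_fun do rewrite big_ord_recr/=.
by apply: is_cderiveD; [exact: IH|apply: is_cderiveZ; exact: is_cderiveX].
Qed.

Lemma W21_poly (p : {poly R[i]}) : W21 a (fun x => p.[x%:C]).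
Proof.
have E (x : R) : p.[x%:C] = power_sum (size p) (fun i => p`_i) id x by rewrite horner_coef.
have D := is_cderive_powers (size p).
have Ch := is_cderive_ccontinuous (D (fun i => p`_i * i%:R * i.-1%:R) (fun i => i.-2)).
have RE := rep_C2 a (D (fun i => p`_i) id) (D (fun i => p`_i * i%:R) predn) Ch.
have uE x (xa : `|x| <= a) := etrans (E x) (etrans (esym (cut_in _ xa)) (congr1 (fun f => f x) RE)).
exact: (W21_rep (L1R_cutoff_continuous a Ch) (fun s => @cut_out R a _ s) uE).
Qed.

Section Operators.
Context (q : R -> R[i]) (k K : R -> R -> R[i]) (B : R).
Hypothesis qL : L1 a q.
Let qh := cutoff a q.
Hypotheses (mk : cmeasurable (fun p : mR * mR => k p.1 p.2)) (kB : forall x t, cnorm1 (k x t) <= B).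
Hypothesis kE : kernel_equation a qh k.
Hypothesis Kk : forall x t, `|x| <= a -> `|t| <= a -> K x t = k x t.

Let kT x t := k t x.
Let mkT : cmeasurable (fun p : mR * mR => kT p.1 p.2).
Proof. exact: cmeasurable_swap mk. Qed.
Let kTB x t : cnorm1 (kT x t) <= B. Proof. exact: kB. Qed.
Let Iq : L1R qh. Proof. exact/L1_cutoff. Qed.
Let qA s : a < `|s| -> qh s = 0. Proof. exact: cut_out. Qed.

Lemma T_op_top (u v : R -> R[i]) x : `|x| <= a -> (forall t, `|t| <= `|x| -> u t = v t) ->
  T_op K u x = top a k v x.
Proof.
move=> xa uv; rewrite /top (cut_in _ xa) /T_op uv//; apply: (congr1 (GRing.add _)).
by apply: volt_oint => // t tx; apply: Kk => //; exact: le_trans tx xa.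
Qed.

Lemma T_inv_sop (u v : R -> R[i]) x : `|x| <= a -> (forall t, `|t| <= `|x| -> u t = v t) ->
  T_inv K u x = sop a k v x.
Proof.
move=> xa uv; rewrite /sop (cut_in _ xa) /T_inv uv//; apply: (congr1 (fun z => v x - z)).
by apply: volt_oint => // t tx; apply: Kk => //; exact: le_trans tx xa.
Qed.

Let clip_le (u : R -> R[i]) (x t : R) : `|x| < a -> `|t| <= `|x| -> u t = clip a u t.
Proof. by move=> xa tx; rewrite clip_in// -ltr_norml; exact: le_lt_trans xa. Qed.

Lemma T_op_clip u (x : R) : `|x| < a -> T_op K u x = top a k (clip a u) x.
Proof. by move=> xa; apply: T_op_top; [exact: ltW|move=> t; exact: clip_le]. Qed.

Lemma T_inv_clip u (x : R) : `|x| < a -> T_inv K u x = sop a k (clip a u) x.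
Proof. by move=> xa; apply: T_inv_sop; [exact: ltW|move=> t; exact: clip_le]. Qed.

Let L1_of (w g : R -> R[i]) : L1R g -> (forall x : R, `|x| < a -> w x = g x) -> L1 a w.
Proof.
move=> Ig wg; apply/(L1_clip a).
rewrite (_ : clip a w = fun x => ind (- a < x < a) * g x).
  by apply: cintegrable_bool => //; apply: measurable_and; apply: measurable_fun_ltr => //; exact: measurable_cst.
apply/funext => x; rewrite /clip; case: (boolP (- a < x < a)) => [xa|_]; last by rewrite !ind0 !mul0r.
by rewrite wg// ltr_norml.
Qed.

Lemma L1_T_op u : L1 a u -> L1 a (T_op K u).
Proof.
move=> /(L1_clip a) Iu; exact: (L1_of (L1R_top a mk kB Iu) (fun x xa => T_op_clip u xa)).
Qed.

Lemma L1_T_inv u : L1 a u -> L1 a (T_inv K u).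
Proof.
move=> /(L1_clip a) Iu; exact: (L1_of (L1R_sop a mk kB Iu) (fun x xa => T_inv_clip u xa)).
Qed.

Lemma T_inv_T_op u (x : R) : L1 a u -> `|x| < a -> T_inv K (T_op K u) x = u x.
Proof.
move=> /(L1_clip a) Iu xa.
rewrite (@T_inv_sop _ (top a k (clip a u)) _ (ltW xa)); last first.
  by move=> t tx; apply: T_op_clip; exact: le_lt_trans xa.
rewrite (sop_top a0 Iq mk kB kE Iu); last exact: clip_supp.
by rewrite -(clip_le u xa (lexx _)).
Qed.

Lemma T_op_T_inv u (x : R) : L1 a u -> `|x| < a -> T_op K (T_inv K u) x = u x.
Proof.
move=> /(L1_clip a) Iu xa.
rewrite (@T_op_top _ (sop a k (clip a u)) _ (ltW xa)); last first.
  by move=> t tx; apply: T_inv_clip; exact: le_lt_trans xa.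
rewrite (top_sop a0 Iq mk kB kE Iu); last exact: clip_supp.
by rewrite -(clip_le u xa (lexx _)).
Qed.

End Operators.
End Endpoints.
End TransmutationOperators.

(** * Transmutation property and inverse on L^1(-a, a) *)

Section TransmutationTheorem.
Context {R : realType}.
Local Notation mR := (measurableTypeR R).
Local Notation I1 f := (cint (@leb R) setT f).
Local Notation L1R f := (cintegrable (@leb R) setT f).
Local Notation ind := (@ind R).
Context (a : R) (a0 : 0 < a).

(** With |u| + |v| <= a, all arguments met in the double integral remain where the extended kernel
    is H and the cut-off potential is q. *)
Lemma kernel_equation_H (q : R -> R[i]) (H : R -> R -> R[i]) : H_equation a q H ->
  kernel_equation a (cutoff a q) (extended_kernel a H).
Proof.
move=> HE; have KE (u v : R) : `|u| + `|v| <= a -> extended_kernel a H (u + v) (u - v) = H u v.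
  move=> uv; rewrite extended_kernelE; last 2 first.
  - exact: le_trans (ler_normD _ _) uv.
  - exact: le_trans (ler_normB _ _) uv.
  by rewrite /goursat_kernel; congr H; field.
move=> u v uv; apply: (etrans (KE u v uv)); apply: (etrans (HE u v uv)).
have ua : `|u| <= a by apply: le_trans uv; rewrite lerDl.
rewrite (oint_cutoff q ua); apply: (congr1 (GRing.add _)); apply: eq_oint_norm => al alu.
apply: eq_oint_norm => be bev.
have ab : `|al| + `|be| <= a by apply: le_trans uv; exact: lerD.
by rewrite (KE al be ab) (cut_in _ (le_trans (ler_normD _ _) ab)).
Qed.

Lemma ae_clip (u v : R -> R[i]) : ae_eq_on a u v -> {ae @leb R, forall x : R, clip a u x = clip a v x}.
Proof.
have aeF := ae_filter_ringOfSetsType (@leb R); apply: filterS => x xuv; rewrite /clip.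
case: (boolP (- a < x < a)) => [xa|_]; last by rewrite !ind0 !mul0r.
by rewrite xuv// in_itv.
Qed.

Lemma ae_volt (k : R -> R -> R[i]) (B : R) (v w : R -> R[i]) (x : R) :
  cmeasurable (fun p : mR * mR => k p.1 p.2) -> (forall x t, cnorm1 (k x t) <= B) ->
  L1R v -> L1R w -> {ae @leb R, forall x : R, v x = w x} -> volt k v x = volt k w x.
Proof.
move=> mk kB Iv Iw vw; have aeF := ae_filter_ringOfSetsType (@leb R).
have Id := cintegrableB Iv Iw.
apply/eqP; rewrite -subr_eq0 -(voltB mk kB)//; apply/eqP; apply: cnorm1_eq0.
apply: (le_trans (cnorm1_volt mk kB x Id)).
rewrite (_ : \int[leb]_t cnorm1 (v t - w t) = 0) ?mulr0//.
rewrite /Rintegral (ae_eq_integral (cst 0%E))//.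
- by rewrite integral0.
- by apply/measurable_EFinP; apply: measurable_cnorm1; exact: cintegrable_measurable Id.
- by move: vw; apply: filterS => t vt _; rewrite /= vt subrr cnorm1_0.
Qed.

Section Operators.
Context (q : R -> R[i]) (k K : R -> R -> R[i]) (B : R).
Hypothesis qL : L1 a q.
Let qh := cutoff a q.
Hypotheses (mk : cmeasurable (fun p : mR * mR => k p.1 p.2)) (kB : forall x t, cnorm1 (k x t) <= B).
Hypothesis kE : kernel_equation a qh k.
Hypothesis Kk : forall x t, `|x| <= a -> `|t| <= a -> K x t = k x t.
Let kT x t := k t x.
Let mkT : cmeasurable (fun p : mR * mR => kT p.1 p.2).
Proof. exact: cmeasurable_swap mk. Qed.
Let kTB x t : cnorm1 (kT x t) <= B. Proof. exact: kB. Qed.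
Let Iq : L1R qh. Proof. exact/L1_cutoff. Qed.

Let itvE (x : R) : x \in `]-a, a[ -> `|x| < a.
Proof. by rewrite in_itv/= ltr_norml. Qed.

Let clipL c (u v : R -> R[i]) : clip a (fun x => c * u x + v x) = fun x => c * clip a u x + clip a v x.
Proof. by apply/funext => x; rewrite /clip; ring. Qed.

Let topE v x : `|x| <= a -> top a k v x = v x + volt k v x.
Proof. by move=> xa; rewrite /top cut_in. Qed.

Let sopE v x : `|x| <= a -> sop a k v x = v x - volt kT v x.
Proof. by move=> xa; rewrite /sop cut_in. Qed.

Let L1_linear (c : R[i]) u v : L1 a u -> L1 a v -> L1 a (fun x => c * u x + v x).
Proof.
move=> /(L1_clip a) Iu /(L1_clip a) Iv; apply/(L1_clip a); rewrite clipL.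
by apply: cintegrableD => //; exact: cintegrableZ.
Qed.

Let L1_0 : L1 a (fun=> 0).
Proof.
apply/(L1_clip a); rewrite (_ : clip a _ = fun=> 0); first exact: cintegrable0.
by apply/funext => x; rewrite /clip mulr0.
Qed.

Lemma linear_T_op : linear_operator a (L1 a) (T_op K).
Proof.
have aeF := ae_filter_ringOfSetsType (@leb R).
split; [by split; [move=> u|exact: L1_0]|exact: L1_linear| | | ].
- by move=> u Lu; exact: (L1_T_op mk kB Kk Lu).
- move=> u v Lu Lv uv; have cuv := ae_clip uv.
  move: (uv); apply: filterS => x xuv xa; have xa' := itvE xa.
  rewrite !(T_op_clip Kk)// !topE ?ltW//; apply: (f_equal2 +%R).
    by rewrite !clip_in ?xuv// -ltr_norml.
  by apply: (ae_volt _ mk kB) => //; exact/(L1_clip a).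
- move=> c u v /(L1_clip a) Iu /(L1_clip a) Iv; apply: aeW => x xa; have xa' := itvE xa.
  rewrite !(T_op_clip Kk)// !topE ?ltW// clipL (voltD mk kB) ?(voltZ mk kB)//; first by ring.
  exact: cintegrableZ.
Qed.

Lemma linear_T_inv : linear_operator a (L1 a) (T_inv K).
Proof.
have aeF := ae_filter_ringOfSetsType (@leb R).
split; [by split; [move=> u|exact: L1_0]|exact: L1_linear| | | ].
- by move=> u Lu; exact: (L1_T_inv mk kB Kk Lu).
- move=> u v Lu Lv uv; have cuv := ae_clip uv.
  move: (uv); apply: filterS => x xuv xa; have xa' := itvE xa.
  rewrite !(T_inv_clip Kk)// !sopE ?ltW//; apply: (f_equal2 (fun y z => y - z)).
    by rewrite !clip_in ?xuv// -ltr_norml.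
  by apply: (ae_volt _ mkT kTB) => //; exact/(L1_clip a).
- move=> c u v /(L1_clip a) Iu /(L1_clip a) Iv; apply: aeW => x xa; have xa' := itvE xa.
  rewrite !(T_inv_clip Kk)// !sopE ?ltW// clipL (voltD mkT kTB) ?(voltZ mkT kTB)//; first by ring.
  exact: cintegrableZ.
Qed.

Lemma inverse_T_op : inverse_operator a (L1 a) (T_op K) (T_inv K).
Proof.
split; [exact: linear_T_op|exact: linear_T_inv| | |].
- by move=> u Lu; split; [exact: (L1_T_op mk kB Kk Lu)|exact: (L1_T_inv mk kB Kk Lu)].
- by move=> u Lu; apply: aeW => x /itvE xa; exact: (T_inv_T_op a0 qL mk kB kE Kk Lu xa).
- by move=> u Lu; apply: aeW => x /itvE xa; exact: (T_op_T_inv a0 qL mk kB kE Kk Lu xa).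
Qed.

(** [top_rep] presents T u in normal form with second derivative w = q (T u) + T f; regularity, the
    equation and the data at 0 are all read off from it. *)
Lemma T_op_rep (u f : R -> R[i]) c0 c1 : L1R f -> (forall s, a < `|s| -> f s = 0) ->
  (forall x, `|x| <= a -> u x = rep a c0 c1 f x) ->
  [/\ W21 a (T_op K u),
    exists w, weak_deriv2 a (T_op K u) w /\
      forall x : R, `|x| < a -> w x - q x * T_op K u x = top a k f x,
    T_op K u 0 = c0 & is_cderive (T_op K u) 0 c1].
Proof.
move=> If fA uE; pose w y := qh y * top a k (rep a c0 c1 f) y + top a k f y.
have Iw : L1R w.
  by apply: cintegrableD; [exact: (L1R_mul_top Iq mk kB c0 c1 If fA)|exact: (L1R_top a mk kB If)].
have wA s : a < `|s| -> w s = 0 by move=> h; rewrite /w !top_out// mulr0 addr0.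
have TE x : `|x| <= a -> T_op K u x = top a k (rep a c0 c1 f) x.
  by move=> xa; apply: (T_op_top Kk xa) => t tx; rewrite uE//; exact: le_trans tx xa.
have TR x : `|x| <= a -> T_op K u x = rep a c0 c1 w x.
  by move=> xa; rewrite TE// (top_rep Iq mk kB kE c0 c1 If fA).
split.
- exact: (W21_rep a0 Iw wA TR).
- exists w; split; first exact: (weak_deriv2_rep a0 Iw wA TR).
  by move=> x xa; rewrite /w TE ?ltW// /qh cut_in ?ltW// addrAC subrr add0r.
- exact: (rep_at0 a0 TR).
- exact: (is_cderive_rep_at0 a0 Iw wA TR).
Qed.

Lemma transmutation_T_op : transmutation_operator a q (L1 a) (T_op K) (W21 a).
Proof.
split; [exact: linear_T_op|by []|by move=> u []|].
(* Valid for every weak second derivative of u, as the definition of a transmutation operator ranges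
   over all its representatives. *)
move=> u Wu; have key h : weak_deriv2 a u h -> L1R (clip a h) /\
    exists c0 c1, forall x, `|x| <= a -> u x = rep a c0 c1 (clip a h) x.
  move=> uh; split; last exact: (W21_representation a0 Wu uh).
  by case: uh => g [_ /(L1_clip a)].
split.
  have [_ _ [h /key [Ih [c0 [c1 uE]]]]] := Wu.
  by have [] := T_op_rep Ih (@clip_supp R a h) uE.
move=> u2 uu2; have [Ih [c0 [c1 uE]]] := key _ uu2.
split; first exact/(L1_clip a).
have [_ [w [Tw wE]] _ _] := T_op_rep Ih (@clip_supp R a u2) uE.
exists w; split => //; apply: aeW => x /itvE xa.
by rewrite wE// (T_op_clip Kk).
Qed.

Lemma T_op_monomial n : [/\ W21 a (T_op K (monomial n)),
    exists w, weak_deriv2 a (T_op K (monomial n)) w /\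
      ae_eq_on a (fun x => w x - q x * T_op K (monomial n) x)
      (fun x => if (n < 2)%N then 0 else (n * (n - 1))%N%:R * T_op K (monomial (n - 2)) x),
    T_op K (monomial n) 0 = 0 ^+ n & is_cderive (T_op K (monomial n)) 0 (n%:R * 0 ^+ n.-1)].
Proof.
have If := cintegrableZ (n * n.-1)%N%:R (L1R_mono a n.-2).
have fA s : a < `|s| -> (n * n.-1)%N%:R * mono a n.-2 s = 0.
  by move=> h; rewrite mono_out// mulr0.
have uE x : `|x| <= a -> monomial n x = rep a (0 ^+ n) (n%:R * 0 ^+ n.-1)
    (fun y => (n * n.-1)%N%:R * mono a n.-2 y) x.
  by move=> xa; rewrite -mono_rep /mono cut_in.
have [h1 [w [h2 h3]] h4 h5] := T_op_rep If fA uE.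
split => //; exists w; split => //; apply: aeW => x /itvE xa; rewrite h3//.
have xa' := ltW xa; rewrite topE// (voltZ mk kB); last exact: L1R_mono.
rewrite -mulrDr -topE//.
rewrite (_ : top a k (mono a n.-2) x = T_op K (monomial n.-2) x); last first.
  by rewrite (T_op_top Kk xa' (v := mono a n.-2))// => t tx; rewrite /mono cut_in//; exact: le_trans tx xa'.
(* For n < 2 the coefficient n * n.-1 vanishes; from 2 on the predecessors and the subtractions
   agree. *)
case: n {If fA uE h1 h2 h3 h4 h5} => [|[|n]] /=; rewrite ?mul0r ?muln0 ?mul0r//.
by rewrite subn1 subn2.
Qed.

Lemma standard_T_op : standard_transmutation_operator a q (L1 a) (T_op K) (W21 a).
Proof.
split; first exact: transmutation_T_op.
  by move=> p; exact: W21_poly.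
split.
  by split=> n; have [] := T_op_monomial n.
move=> n n2; have [_ _ -> D] := T_op_monomial n.
by case: n n2 D => [|[|n]]//= _; rewrite !expr0n/= mulr0.
Qed.

End Operators.
End TransmutationTheorem.

(** * The weak solution of the Goursat problem *)

Section GoursatProblem.
Context {R : realType}.
Local Notation mR := (measurableTypeR R).
Local Notation I2 f := (cint (@leb2 R) setT f).
Local Notation L1R2 f := (cintegrable (@leb2 R) setT f).
Local Notation ind := (@ind R).
Context (a : R) (a0 : 0 < a).

Lemma mem_Omega (p : R * R) : (p \in Omega a) = box a p.
Proof.
apply/idP/idP => [/set_mem[]|/andP[p1 p2]]; first by rewrite /box/= !in_itv/= -!ler_norml => -> ->.
by apply: mem_set; split; rewrite /= in_itv/= -ler_norml.
Qed.

Lemma cint_Omega (f g : R * R -> R[i]) : (forall p, box a p -> f p = g p) ->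
  (forall p, ~~ box a p -> g p = 0) -> cint leb2 (Omega a) f = I2 g.
Proof.
move=> fg g0; rewrite cint_mkcond; congr (cint _ _ _); apply/funext => p.
rewrite mem_Omega; have [pb|npb] := boolP (box a p); first by rewrite ind1 mul1r fg.
by rewrite ind0 mul0r g0.
Qed.

Lemma cintegrable_Omega (f g : R * R -> R[i]) : L1R2 (fun p => ind (box a p) * g p) ->
  (forall p, box a p -> f p = g p) -> cintegrable leb2 (Omega a) f.
Proof.
move=> Ig fg; apply/cintegrable_mkcond; first by apply: measurableX; exact: measurable_itv.
move: Ig; congr (cintegrable _ _ _); apply/funext => p; rewrite mem_Omega.
by have [pb|npb] := boolP (box a p); rewrite ?ind0 ?mul0r// fg.
Qed.

Lemma cD_diag (phi : R * R -> R[i]) (e : R) (p : R * R) : smooth (re phi) -> smooth (im phi) -> `|e| <= 1 ->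
  cD (diag e) phi p = cD dirx phi p + e%:C * cD dirt phi p.
Proof.
move=> s1 s2 e1; apply: complex_eqP.
  by rewrite cReD cReM /= mul0r subr0 (derive_direction _ s1 e1).
by rewrite cImD cImM /= mul0r addr0 (derive_direction _ s2 e1).
Qed.

Section Solution.
Context (q : R -> R[i]) (k K : R -> R -> R[i]) (B : R).
Hypothesis qL : L1 a q.
Let qh := cutoff a q.
Hypotheses (mk : cmeasurable (fun p : mR * mR => k p.1 p.2)) (kB : forall x t, cnorm1 (k x t) <= B).
Hypothesis kE : kernel_equation a qh k.
Hypothesis Kk : forall x t, `|x| <= a -> `|t| <= a -> K x t = k x t.
Let Iq : cintegrable (@leb R) setT qh. Proof. exact/L1_cutoff. Qed.

Let g := in_plane (char_u qh k).
Let h := in_plane (char_v qh k).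
(** In the coordinates x = u + v, t = u - v, the derivatives in u and v are the sum and the
    difference of those in x and t. *)
Let Kx p := 2^-1 * (g p + h p).
Let Kt p := 2^-1 * (g p - h p).
Let Ig : L1R2 (fun p => ind (box a p) * g p). Proof. exact: (L1R2_char_u a Iq mk kB). Qed.
Let Ih : L1R2 (fun p => ind (box a p) * h p). Proof. exact: (L1R2_char_v a Iq mk kB). Qed.
Let Ik : L1R2 (fun p => ind (box a p) * k p.1 p.2). Proof. exact: (L1R2_kernel a mk kB). Qed.
Let Iqk : L1R2 (fun p => ind (box a p) * (qh p.1 * k p.1 p.2)). Proof. exact: (L1R2_mul_kernel a Iq mk kB). Qed.

Let IKx : L1R2 (fun p => ind (box a p) * Kx p).
Proof.
have := cintegrableZ 2^-1 (cintegrableD Ig Ih).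
by congr (cintegrable _ _ _); apply/funext => p; rewrite /Kx; ring.
Qed.

Let IKt : L1R2 (fun p => ind (box a p) * Kt p).
Proof.
have := cintegrableZ 2^-1 (cintegrableB Ig Ih).
by congr (cintegrable _ _ _); apply/funext => p; rewrite /Kt; ring.
Qed.

Let KkO p : box a p -> unc K p = k p.1 p.2.
Proof. by move=> /andP[p1 p2]; exact: Kk. Qed.

Let I2lin (c : R[i]) (f1 f2 : R * R -> R[i]) : L1R2 f1 -> L1R2 f2 ->
  I2 (fun p => c * (f1 p + f2 p)) = c * (I2 f1 + I2 f2).
Proof. by move=> H1 H2; rewrite cintZ ?cintD//; exact: cintegrableD. Qed.

Section Test.
Context (phi : R * R -> R[i]).
Hypothesis tphi : test_function (Omega a)° phi.
Let D1 := cD (diag 1) phi.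
Let Dm := cD (diag (-1)) phi.

Let out p : ~~ box a p -> phi p = 0 /\ forall d, cD d phi p = 0.
Proof.
move=> np; have [_ _ _ zl] := plane_test_function tphi; apply: zl => -[h1 h2].
by move/negP: np; apply; apply/andP; split; exact: ltW.
Qed.

Let mul_phi f : L1R2 (fun p => ind (box a p) * f p) -> L1R2 (fun p => f p * phi p).
Proof.
have [_ _ [c1 c2] zl] := plane_test_function tphi => If.
exact: (L1R2_box_mul If c1 c2 (fun p np => (zl p np).1)).
Qed.

Let mul_D f d : L1R2 (fun p => ind (box a p) * f p) -> L1R2 (fun p => f p * cD d phi p).
Proof.
have [_ cl _ zl] := plane_test_function tphi => If; have [c1 c2] := cl d.
exact: (L1R2_box_mul If c1 c2 (fun p np => (zl p np).2 d)).
Qed.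

Let D1E p : D1 p = cD dirx phi p + cD dirt phi p.
Proof. by case: tphi => s1 s2 _ _; rewrite /D1 cD_diag ?normr1// mul1r. Qed.

Let DmE p : Dm p = cD dirx phi p - cD dirt phi p.
Proof. by case: tphi => s1 s2 _ _; rewrite /Dm cD_diag ?normrN1// rmorphN mulN1r. Qed.

Let DxE p : cD dirx phi p = 2^-1 * (D1 p + Dm p).
Proof. by rewrite D1E DmE; field. Qed.

Let DtE p : cD dirt phi p = 2^-1 * (D1 p - Dm p).
Proof. by rewrite D1E DmE; field. Qed.

Let wku := weak_kernel_u Iq mk kB kE tphi.
Let wkv := weak_kernel_v Iq mk kB kE tphi.
Let wcu := weak_char_u Iq mk kB tphi.
Let wcv := weak_char_v Iq mk kB tphi.

Lemma weak_partial_x : cint leb2 (Omega a) (fun p => unc K p * cD dirx phi p) =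
  - cint leb2 (Omega a) (fun p => Kx p * phi p).
Proof.
rewrite (@cint_Omega _ (fun p => 2^-1 * (k p.1 p.2 * D1 p + k p.1 p.2 * Dm p))); last 2 first.
- by move=> p pb; rewrite KkO// DxE; ring.
- by move=> p /out[_ z]; rewrite /D1 /Dm !z; ring.
rewrite (@cint_Omega _ (fun p => 2^-1 * (g p * phi p + h p * phi p))); last 2 first.
- by move=> p pb; rewrite /Kx; ring.
- by move=> p /out[-> _]; ring.
rewrite (I2lin _ (mul_D _ Ik) (mul_D _ Ik)) (I2lin _ (mul_phi Ig) (mul_phi Ih)).
by rewrite /D1 /Dm wku wkv; ring.
Qed.

Lemma weak_partial_t : cint leb2 (Omega a) (fun p => unc K p * cD dirt phi p) =
  - cint leb2 (Omega a) (fun p => Kt p * phi p).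
Proof.
have neg f : L1R2 f -> L1R2 (fun p => - f p) by exact: cintegrableN.
rewrite (@cint_Omega _ (fun p => 2^-1 * (k p.1 p.2 * D1 p + - (k p.1 p.2 * Dm p)))); last 2 first.
- by move=> p pb; rewrite KkO// DtE; ring.
- by move=> p /out[_ z]; rewrite /D1 /Dm !z; ring.
rewrite (@cint_Omega _ (fun p => 2^-1 * (g p * phi p + - (h p * phi p)))); last 2 first.
- by move=> p pb; rewrite /Kt; ring.
- by move=> p /out[-> _]; ring.
rewrite (I2lin _ (mul_D _ Ik) (neg _ (mul_D _ Ik))) (I2lin _ (mul_phi Ig) (neg _ (mul_phi Ih))).
by rewrite (cintN (mul_D _ Ik)) (cintN (mul_phi Ih)) /D1 /Dm wku wkv; ring.
Qed.

(** Kt phi_t - Kx phi_x equals - 1/2 (g D_(1, -1) phi + h D_(1, 1) phi): in characteristic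
    directions only mixed products occur. Each of the two integrates to minus the integral of q K
    phi, which balances the potential term. *)
Lemma weak_wave_equation : cint leb2 (Omega a) (fun p =>
  Kt p * cD dirt phi p - Kx p * cD dirx phi p - q p.1 * unc K p * phi p) = 0.
Proof.
pose f1 p := g p * Dm p + h p * D1 p; pose f2 p := 2 * (qh p.1 * k p.1 p.2 * phi p).
have I1f : L1R2 f1 by apply: cintegrableD; exact: mul_D.
have I2f : L1R2 f2 by apply: cintegrableZ; exact: mul_phi.
rewrite (@cint_Omega _ (fun p => - 2^-1 * (f1 p + f2 p))); last 2 first.
- move=> p pb; have /andP[p1 _] := pb.
  by rewrite KkO// DtE DxE /f1 /f2 /qh cut_in// /Kt /Kx; field.
- by move=> p /out[zp z]; rewrite /f1 /f2 /D1 /Dm !z zp; ring.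
rewrite (I2lin _ I1f I2f) (cintD (mul_D _ Ig) (mul_D _ Ih)) (cintZ _ (mul_phi Iqk)).
rewrite /D1 /Dm wcu wcv; ring.
Qed.
End Test.

Lemma Goursat_weak : exists Kx' Kt' : R * R -> R[i], W11_grad a (unc K) Kx' Kt' /\
  forall phi : R * R -> R[i], test_function (Omega a)° phi ->
    cint leb2 (Omega a) (fun p =>
      Kt' p * cD dirt phi p - Kx' p * cD dirx phi p - q p.1 * unc K p * phi p) = 0.
Proof.
exists Kx, Kt; split; last exact: weak_wave_equation.
split; [exact: (cintegrable_Omega Ik KkO)|exact: (cintegrable_Omega IKx)|exact: (cintegrable_Omega IKt)| | ].
  exact: weak_partial_x.
exact: weak_partial_t.
Qed.
End Solution.

Lemma oint_same (f : R -> R[i]) : oint 0 0 f = 0.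
Proof. by rewrite /oint lexx cint_set1. Qed.

Lemma oint_cst0 (x y : R) : oint x y (fun=> 0 : R[i]) = 0.
Proof.
have z (u v : R) : cint (@leb R) `[u, v] (fun=> 0) = 0.
  rewrite cint_itv_I1; transitivity (cint (@leb R) setT (fun=> 0)); last exact: cint0.
  by apply: eq_I1 => s; rewrite mulr0.
by rewrite /oint !z oppr0 if_same.
Qed.

Lemma Goursat_solution (q : R -> R[i]) (H : R -> R -> R[i]) : L1 a q ->
  ccontinuous_on (Omega1 a) (unc H) -> H_equation a q H ->
  Goursat_weak_solution a q (goursat_kernel H).
Proof.
move=> qL Hc HE; have [B kB] := extended_kernel_bounded a0 Hc.
have mk := extended_kernel_measurable a0 Hc.
have kE := kernel_equation_H HE.
have Kk x t : `|x| <= a -> `|t| <= a -> goursat_kernel H x t = extended_kernel a H x t.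
  by move=> xa ta; rewrite extended_kernelE.
have KO p : p \in Omega a -> unc (goursat_kernel H) p = unc (extended_kernel a H) p.
  by rewrite mem_Omega => /andP[p1 p2]; exact: Kk.
split.
- have [c1 c2] := continuous_extended_kernel a0 Hc; split.
    apply: (@subspace_eq_continuous _ _ _ (re (unc (extended_kernel a H)))).
      by move=> p pO; rewrite /from_subspace/= /re KO.
    exact: continuous_subspaceT.
  apply: (@subspace_eq_continuous _ _ _ (im (unc (extended_kernel a H)))).
    by move=> p pO; rewrite /from_subspace/= /im KO.
  exact: continuous_subspaceT.
- exact: (Goursat_weak qL mk kB kE Kk).
- move=> x; rewrite in_itv/= -ler_norml => xa; rewrite /goursat_kernel subrr mul0r.
  rewrite (_ : (x + x) / 2 = x); last by field.
  rewrite HE; last by rewrite /Omega1/= normr0 addr0.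
  rewrite -[RHS]addr0; apply: (congr1 (GRing.add _)).
  transitivity (oint 0 x (fun=> 0)); last exact: oint_cst0.
  by apply: eq_oint => s; exact: oint_same.
- move=> x; rewrite in_itv/= -ler_norml => xa; rewrite /goursat_kernel subrr mul0r opprK.
  rewrite (_ : (x + x) / 2 = x); last by field.
  rewrite HE; last by rewrite /Omega1/= normr0 add0r.
  by rewrite !oint_same mulr0 addr0.
Qed.
End GoursatProblem.

Theorem theorem21 (R : realType) (a : R) (a_gt0 : 0 < a)
    (q : R -> R[i]) (q_L1 : L1 a q)
    (H : R -> R -> R[i]) (H_cont : ccontinuous_on (Omega1 a) (unc H))
    (H_eq : H_equation a q H) :
  let K := goursat_kernel H in
  let alpha := fun k => T_op K (monomial k) in
  [/\ Goursat_weak_solution a q K,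
      standard_transmutation_operator a q (L1 a) (T_op K) (W21 a),
      alpha 0%N 0 = 1 /\ is_cderive (alpha 1%N) 0 1,
      is_cderive (alpha 0%N) 0 0 /\ alpha 1%N 0 = 0 &
      inverse_operator a (L1 a) (T_op K) (T_inv K)].
Proof.
move=> K alpha; have [B kB] := extended_kernel_bounded a_gt0 H_cont.
have mk := extended_kernel_measurable a_gt0 H_cont.
have kE := kernel_equation_H H_eq.
have Kk x t : `|x| <= a -> `|t| <= a -> K x t = extended_kernel a H x t.
  by move=> xa ta; rewrite extended_kernelE.
have [_ _ b0 d0] := T_op_monomial a_gt0 q_L1 mk kB kE Kk 0.
have [_ _ b1 d1] := T_op_monomial a_gt0 q_L1 mk kB kE Kk 1.
split.
- exact: Goursat_solution.
- exact: (standard_T_op a_gt0 q_L1 mk kB kE Kk).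
- by split; [rewrite /alpha b0 expr0|move: d1; rewrite /= expr0 mulr1].
- by split; [move: d0; rewrite /= mul0r|rewrite /alpha b1 expr1].
- exact: (inverse_T_op a_gt0 q_L1 mk kB kE Kk).
Qed.
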